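(* Let $\varphi:[0,\infty)\to(0,\infty)$ be decreasing and regularly varying of index $-1$. Let $V\in\mathcal{L}_\varphi(\mathcal{H})$ be strictly positive and let $(e_n)_{n\in\mathbb{N}}$ be an orthonormal eigenbasis for $V$ ordered so that $Ve_n=\mu(n,V)e_n$, $n\ge0$. If $G\in\mathbb{B}(\mathcal{H})$ is weakly $\varphi$-modulated with respect to $V$, then for every extended limit $\omega$ on $\ell_\infty$, $$\mathrm{Tr}_\omega(G)=\omega\left(\frac1{\Phi(n+1)}\sum_{k=0}^n\langle Ge_k,e_k\rangle\right).$$
   Context: $\mathcal{H}$ is a separable (infinite-dimensional) Hilbert space. $\varphi$ is regularly varying of index $-1$ ($\varphi\in R_{-1}$) if it is measurable and $\lim_{t\to\infty}\varphi(\lambda t)/\varphi(t)=\lambda^{-1}$ for all $\lambda>0$. $\Phi(t)=\int_0^t\varphi(s)\,ds+c_\varphi$ with a constant $c_\varphi\ge0$, and $\Phi(t)\to\infty$ is assumed. $\mu(n,A)$, $n\ge0$, denote the singular values of a compact operator $A$ in decreasing order; $\mathcal{L}_\varphi=\{A\text{ compact}:\sup_{n\ge0}\mu(n,A)/\varphi(n)<\infty\}$; $\mathcal{L}_\varphi^{(q)}=\{A:|A|^q\in\mathcal{L}_\varphi\}$ for $0<q<\infty$; $\mathcal{L}_\varphi^{(\infty)}=\mathbb{B}(\mathcal{H})$. $V\in\mathbb{B}(\mathcal{H})$ is strictly positive if it is positive with dense range. $G\in\mathbb{B}(\mathcal{H})$ is weakly $\varphi$-modulated with respect to $V$ if there is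 $p\ge1$ such that the densely defined operator $GV^{-1/p}$ extends to a bounded operator belonging to $\mathcal{L}_\varphi^{(p/(p-1))}(\mathcal{H})$ (exponent $\infty$ if $p=1$). In this situation $G\in\mathcal{L}_\varphi$, so that $\mathrm{Tr}_\omega(G)$ is defined. An extended limit is a state on $\ell_\infty(\mathbb{N})$ vanishing on $c_0$. $\mathrm{Tr}_\omega$ is the linear extension to $\mathcal{L}_\varphi$ of $A\mapsto\omega\big(\frac1{\Phi(n+1)}\sum_{k=0}^n\mu(k,A)\big)$, $0\le A\in\mathcal{L}_\varphi$ (for decreasing $\varphi\in R_{-1}$ this extension exists for every extended limit $\omega$). *)

(* Defs.v *)
From HB Require Import structures.
From mathcomp Require Import all_boot all_order all_algebra.
From mathcomp Require Import all_classical all_reals all_analysis.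
From mathcomp Require Export complex.

Set Implicit Arguments.
Unset Strict Implicit.
Unset Printing Implicit Defensive.

Import Order.TTheory GRing.Theory Num.Theory numFieldNormedType.Exports.

Local Open Scope classical_set_scope.
Local Open Scope complex_scope.
Local Open Scope ring_scope.

(* Complex Hilbert spaces; the inner product is linear in its first argument.
   The norm of the space takes its (real) values in R[i]. *)
Record hilbertSpace (R : realType) := HilbertSpace {
  hilbert_sort :> completeNormedModType R[i] ;
  inner : {dot hilbert_sort for Num.conj} ;
  inner_normE : forall x : hilbert_sort, `|x| ^+ 2 = inner x x
}.
Arguments inner {R h}.

Section Space.
Context {R : realType} {H : hilbertSpace R}.

Definition separable (T : topologicalType) : Prop :=
  exists D : set T, countable D /\ dense D.

Definition has_dim (E : set H) (k : nat) : Prop :=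
  exists b : 'I_k -> H,
    (forall c : 'I_k -> R[i], \sum_i c i *: b i = 0 -> forall i, c i = 0) /\
    E = [set x | exists c : 'I_k -> R[i], x = \sum_i c i *: b i].

Definition infinite_dim : Prop := forall k, ~ has_dim [set: H] k.

Definition orthonormal_basis (e : nat -> H) : Prop :=
  (forall i j, inner (e i) (e j) = (i == j)%:R) /\
  (forall x : H, (fun n => \sum_(k < n) inner x (e k) *: e k) @ \oo --> x).

End Space.
Arguments infinite_dim {R} H.

Section Operators.
Context {R : realType} {H : hilbertSpace R}.
Implicit Types A B P S T V W G : H -> H.

Definition bounded_op A : Prop := linear A /\ continuous A.

Definition compact_op A : Prop :=
  linear A /\ precompact (A @` [set x : H | `|x| <= 1]).

Definition positive_op A : Prop :=
  bounded_op A /\ forall x, 0 <= inner (A x) x.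

Definition strictly_positive_op A : Prop :=
  positive_op A /\ dense (range A).

Definition is_adjoint A B : Prop :=
  forall x y, inner (A x) y = inner x (B y).

(* P = |A|, the positive square root of A^* A *)
Definition is_absop A P : Prop :=
  positive_op P /\ exists B, is_adjoint A B /\ P \o P = B \o A.

Definition polyop (p : {poly R}) T : H -> H :=
  fun x => \sum_(i < size p) (p`_i)%:C *: iter i T x.

(* S = f(T) in the continuous functional calculus of a positive operator T:
   S is the limit in operator norm of polynomials p_n(T), where p_n tends to f
   uniformly on an interval [0, M] with M >= ||T||, which contains the
   spectrum of T. *)
Definition is_fcalc (f : R -> R) T S : Prop :=
  exists (M : R) (p : nat -> {poly R}),
    [/\ forall x, `|T x| <= M%:C * `|x|,
        forall eps : R, 0 < eps -> \forall n \near \oo,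
          forall t, 0 <= t <= M -> `|(p n).[t] - f t| <= eps
      & forall eps : R, 0 < eps -> \forall n \near \oo,
          forall x, `|polyop (p n) T x - S x| <= eps%:C * `|x| ].

(* S = T^r, for T positive and r > 0 (so that 0 `^ r = 0) *)
Definition is_powop T (r : R) S : Prop :=
  positive_op T /\ is_fcalc (fun t => t `^ r) T S.

(* s lists the eigenvalues of |A| in decreasing order, each t > 0 being
   repeated dim ker(|A| - t) times; the list is completed by zeros when A has
   finite rank. *)
Definition is_singular_values A (s : nat -> R) : Prop :=
  exists2 P, is_absop A P &
    [/\ nonincreasing_seq s,
        forall n, 0 <= s n
      & forall t : R, 0 < t -> exists k,
          has_dim [set x : H | P x = t%:C *: x] k /\ ([set n | s n = t] #= `I_k)%card].

(* The n-th singular value mu(n, A), for A compact *)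
Definition singular_value A : nat -> R :=
  xget (fun=> 0) [set s | is_singular_values A s].

End Operators.

Section Ideals.
Context {R : realType} {H : hilbertSpace R}.
Implicit Types (phi : R -> R) (A B P Q V W G : H -> H).

Definition Lphi phi A : Prop :=
  compact_op A /\
  has_ubound (range (fun n => singular_value A n / phi n%:R)).

Definition Lphi_pow phi (q : \bar R) A : Prop :=
  bounded_op A /\
  match q with
  | q'%:E => exists P Q, [/\ is_absop A P, is_powop P q' Q & Lphi phi Q]
  | +oo%E => True
  | -oo%E => False
  end.

Definition conj_exponent (p : R) : \bar R :=
  if p == 1 then +oo%E else (p / (p - 1))%:E.

(* With W = V^(1/p), the operator V^(-1/p) is the inverse of W, with domain the
   dense subspace range W; hence B extends G V^(-1/p) iff B (W x) = G x for
   all x. *)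
Definition weakly_modulated phi V G : Prop :=
  exists p : R, 1 <= p /\
  exists W B, [/\ is_powop V p^-1 W,
    forall x, B (W x) = G x & Lphi_pow phi (conj_exponent p) B].

End Ideals.

Section Traces.
Context {R : realType}.

Definition regularly_varying_m1 (phi : R -> R) : Prop :=
  measurable_fun (`[0, +oo[ : set R) phi /\
  forall lambda : R, 0 < lambda ->
    (fun t => phi (lambda * t) / phi t) @ +oo --> lambda^-1.

Definition Phi (phi : R -> R) (c : R) (t : R) : R :=
  \int[lebesgue_measure]_(s in `[0, t]) phi s + c.

Definition bounded_seq (a : nat -> R[i]) : Prop :=
  bounded_fun (a : nat -> R[i]^o).

(* States on l_infty vanishing on c_0; the values of omega on unbounded
   sequences are irrelevant. *)
Definition extended_limit (omega : (nat -> R[i]) -> R[i]) : Prop :=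
  [/\ forall (z : R[i]) a b, bounded_seq a -> bounded_seq b ->
        omega (fun n => z * a n + b n) = z * omega a + omega b,
      forall a, bounded_seq a -> (forall n, 0 <= a n) -> 0 <= omega a,
      omega (fun=> 1) = 1
    & forall a : nat -> R[i],
        (a : nat -> R[i]^o) @ \oo --> (0 : R[i]^o) -> omega a = 0].

(* Tr is the linear extension to L_phi of the functional
   A |-> omega (1 / Phi(n+1) * sum_(k <= n) mu(k, A)) on the positive cone of
   L_phi. As L_phi is spanned by that cone, the values of Tr on L_phi are
   determined; those outside L_phi are irrelevant. *)
Definition is_Tr (H : hilbertSpace R) (phi : R -> R) (c : R)
    (omega : (nat -> R[i]) -> R[i]) (Tr : (H -> H) -> R[i]) : Prop :=
  (forall (z : R[i]) (A B : H -> H), Lphi phi A -> Lphi phi B ->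
     Tr (fun x => z *: A x + B x) = z * Tr A + Tr B) /\
  (forall A : H -> H, positive_op A -> Lphi phi A ->
     Tr A = omega (fun n => ((Phi phi c n.+1%:R)^-1 *
                             \sum_(k < n.+1) singular_value A k)%:C)).

End Traces.

(* Main.v *)
Require Import Defs.
From HB Require Import structures.
From mathcomp Require Import all_boot all_order all_algebra.
From mathcomp Require Import finmap.
From mathcomp Require Import all_classical all_reals all_analysis.
From mathcomp Require Import ring lra zify.

Import Order.TTheory GRing.Theory Num.Theory numFieldNormedType.Exports.

Local Open Scope classical_set_scope.
Local Open Scope complex_scope.
Local Open Scope ring_scope.

Set Implicit Arguments.
Unset Strict Implicit.
Unset Printing Implicit Defensive.

(** Write G = B W, where W = V^(1/p) and |B|^q is in the ideal, 1/p + 1/q = 1. Put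
    b k = C phi(k)^(1/q) and w k = C phi(k)^(1/p). Then W is bounded by w n on the
    vectors orthogonal to e_0, .., e_(n-1), and B by b n off n suitable vectors
    (root_codim_bound, conj_codim_bound). These bounds use the functional
    calculus only through powop_root_bound and powop_power_bound, which rest on
    the positivity of p(T) for a polynomial p >= 0 on [0, M], with M a bound of
    the positive operator T (polyop_ge0).

    Taking real and imaginary parts, which are both of the form K = Re (z G), it
    is enough to treat a self-adjoint K with |<K x, x>| <= |B W x| |x|. It is
    compact, and has eigenvalues l 0 >= l 1 >= .. from above and
    - l' 0 <= - l' 1 <= .. from below (eigsys_exists). By min-max,
    l (2n) <= b n * w n, which is O(phi(n)); the same holds for l' (eig_prod_le).
    Hence the positive and negative parts of K are in the ideal, with singular
    values l and l' (eig_split, singular_valueE), and the trace of K is the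
    extended limit of the sums of l - l' up to n, divided by Phi(n+1).

    It remains to compare, for N = n + 1, the sum of the l k - l' k with the sum
    of the <K e_k, e_k>, k < N. Both are traces of compressions of K to subspaces
    of the finite-dimensional space S spanned by the e_k and the eigenvectors
    involved. Computing the trace of K on S in two ways, they differ by a trace
    on the complement of the eigenvectors, where the form of K is at most
    l N + l' N in absolute value, and a trace over at most 2N unit vectors u_k
    orthogonal to e_0, .., e_(N-1). There |W u_k| <= w N, and by counting
    dimensions u_k can be chosen so that |B W u_k| <= b k * w N
    (trace_estimate). Karamata's estimates for phi bound the sum of the b k, k < 2N, by a multiple of
    N phi(N)^(1/q) (sum_phi_powR), so that the difference is O(N phi(N)), and they
    show that N phi(N) = o(Phi(N)) (nphi_Phi_small). Extended limits vanish on
    null sequences, so the two limits agree (selfadj_trace). *)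

Local Notation Re := complex.Re.
Local Notation Im := complex.Im.

(** * Norms and inner products over R *)

Section Norm.
Context {R : realType}.

(** The norms of the Hilbert space and of the scalars take their values in R[i];
    nm is their real form, so that estimates live in the ordered field R. *)
Definition nm {V : normedZmodType R[i]} (x : V) : R := Re `|x|.

Lemma normE (V : normedZmodType R[i]) (x : V) : `|x| = (nm x)%:C.
Proof. by rewrite /nm RRe_real// normr_real. Qed.

Lemma nm_ge0 (V : normedZmodType R[i]) (x : V) : 0 <= nm x.
Proof. by rewrite -ler0c -normE. Qed.

Lemma nm0 (V : normedZmodType R[i]) : nm (0 : V) = 0.
Proof. by rewrite /nm normr0. Qed.

Lemma nm_eq0 (V : normedZmodType R[i]) (x : V) : nm x = 0 -> x = 0.
Proof. by move=> x0; apply/normr0_eq0; rewrite normE x0. Qed.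

Lemma nmN (V : normedZmodType R[i]) (x : V) : nm (- x) = nm x.
Proof. by rewrite /nm normrN. Qed.

Lemma nmD (V : normedZmodType R[i]) (x y : V) : nm (x + y) <= nm x + nm y.
Proof. by rewrite -lecR rmorphD/= -!normE ler_normD. Qed.

Lemma nmB (V : normedZmodType R[i]) (x y : V) : nm (x - y) <= nm x + nm y.
Proof. by rewrite -(nmN y); exact: nmD. Qed.

Lemma nmBC (V : normedZmodType R[i]) (x y : V) : nm (x - y) = nm (y - x).
Proof. by rewrite -nmN opprB. Qed.

Lemma nmM (a b : R[i]) : nm (a * b) = nm a * nm b.
Proof. by apply: complexI; rewrite rmorphM/= -!normE normrM. Qed.

Lemma nmZ (V : normedModType R[i]) (a : R[i]) (x : V) :
  nm (a *: x) = nm a * nm x.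
Proof. by apply: complexI; rewrite rmorphM/= -!normE normrZ. Qed.

Lemma nmC (a : R) : nm a%:C = `|a|.
Proof. by rewrite /nm normc_def/= expr0n addr0 sqrtr_sqr. Qed.

Lemma nm_sum (V : normedZmodType R[i]) I (r : seq I) (F : I -> V) :
  nm (\sum_(i <- r) F i) <= \sum_(i <- r) nm (F i).
Proof.
elim: r => [|a r IH]; first by rewrite !big_nil nm0.
by rewrite !big_cons (le_trans (nmD _ _))// lerD.
Qed.

Lemma Re_le_nm (a : R[i]) : `|Re a| <= nm a.
Proof. by rewrite -lecR -normE; exact: normc_ge_Re. Qed.

Lemma Im_le_nm (a : R[i]) : `|Im a| <= nm a.
Proof.
rewrite -normrN -ReiNIm (le_trans (Re_le_nm _))// nmM [X in _ * X]/nm normc_def/=.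
by rewrite expr0n expr1n add0r sqrtr1 mulr1.
Qed.

Lemma nm_le_ReIm (a : R[i]) : nm a <= `|Re a| + `|Im a|.
Proof.
rewrite {1}[a]complexE (le_trans (nmD _ _))// nmC nmM nmC.
by rewrite {1}/nm normc_def/= expr0n expr1n add0r sqrtr1 mul1r.
Qed.

Lemma nmconj (a : R[i]) : nm a^* = nm a.
Proof. by rewrite /nm norm_conjC. Qed.

Lemma nm_sqr (a : R[i]) : a * a^* = (nm a ^+ 2)%:C.
Proof. by rewrite rmorphXn/= -normE normCK. Qed.

Lemma cvg_nmP (V : normedModType R[i]) T (F : set_system T) (FF : Filter F)
    (f : T -> V) (l : V) :
  f @ F --> l <-> (forall e : R, 0 < e -> \forall t \near F, nm (f t - l) < e).
Proof.
split=> [/cvgrPdist_lt h e e0|h].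
  have /h : (0 : R[i]) < e%:C by rewrite ltcR.
  by apply: filterS => t; rewrite distrC normE ltcR.
apply/cvgrPdist_lt => e e0.
have eR : e = (Re e)%:C by rewrite RRe_real// gtr0_real.
move: (e0); rewrite eR ltcR => /h; apply: filterS => t.
by rewrite distrC normE ltcR.
Qed.

Lemma cvg_seq_unique (V : normedModType R[i]) (u : nat -> V) (a b : V) :
  u @ \oo --> a -> u @ \oo --> b -> a = b.
Proof.
move=> /cvg_nmP ua /cvg_nmP ub; apply/eqP; rewrite -subr_eq0; apply/eqP/nm_eq0.
apply/eqP; rewrite eq_le nm_ge0 andbT; apply/ler_addgt0Pl => e e0; rewrite addr0.
have e20 : 0 < e / 2 by rewrite divr_gt0.
have [n [h1 h2]] := @filter_ex _ \oo _ _ (filterI (ua _ e20) (ub _ e20)).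
rewrite (splitr e) -(subrK (u n) a) -addrA (le_trans (nmD _ _))//.
by rewrite lerD// ltW// nmBC.
Qed.

End Norm.

Local Notation "''[' x , y ]" := (inner x y) : ring_scope.

Section Inner.
Context {R : realType} {H : hilbertSpace R}.
Implicit Types x y z : H.

Lemma innerDl x y z : '[x + y, z] = '[x, z] + '[y, z].
Proof. exact: linearDl. Qed.
Lemma innerDr x y z : '[x, y + z] = '[x, y] + '[x, z].
Proof. exact: linearDr. Qed.
Lemma innerZl a x y : '[a *: x, y] = a * '[x, y].
Proof. exact: linearZl_LR. Qed.
Lemma innerZr a x y : '[x, a *: y] = a^* * '[x, y].
Proof. exact: linearZr_LR. Qed.
Lemma innerC x y : '[x, y] = '[y, x]^*.
Proof. by rewrite hermC expr0 mul1r. Qed.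
Lemma inner0l x : '[0, x] = 0. Proof. exact: linear0l. Qed.
Lemma inner0r x : '[x, 0] = 0. Proof. exact: linear0r. Qed.
Lemma innerNl x y : '[- x, y] = - '[x, y]. Proof. exact: linearNl. Qed.
Lemma innerNr x y : '[x, - y] = - '[x, y]. Proof. exact: linearNr. Qed.
Lemma innerBl x y z : '[x - y, z] = '[x, z] - '[y, z].
Proof. by rewrite innerDl innerNl. Qed.
Lemma innerBr x y z : '[x, y - z] = '[x, y] - '[x, z].
Proof. by rewrite innerDr innerNr. Qed.
Lemma inner_suml I (r : seq I) (P : pred I) (F : I -> H) y :
  '[\sum_(i <- r | P i) F i, y] = \sum_(i <- r | P i) '[F i, y].
Proof. exact: linear_sumlz. Qed.
Lemma inner_sumr I (r : seq I) (P : pred I) (F : I -> H) y :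
  '[y, \sum_(i <- r | P i) F i] = \sum_(i <- r | P i) '[y, F i].
Proof. exact: linear_sumr. Qed.

Lemma innerxx x : '[x, x] = (nm x ^+ 2)%:C.
Proof. by rewrite rmorphXn/= -normE inner_normE. Qed.

Lemma orthoC x y : '[x, y] = 0 -> '[y, x] = 0.
Proof. by rewrite innerC => /eqP; rewrite conjC_eq0 => /eqP. Qed.

Lemma nmDo x y : '[x, y] = 0 -> nm (x + y) ^+ 2 = nm x ^+ 2 + nm y ^+ 2.
Proof.
move=> xy; apply: complexI; rewrite rmorphD/= -!innerxx innerDl !innerDr.
by rewrite xy (orthoC xy) addr0 add0r.
Qed.

(** Expand |a x - b y|^2 >= 0 with a = |y|^2 and b = <x, y>. *)
Lemma CauchySchwarz x y : nm '[x, y] <= nm x * nm y.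
Proof.
have [->|y0] := eqVneq y 0; first by rewrite inner0r !nm0 mulr0.
have ny : 0 < nm y.
  by rewrite lt_neqAle nm_ge0 andbT eq_sym; apply: contraNneq y0 => /nm_eq0/eqP.
have := sqr_ge0 (nm ((nm y ^+ 2)%:C *: x - '[x, y] *: y)).
rewrite -lecR -(innerxx (_ - _)) innerBl !innerBr !innerZl !innerZr !innerxx.
rewrite [(nm y ^+ 2)%:C^*]conj_Creal ?realE ?ler0c ?sqr_ge0//.
rewrite [in '[x, y] * _](innerC y x).
have -> : (nm y ^+ 2)%:C * ((nm y ^+ 2)%:C * (nm x ^+ 2)%:C) -
  (nm y ^+ 2)%:C * ('[x, y]^* * '[x, y]) -
  ('[x, y] * ((nm y ^+ 2)%:C * '[x, y]^*) -
   '[x, y] * ('[x, y]^* * (nm y ^+ 2)%:C))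
  = (nm y ^+ 2)%:C * ((nm y ^+ 2)%:C * (nm x ^+ 2)%:C - '[x, y] * '[x, y]^*).
  by ring.
rewrite nm_sqr -!(rmorphM, rmorphB)/= lecR pmulr_rge0 ?exprn_gt0//.
rewrite subr_ge0 -exprMn ler_pXn2r ?nnegrE ?mulr_ge0 ?nm_ge0//.
by rewrite mulrC.
Qed.

Lemma Re_inner_le x y : Re '[x, y] <= nm x * nm y.
Proof.
by rewrite (le_trans _ (CauchySchwarz x y))// (le_trans (ler_norm _))// Re_le_nm.
Qed.

Lemma inner_ext x y : (forall z, '[x, z] = '[y, z]) -> x = y.
Proof.
move=> h; apply/eqP; rewrite -subr_eq0; apply/eqP/nm_eq0.
apply/eqP; rewrite -sqrf_eq0; apply/eqP/complexI.
by rewrite -innerxx innerBl h subrr.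
Qed.

End Inner.

(** * Orthonormal lists, dimension counting and finite traces *)

Lemma null_row (F : fieldType) m n (A : 'M[F]_(m, n)) : (n < m)%N ->
  exists2 v : 'rV_m, v != 0 & v *m A = 0.
Proof.
move=> nm; have : ~~ (kermx A <= (0%R : 'M[F]_m))%MS.
  rewrite submx0 -mxrank_eq0 mxrank_ker -lt0n subn_gt0.
  by rewrite (leq_ltn_trans _ nm)// rank_leq_col.
case/row_subPn => i; rewrite submx0 => vi0; exists (row i (kermx A)) => //.
by apply/sub_kermxP; exact: row_sub.
Qed.

Section Ortho.
Context {R : realType} {H : hilbertSpace R}.
Implicit Types (x y : H) (s t : seq H).

(** Orthonormal lists; finite-dimensional subspaces are given below by such
    lists, so that dimensions are list sizes. *)
Definition orthon s : bool :=
  pairwise (fun x y => '[x, y] == 0) s && all (fun x => '[x, x] == 1) s.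

Definition perp s x : Prop := forall a, a \in s -> '[x, a] = 0.

Definition proj s x : H := \sum_(a <- s) '[x, a] *: a.

Definition inspan s x : Prop := proj s x = x.

Lemma orthon_cons a s :
  orthon (a :: s) <-> [/\ perp s a, '[a, a] = 1 & orthon s].
Proof.
rewrite /orthon/=; split.
  move=> /andP[/andP[/allP h1 ->] /andP[/eqP -> ->]]; split=> // b bs.
  exact/eqP/h1.
move=> [h1 h2 /andP[-> ->]]; rewrite h2 eqxx !andbT.
by apply/allP => b bs; apply/eqP/h1.
Qed.

Lemma perp_cat s t x : perp (s ++ t) x <-> perp s x /\ perp t x.
Proof.
split=> [h|[h1 h2] a]; last by rewrite mem_cat => /orP[/h1|/h2].
by split=> a h'; apply: h; rewrite mem_cat h' ?orbT.
Qed.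

Lemma perpD s x y : perp s x -> perp s y -> perp s (x + y).
Proof. by move=> hx hy a sa; rewrite innerDl hx// hy// addr0. Qed.

Lemma perpZ s c x : perp s x -> perp s (c *: x).
Proof. by move=> hx a sa; rewrite innerZl hx// mulr0. Qed.

Lemma perpB s x y : perp s x -> perp s y -> perp s (x - y).
Proof. by move=> hx hy; rewrite -scaleN1r; apply/perpD/perpZ. Qed.

Lemma perp_proj s x : perp s x -> proj s x = 0.
Proof. by move=> h; rewrite /proj big_seq big1// => a /h ->; rewrite scale0r. Qed.

Lemma inner_proj_perp s x y : perp s y -> '[y, proj s x] = 0.
Proof.
move=> h; rewrite inner_sumr big_seq big1// => a sa.
by rewrite innerZr h// mulr0.
Qed.

Lemma inner_proj s x a : orthon s -> a \in s -> '[proj s x, a] = '[x, a].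
Proof.
elim: s => [//|b s IH] /orthon_cons[bs b1 os]; rewrite inE /proj big_cons.
case/predU1P => [->|sa]; rewrite innerDl innerZl.
  by rewrite b1 mulr1 (orthoC (inner_proj_perp x bs)) addr0.
by rewrite bs// mulr0 add0r IH.
Qed.

Lemma perp_sub_proj s x : orthon s -> perp s (x - proj s x).
Proof. by move=> os a sa; rewrite innerBl inner_proj// subrr. Qed.

Lemma inspan_proj s x : orthon s -> inspan s (proj s x).
Proof.
move=> os; apply/eqP; rewrite -subr_eq0; apply/eqP.
rewrite {2}/proj -sumrB big_seq big1// => a sa.
by rewrite inner_proj// subrr.
Qed.

Lemma inspan_perp s x : inspan s x -> perp s x -> x = 0.
Proof. by move=> sx /perp_proj; rewrite sx. Qed.

Lemma perp_inspan s x y : perp s y -> inspan s x -> '[y, x] = 0.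
Proof. by move=> h <-; exact: inner_proj_perp. Qed.

Lemma inspanZ s c x : inspan s x -> inspan s (c *: x).
Proof.
move=> h; rewrite /inspan /proj -{2}h /proj scaler_sumr.
by apply: eq_bigr => a _; rewrite innerZl scalerA.
Qed.

Lemma inspanB s x y : inspan s x -> inspan s y -> inspan s (x - y).
Proof.
move=> hx hy; rewrite /inspan -[x in RHS]hx -[y in RHS]hy /proj -sumrB.
by apply: eq_bigr => a _; rewrite innerBl scalerBl.
Qed.

Lemma inspan_comb s t (c : H -> R[i]) : (forall a, a \in s -> inspan t a) ->
  inspan t (\sum_(a <- s) c a *: a).
Proof.
move=> st; rewrite /inspan /proj; under eq_bigr do rewrite inner_suml scaler_suml.
rewrite exchange_big/=; apply: eq_big_seq => a /st ta.
rewrite -[X in _ = _ *: X]ta /proj scaler_sumr; apply: eq_bigr => b _.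
by rewrite innerZl scalerA.
Qed.

Lemma inspan_mem s x : orthon s -> x \in s -> inspan s x.
Proof.
elim: s => [//|b s IH] /orthon_cons[bs b1 os].
rewrite inE /inspan /proj big_cons => /predU1P[->|sx].
  by rewrite b1 scale1r -/(proj s b) (perp_proj bs) addr0.
by rewrite (orthoC (bs _ sx)) scale0r add0r; exact: IH.
Qed.

Lemma inspan_cons a s x : perp s a -> inspan s x -> inspan (a :: s) x.
Proof.
move=> sa h; rewrite /inspan /proj big_cons.
by rewrite (orthoC (perp_inspan sa h)) scale0r add0r.
Qed.

Lemma nm_proj s x : orthon s ->
  nm (proj s x) ^+ 2 = \sum_(a <- s) nm '[x, a] ^+ 2.
Proof.
move=> os; apply: complexI; rewrite -innerxx {2}/proj inner_sumr rmorph_sum/=.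
apply: eq_big_seq => a sa.
by rewrite innerZr inner_proj// mulrC nm_sqr.
Qed.

Lemma pythagoras s x : orthon s ->
  nm x ^+ 2 = nm (proj s x) ^+ 2 + nm (x - proj s x) ^+ 2.
Proof.
move=> os; have := @nmDo _ _ (proj s x) (x - proj s x).
rewrite subrKC => -> //; apply: orthoC.
by apply/inner_proj_perp/perp_sub_proj.
Qed.

Lemma nm_sub_proj s x : orthon s -> nm (x - proj s x) <= nm x.
Proof.
move=> os; rewrite -(ler_pXn2r (_ : 0 < 2)%N) ?nnegrE ?nm_ge0//.
by rewrite (pythagoras x os) lerDr sqr_ge0.
Qed.

Lemma Bessel s x : orthon s -> \sum_(a <- s) nm '[x, a] ^+ 2 <= nm x ^+ 2.
Proof.
by move=> os; rewrite -nm_proj// (pythagoras x os) lerDl sqr_ge0.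
Qed.

Lemma orthon_normalize s x : x != 0 -> perp s x -> orthon s ->
  orthon ((nm x)^-1%:C *: x :: s).
Proof.
move=> x0 sx os; apply/orthon_cons; split=> //; first exact: perpZ.
have n0 : nm x != 0 by apply: contra_neq x0 => /nm_eq0.
rewrite innerxx nmZ nmC ger0_norm ?invr_ge0 ?nm_ge0// mulVf//.
by rewrite expr1n.
Qed.

Lemma orthon_nth s i j : orthon s -> (i < size s)%N -> (j < size s)%N ->
  '[s`_i, s`_j] = (i == j)%:R.
Proof.
move=> /andP[/(pairwiseP 0) h1 /allP h2] si sj; case: ltngtP => ij /=.
- by apply/eqP/h1.
- by apply/orthoC/eqP/h1.
- by rewrite ij; apply/eqP/h2; rewrite mem_nth.
Qed.

(** The Gram matrix of s against t has more rows than columns, hence a nonzero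
    vector in its left kernel: its entries are the coordinates of x. *)
Lemma unit_vector_perp s t : orthon s -> (size t < size s)%N ->
  exists x, [/\ inspan s x, nm x = 1 & perp t x].
Proof.
move=> os ts.
pose A : 'M[R[i]]_(size s, size t) := \matrix_(i, j) '[s`_i, t`_j].
have [v v_neq0 vA] := null_row A ts.
have [k0 vk0] := rV0Pn _ v_neq0.
pose z := \sum_(k < size s) v 0 k *: s`_k.
have zs (k : 'I_(size s)) : '[z, s`_k] = v 0 k.
  rewrite inner_suml (bigD1 k)//= big1 ?addr0.
    by rewrite innerZl orthon_nth// eqxx mulr1.
  move=> j jk; rewrite innerZl orthon_nth//.
  by rewrite -[(_ == _ :> nat)]/(j == k) (negbTE jk) mulr0.
have z0 : z != 0.
  apply: contra_neq vk0 => z0.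
  by rewrite -(zs k0) z0 inner0l.
have sz : inspan s z.
  rewrite /inspan /proj (big_nth 0) big_mkord.
  by apply: eq_bigr => k _; rewrite zs.
exists ((nm z)^-1%:C *: z); split; first exact: inspanZ.
  rewrite nmZ nmC ger0_norm ?invr_ge0 ?nm_ge0// mulVf//.
  by apply: contra_neq z0 => /nm_eq0.
apply: perpZ => a /(nthP 0)[j jt <-].
have /rowP/(_ (Ordinal jt)) := vA.
rewrite !mxE => <-; rewrite inner_suml; apply: eq_bigr => k _.
by rewrite innerZl mxE.
Qed.

(** A longer list would contain in its span a unit vector orthogonal to t,
    although it is in the span of t. *)
Lemma orthon_size_le s t : orthon s -> orthon t -> (forall x, x \in s -> inspan t x) ->
  (size s <= size t)%N.
Proof.
move=> os ot st; rewrite leqNgt; apply/negP => /(unit_vector_perp os)[x [xs x1 xt]].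
have : inspan t x by rewrite -xs; exact: inspan_comb.
by move=> /inspan_perp/(_ xt) x0; move: x1; rewrite x0 nm0 => /esym/eqP; rewrite oner_eq0.
Qed.

(** An orthonormal list of full length in a span spans it: a further direction
    would make it longer than the dimension. *)
Lemma inspan_full s b : orthon s -> orthon b -> size b = size s ->
  (forall x, x \in b -> inspan s x) -> forall x, inspan s x -> inspan b x.
Proof.
move=> os ob sb bs x sx; apply/eqP; rewrite eq_sym -subr_eq0; apply/eqP.
apply: contrapT => /eqP y0; set y := x - proj b x in y0.
have yb : perp b y by exact: perp_sub_proj.
have sy : inspan s y.
  by apply: inspanB => //; exact: inspan_comb.
have := @orthon_size_le ((nm y)^-1%:C *: y :: b) s (orthon_normalize y0 yb ob) os.
rewrite /= sb ltnn; suff h : forall a, a \in (nm y)^-1%:C *: y :: b -> inspan s a.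
  by move=> /(_ h).
by move=> a; rewrite inE => /predU1P[->|/bs//]; exact: inspanZ.
Qed.

(** Expanding a along s, then c along b, both sums become the sum over a in b
    and c in s of <a, c> <K c, a>. *)
Lemma trace_indep s b (K : H -> H) : linear K -> orthon s -> orthon b ->
  size b = size s -> (forall x, x \in b -> inspan s x) ->
  \sum_(a <- b) '[K a, a] = \sum_(a <- s) '[K a, a].
Proof.
move=> Kl os ob sb bs.
pose KL : {linear H -> H} := HB.pack K (GRing.isLinear.Build _ _ _ _ K Kl).
have E a t : K (proj t a) = \sum_(c <- t) '[a, c] *: K c.
  by rewrite -[K]/(KL : H -> H) /proj linear_sum; under eq_bigr do rewrite linearZ.
transitivity (\sum_(a <- b) \sum_(c <- s) '[a, c] * '[K c, a]).
  apply: eq_big_seq => a /bs sa; rewrite -{1}sa E inner_suml.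
  by apply: eq_bigr => c _; rewrite innerZl.
rewrite exchange_big/=; apply: eq_big_seq => c sc.
have cb : inspan b c by apply: (@inspan_full s) => //; exact: inspan_mem.
rewrite -{4}cb /proj inner_sumr; apply: eq_bigr => a _.
by rewrite innerZr -innerC.
Qed.

(** Gram-Schmidt: the residual of the next vector of t is either 0 or, once
    normalized, a new member of the list. *)
Lemma orthon_hull a t : orthon a -> exists s, [/\ orthon s,
  (size s <= size a + size t)%N, (forall x, x \in a -> inspan s x) &
  (forall x, x \in t -> inspan s x)].
Proof.
move=> oa; elim: t => [|f t [s [os ss sa st]]].
  by exists a; rewrite addn0; split=> // x; exact: inspan_mem.
have [y0|y0] := eqVneq (f - proj s f) 0.
  exists s; split=> //; first by rewrite /= addnS ltnW.
  move=> x; rewrite inE => /predU1P[->|]; last exact: st.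
  by apply/esym/eqP; rewrite -subr_eq0 y0.
have os' := orthon_normalize y0 (perp_sub_proj f os) os.
have [yp _ _] := (orthon_cons _ _).1 os'.
exists ((nm (f - proj s f))^-1%:C *: (f - proj s f) :: s); split=> //.
- by rewrite /= addnS ltnS.
- by move=> x /sa; exact: inspan_cons.
- move=> x; rewrite inE => /predU1P[->|]; last by move=> /st; exact: inspan_cons.
  have n0 : nm (f - proj s f) != 0 by apply: contra_neq y0 => /nm_eq0.
  have h1 : inspan ((nm (f - proj s f))^-1%:C *: (f - proj s f) :: s) (f - proj s f).
    set u := _ *: _; have -> : f - proj s f = (nm (f - proj s f))%:C *: u.
      by rewrite /u scalerA -rmorphM/= mulfV// scale1r.
    by apply/inspanZ/inspan_mem => //; rewrite inE eqxx.
  have h2 := inspan_cons yp (inspan_proj f os).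
  by have := inspanB h1 (inspanZ (-1) h2); rewrite scaleN1r opprK subrK.
Qed.

(** The k-th of the r new vectors has to meet k extra conditions. Choosing the
    most constrained one, k = r - 1, first, the conditions at each step (being
    orthogonal to a and to the vectors already chosen, and the extra ones) are
    always size s - 1 in number. *)
Lemma orthon_extend s a (y : nat -> H) r : orthon s -> orthon a ->
  (forall x, x \in a -> inspan s x) -> (size a + r = size s)%N ->
  exists u, [/\ size u = r, orthon (u ++ a), (forall x, x \in u -> inspan s x) &
   forall k j, (k < r)%N -> (j < k)%N -> '[u`_k, y j] = 0].
Proof.
move=> os oa sa ar.
suff : forall t : nat, (t <= r)%N -> exists u, [/\ size u = t, orthon (u ++ a),
    (forall x, x \in u -> inspan s x) &
    forall k j, (k < t)%N -> (j < r - t + k)%N -> '[u`_k, y j] = 0].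
  move=> /(_ r (leqnn r))[u [ur ou us hu]]; exists u; split=> // k j kr jk.
  by apply: hu => //; rewrite subnn.
elim=> [|t IH] tr; first by exists [::].
have [u [ut ou us hu]] := IH (ltnW tr).
pose cs := (u ++ a) ++ map y (iota 0 (r - t.+1)).
have ss : (size cs < size s)%N.
  by rewrite !size_cat size_map size_iota ut -ar addnC; lia.
have [x [xs x1 /perp_cat[xua xy]]] := unit_vector_perp os ss.
exists (x :: u); split=> //=.
- by rewrite ut.
- by apply/orthon_cons; split=> //; rewrite innerxx x1 expr1n.
- by move=> z; rewrite inE => /predU1P[->|/us].
- case=> [|k] j kt.
    rewrite addn0 => jr; apply: xy; apply/mapP; exists j => //.
    by rewrite mem_iota.
  by move=> jk; apply: hu => //; apply: leq_trans jk _; lia.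
Qed.

End Ortho.

(** * Bounded operators and positivity of the polynomial calculus *)

Section Operators.
Context {R : realType} {H : hilbertSpace R}.
Implicit Types (A B T S : H -> H) (x y : H).

Section Linear.
Variables (A : H -> H) (Al : linear A).

Let AL : {linear H -> H} := HB.pack A (GRing.isLinear.Build _ _ _ _ A Al).

Lemma lin0 : A 0 = 0. Proof. exact: (linear0 AL). Qed.
Lemma linD x y : A (x + y) = A x + A y. Proof. exact: (linearD AL). Qed.

Lemma linB x y : A (x - y) = A x - A y. Proof. exact: (linearB AL). Qed.
Lemma linZ a x : A (a *: x) = a *: A x. Proof. exact: (linearZZ AL). Qed.
Lemma lin_sum I (r : seq I) (P : pred I) (F : I -> H) :
  A (\sum_(i <- r | P i) F i) = \sum_(i <- r | P i) A (F i).
Proof. exact: (linear_sum AL). Qed.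

Lemma bounded_lin_cont (M : R) : (forall x, nm (A x) <= M * nm x) -> continuous A.
Proof.
move=> AM; suff : continuous AL by [].
apply: bounded_linear_continuous; apply/linear_boundedP.
exists (`|M|)%:C; split; first by rewrite realE ler0c normr_ge0.
move=> r rM x; rewrite !normE (le_trans _ (ler_wpM2r _ (ltW rM)))//.
  by rewrite -rmorphM/= lecR (le_trans (AM x))// ler_wpM2r ?nm_ge0// ler_norm.
by rewrite ler0c nm_ge0.
Qed.

Lemma cont_lin_bounded : continuous A ->
  exists2 M : R, 0 < M & forall x, nm (A x) <= M * nm x.
Proof.
move=> Ac; have /linear_boundedP : bounded_near AL (nbhs (0 : H)).
  by apply: (@continuous_linear_bounded _ _ _ 0 AL); exact: (Ac 0).
move=> [r [rr h]]; exists (`|Re r| + 1); first by rewrite ltr_pwDr.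
move=> x; rewrite -lecR rmorphM/= -!normE; apply: h.
have -> : r = (Re r)%:C by rewrite RRe_real.
by rewrite ltcR (le_lt_trans (ler_norm _))// ltrDl.
Qed.

End Linear.

Lemma bounded_opP A : bounded_op A <->
  linear A /\ exists2 M : R, 0 < M & forall x, nm (A x) <= M * nm x.
Proof.
split=> [[Al Ac]|[Al [M _ AM]]]; split=> //; first exact: cont_lin_bounded.
exact: (bounded_lin_cont Al AM).
Qed.

Definition selfadj A : Prop := forall x y, '[A x, y] = '[x, A y].

Definition qf A x : R := Re '[A x, x].

Lemma qfE A x : selfadj A -> '[A x, x] = (qf A x)%:C.
Proof.
move=> As; rewrite /qf RRe_real//; apply/CrealP.
by rewrite -innerC As.
Qed.

Lemma qf_le A M x : (forall x, nm (A x) <= M * nm x) ->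
  `|qf A x| <= M * nm x ^+ 2.
Proof.
move=> AM; rewrite (le_trans (Re_le_nm _))// (le_trans (CauchySchwarz _ _))//.
by rewrite expr2 mulrA ler_wpM2r ?nm_ge0.
Qed.

Lemma qfZ A a x : linear A -> qf A (a *: x) = nm a ^+ 2 * qf A x.
Proof.
move=> Al; rewrite /qf linZ// innerZl innerZr mulrA nm_sqr.
by case: '[_, _] => u v /=; rewrite mul0r subr0.
Qed.

(** Polarization: the sesquilinear form S, which measures how far A is from
    self-adjoint, vanishes on the diagonal because <A z, z> is real; so it
    vanishes at (x, y) by its values at x + y and x + i y. *)
Lemma pos_selfadj A : positive_op A -> selfadj A.
Proof.
move=> [[Al _] Ap] x y.
pose S x y := '[A x, y] - '[x, A y].
have S0 z : S z z = 0.
  rewrite /S (innerC z) conj_Creal ?subrr//; exact: ger0_real.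
have SD z t : S z t + S t z = 0.
  rewrite -[RHS](S0 (z + t)) /S (linD Al) !innerDl !innerDr.
  have /eqP := S0 z; have /eqP := S0 t; rewrite /S !subr_eq0 => /eqP -> /eqP ->.
  by ring.
have Si : S x ('i%C *: y) + S ('i%C *: y) x = 'i%C * (S y x - S x y).
  rewrite /S (linZ Al) !innerZl !innerZr.
  have -> : ('i%C : R[i])^* = - 'i%C by rewrite /Num.conj/=; apply/eqP; rewrite eq_complex/= oppr0 !eqxx.
  by ring.
have yx : S y x = S x y.
  have /eqP := SD x ('i%C *: y); rewrite Si mulf_eq0.
  have -> : ('i%C == 0 :> R[i]) = false by rewrite eq_complex/= oner_eq0 andbF.
  by rewrite orFb subr_eq0 => /eqP.
have /eqP := SD x y.
by rewrite yx -[X in X == _]mulr2n mulrn_eq0/= subr_eq0 => /eqP.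
Qed.

Lemma qf0_eq0 A : linear A -> selfadj A -> (forall x, qf A x = 0) ->
  forall x, A x = 0.
Proof.
move=> Al As A0 x; have q0 z : '[A z, z] = 0 by rewrite qfE// A0.
have h z t : '[A z, t] + '[A t, z] = 0.
  rewrite -[RHS](q0 (z + t)) (linD Al) !innerDl !innerDr !q0.
  by rewrite addr0 add0r.
have := h x (A x); rewrite [X in _ + X]As => /eqP; rewrite -mulr2n mulrn_eq0/=.
rewrite innerxx => /eqP/complexI/eqP.
by rewrite sqrf_eq0 => /eqP/nm_eq0.
Qed.

(** The value of the form of T at x - M^-1 T x is at most
    <T x, x> - M^-1 |T x|^2. Stated for a single vector x, the bound applies on
    invariant subspaces on which T is positive or bounded by M. *)
Lemma psd_bound T M x : linear T -> selfadj T -> 0 < M ->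
  qf T (T x) <= M * nm (T x) ^+ 2 -> 0 <= qf T (x - (M^-1)%:C *: T x) ->
  nm (T x) ^+ 2 <= M * qf T x.
Proof.
move=> Tl Ts M0 qle.
have conjR (a : R) : (a%:C : R[i])^* = a%:C.
  by rewrite conj_Creal// complex_real.
have -> : qf T (x - (M^-1)%:C *: T x) =
    qf T x - 2 * M^-1 * nm (T x) ^+ 2 + M^-1 ^+ 2 * qf T (T x).
  apply: complexI; rewrite -qfE// (linB Tl) (linZ Tl) !innerBl !innerBr !innerZl.
  rewrite !innerZr -(Ts (T x)) !conjR.
  rewrite [ '[T (T x), x]]Ts !qfE// innerxx.
  by rewrite -!(rmorphM, rmorphB, rmorphD)/=; congr (_%:C); ring.
move: qle; set q := qf T (T x); set n := nm (T x); set c := qf T x => qle h.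
have : M^-1 ^+ 2 * q <= M^-1 * n ^+ 2.
  rewrite (le_trans (ler_wpM2l (sqr_ge0 _) qle))//.
  have M1 : M^-1 * M = 1 by rewrite mulVf// gt_eqF.
  by rewrite expr2 -mulrA (mulrA M^-1 M) M1 mul1r.
move=> h2; have : M^-1 * n ^+ 2 <= c by lra.
by rewrite mulrC ler_pdivrMr// mulrC.
Qed.

(** Complex coefficients are needed to split p(T) into linear factors. *)
Definition cpoly (p : {poly R[i]}) T x : H := \sum_(i < size p) p`_i *: iter i T x.

Lemma cpolyE (p : {poly R[i]}) T x n : (size p <= n)%N -> cpoly p T x = \sum_(i < n) p`_i *: iter i T x.
Proof.
move=> pn; rewrite /cpoly -!(big_mkord xpredT (fun i => p`_i *: iter i T x)).
rewrite [RHS](@big_cat_nat _ _ _ (size p))//= [X in _ = _ + X]big_nat.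
rewrite [X in _ = _ + X]big1 ?addr0// => i /andP[pi _].
by rewrite nth_default// scale0r.
Qed.

Lemma cpolyD p q T x : cpoly (p + q) T x = cpoly p T x + cpoly q T x.
Proof.
pose n := maxn (size p) (size q).
rewrite (@cpolyE _ _ _ n) ?size_polyD// (@cpolyE p _ _ n) ?leq_maxl//.
rewrite (@cpolyE q _ _ n) ?leq_maxr// -big_split/=; apply: eq_bigr => i _.
by rewrite coefD scalerDl.
Qed.

Lemma cpolyZ c p T x : cpoly (c *: p) T x = c *: cpoly p T x.
Proof.
rewrite (@cpolyE _ _ _ (size p)) ?size_scale_leq// /cpoly scaler_sumr.
by apply: eq_bigr => i _; rewrite coefZ scalerA.
Qed.

Lemma cpolyC c T x : cpoly c%:P T x = c *: x.
Proof.
rewrite (@cpolyE _ _ _ 1) ?size_polyC ?leq_b1//.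
by rewrite big_ord1 coefC.
Qed.

Lemma cpolyMX p T x : cpoly (p * 'X) T x = cpoly p T (T x).
Proof.
rewrite (@cpolyE _ _ _ (size p).+1); last first.
  by rewrite (leq_trans (size_polyMleq _ _))// size_polyX addn2.
rewrite big_ord_recl coefMX/= scale0r add0r; apply: eq_bigr => i _.
by rewrite [in RHS]/= -iterSr coefMX.
Qed.

Lemma cpoly_XsubC c T x : cpoly ('X - c%:P) T x = T x - c *: x.
Proof.
rewrite cpolyD -polyCN cpolyC scaleNr -['X]mul1r cpolyMX -polyC1 cpolyC.
by rewrite scale1r.
Qed.

Lemma cpolyM p q T x : linear T -> cpoly (p * q) T x = cpoly p T (cpoly q T x).
Proof.
move=> Tl; elim/poly_ind: p q x => [|p c IH] q x.
  by rewrite mul0r -polyC0 !cpolyC !scale0r.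
rewrite mulrDl cpolyD mul_polyC cpolyZ cpolyD cpolyMX cpolyC; congr (_ + _).
rewrite -mulrA IH mulrC cpolyMX; congr (cpoly p T _).
rewrite /cpoly (lin_sum Tl); apply: eq_bigr => i _.
by rewrite (linZ Tl) -iterS iterSr.
Qed.

Lemma cpoly_linear p T : linear T -> linear (cpoly p T).
Proof.
move=> Tl a x y; rewrite /cpoly scaler_sumr -big_split/=; apply: eq_bigr => i _.
have -> : iter i T (a *: x + y) = a *: iter i T x + iter i T y.
  by elim: (nat_of_ord i) => //= k ->; rewrite Tl.
by rewrite scalerDr !scalerA mulrC.
Qed.

Lemma cpoly_bounded (p : {poly R[i]}) T M : 0 < M -> (forall x, nm (T x) <= M * nm x) ->
  exists2 L : R, 0 < L & forall x, nm (cpoly p T x) <= L * nm x.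
Proof.
move=> M0 TM; exists (\sum_(i < size p) nm p`_i * M ^+ i + 1).
  by rewrite ltr_pwDr// sumr_ge0// => i _; rewrite mulr_ge0 ?nm_ge0 ?exprn_ge0 ?ltW.
move=> x; rewrite (le_trans (nm_sum _ _))// mulrDl mul1r ler_wpDr ?nm_ge0//.
rewrite mulr_suml ler_sum// => i _; rewrite nmZ -mulrA ler_wpM2l ?nm_ge0//.
elim: (nat_of_ord i) => [|k IH] /=; first by rewrite expr0 mul1r.
by rewrite (le_trans (TM _))// exprS -mulrA ler_wpM2l// ltW.
Qed.

Definition cmap (p : {poly R}) : {poly R[i]} := map_poly (real_complex R) p.

Lemma polyopE p T x : polyop p T x = cpoly (cmap p) T x.
Proof.
rewrite /polyop /cpoly size_map_poly; apply: eq_bigr => i _.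
by rewrite coef_map.
Qed.

Lemma polyop_selfadj p T : linear T -> selfadj T -> selfadj (polyop p T).
Proof.
move=> Tl Ts x y; rewrite /polyop inner_suml inner_sumr; apply: eq_bigr => i _.
rewrite innerZl innerZr conj_Creal ?complex_real//; congr (_ * _).
elim: (nat_of_ord i) y => //= k IH y.
by rewrite Ts IH -iterSr.
Qed.

Lemma polyop_linear p T : linear T -> linear (polyop p T).
Proof. by move=> Tl a x y; rewrite !polyopE cpoly_linear. Qed.

(** The numerical range of T lies in [0, M], and |T y - r y| |y| is at least
    |y|^2 times the distance of r from it. *)
Lemma bounded_below T M (r : R[i]) : positive_op T ->
  (forall x, nm (T x) <= M * nm x) -> ~ (Im r = 0 /\ 0 <= Re r <= M) ->
  exists2 d : R, 0 < d & forall y, d * nm y <= nm (T y - r *: y).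
Proof.
move=> Tp TM hr; have Ts := pos_selfadj Tp; case: Tp => _ Tp.
have q0 y : 0 <= qf T y by rewrite -ler0c -qfE.
have qM y : qf T y <= M * nm y ^+ 2.
  by rewrite (le_trans (ler_norm _))// qf_le.
suff [d d0 h] : exists2 d : R, 0 < d & forall y,
    d * nm y ^+ 2 <= nm ('[T y - r *: y, y]).
  exists d => // y; have [->|y0] := eqVneq y 0; first by rewrite nm0 mulr0 nm_ge0.
  have ny : 0 < nm y.
    by rewrite lt_neqAle nm_ge0 andbT eq_sym; apply: contra_neq y0 => /nm_eq0.
  rewrite -(ler_pM2r ny) -mulrA -expr2 (le_trans (h y))//.
  exact: CauchySchwarz.
have E y : '[T y - r *: y, y] = (qf T y)%:C - r * (nm y ^+ 2)%:C.
  by rewrite innerBl innerZl qfE// innerxx.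
have Ere y : Re '[T y - r *: y, y] = qf T y - Re r * nm y ^+ 2.
  by rewrite E; case: r {hr E} => a b /=; rewrite !mulr0 subr0.
have Eim y : Im '[T y - r *: y, y] = - (Im r * nm y ^+ 2).
  by rewrite E; case: r {hr E Ere} => a b /=; rewrite !mulr0 !add0r.
have [im0|im0] := eqVneq (Im r) 0; last first.
  exists `|Im r|; first by rewrite normr_gt0.
  move=> y; have -> : `|Im r| * nm y ^+ 2 = `|Im '[T y - r *: y, y]|.
    by rewrite Eim normrN normrM (ger0_norm (sqr_ge0 _)).
  exact: Im_le_nm.
have [re0|re0] := ltP (Re r) 0.
  exists (- Re r); first by rewrite oppr_gt0.
  move=> y; rewrite (le_trans _ (Re_le_nm _))// Ere.
  by rewrite (le_trans _ (ler_norm _))// mulNr ler_wpDl.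
have [reM|reM] := ltP M (Re r); last by case: hr; rewrite re0 reM.
exists (Re r - M); first by rewrite subr_gt0.
move=> y; rewrite (le_trans _ (Re_le_nm _))// Ere -normrN.
by rewrite (le_trans _ (ler_norm _))// opprB mulrBl lerB.
Qed.

Lemma prod_bounded_below T M (rs : seq R[i]) : positive_op T ->
  (forall x, nm (T x) <= M * nm x) ->
  (forall r, r \in rs -> ~ (Im r = 0 /\ 0 <= Re r <= M)) ->
  exists2 d : R, 0 < d & forall y,
    d * nm y <= nm (cpoly (\prod_(r <- rs) ('X - r%:P)) T y).
Proof.
move=> Tp TM; elim: rs => [|r rs IH] hr.
  exists 1 => // y; rewrite big_nil -polyC1 cpolyC scale1r mul1r//.
have [|d1 d10 h1] := IH; first by move=> s srs; apply: hr; rewrite inE srs orbT.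
have [|d d0 h] := bounded_below Tp TM (r := r); first by apply: hr; rewrite inE eqxx.
exists (d * d1); first exact: mulr_gt0.
move=> y; rewrite big_cons cpolyM; last by case: Tp => -[].
rewrite cpoly_XsubC.
by rewrite (le_trans _ (h _))// -mulrA ler_wpM2l// ltW.
Qed.

(** Positivity of the polynomial functional calculus. If the infimum m of the
    form of p(T) over unit vectors were negative, p(T) - m would not be bounded
    below; but it is a product of factors T - r, where p(r) = m < 0 keeps r out
    of [0, M]. *)
Lemma polyop_ge0 T M (p : {poly R}) : positive_op T -> (forall x, nm (T x) <= M * nm x) ->
  (forall t, 0 <= t <= M -> 0 <= p.[t]) -> forall x, 0 <= qf (polyop p T) x.
Proof.
move=> Tp TM p0 x1; rewrite leNgt; apply/negP => qx1.
have Ts := pos_selfadj Tp; have Tl : linear T by case: Tp => -[].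
have nx1 : 0 < nm x1.
  rewrite lt_neqAle nm_ge0 andbT eq_sym; apply: contraTneq qx1 => /nm_eq0 ->.
  by rewrite /qf inner0r ltxx.
have M0 : 0 <= M.
  by rewrite -(pmulr_lge0 _ nx1) (le_trans _ (TM _))// nm_ge0.
have TM' x : nm (T x) <= (M + 1) * nm x.
  by rewrite (le_trans (TM x))// ler_wpM2r ?nm_ge0// lerDl.
have [L L0 PL] : exists2 L : R, 0 < L & forall x, nm (polyop p T x) <= L * nm x.
  have [|L L0 h] := cpoly_bounded (cmap p) _ TM'; first by rewrite ltr_pwDr.
  by exists L => // x; rewrite polyopE.
pose E := [set qf (polyop p T) x | x in [set x | nm x = 1]].
pose y1 := (nm x1)^-1%:C *: x1.
have ny1 : nm y1 = 1 by rewrite nmZ nmC gtr0_norm ?invr_gt0// mulVf// gt_eqF.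
have Ey1 : E (qf (polyop p T) y1) by exists y1.
have hE : has_inf E.
  split; first by exists (qf (polyop p T) y1).
  exists (- L) => _ [x /= nx <-].
  have := qf_le x PL; rewrite nx expr1n mulr1 ler_norml => /andP[]//.
pose m := inf E.
have m0 : m < 0.
  apply: le_lt_trans (ge_inf hE.2 Ey1) _; rewrite qfZ; last exact: polyop_linear.
  by rewrite pmulr_rlt0// exprn_gt0// nmC gtr0_norm ?invr_gt0.
pose T1 x := polyop p T x - m%:C *: x.
pose P1 := cmap (p - m%:P).
have T1E x : T1 x = cpoly P1 T x.
  rewrite /T1 /P1 /cmap rmorphB/= map_polyC/= cpolyD -polyCN cpolyC polyopE.
  by rewrite scaleNr.
have T1l : linear T1 by move=> a u v; rewrite !T1E cpoly_linear.
have T1s : selfadj T1.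
  move=> u v; rewrite /T1 innerBl innerBr innerZl innerZr conj_Creal ?complex_real//.
  by rewrite polyop_selfadj.
have qT1 u : qf T1 u = qf (polyop p T) u - m * nm u ^+ 2.
  apply: complexI; rewrite -qfE// rmorphB rmorphM/= -qfE; last exact: polyop_selfadj.
  by rewrite -innerxx /T1 innerBl innerZl.
have T1L u : nm (T1 u) <= (L + `|m|) * nm u.
  by rewrite (le_trans (nmB _ _))// mulrDl lerD// nmZ nmC.
have T1p u : 0 <= qf T1 u.
  have [->|u0] := eqVneq u 0; first by rewrite /qf inner0r.
  have nu : 0 < nm u.
    by rewrite lt_neqAle nm_ge0 andbT eq_sym; apply: contra_neq u0 => /nm_eq0.
  rewrite qT1 subr_ge0 -ler_pdivlMr ?exprn_gt0//.
  apply: (ge_inf hE.2); exists ((nm u)^-1%:C *: u) => /=.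
    by rewrite nmZ nmC gtr0_norm ?invr_gt0// mulVf// gt_eqF.
  rewrite qfZ ?nmC ?gtr0_norm ?invr_gt0//; last exact: polyop_linear.
  by rewrite exprVn mulrC.
have L'0 : 0 < L + `|m| by rewrite ltr_pwDl.
have P10 : P1 != 0.
  apply/eqP => P10; have := p0 0; rewrite lexx M0 => /(_ isT).
  have /eqP : p - m%:P = 0.
    by apply: (@map_poly_inj _ _ (real_complex R)); rewrite rmorph0.
  rewrite subr_eq0 => /eqP ->; rewrite hornerC => m0'.
  by move: m0; rewrite ltNge m0'.
have [rs Prs] := closed_field_poly_normal P1.
have root r : r \in rs -> ~ (Im r = 0 /\ 0 <= Re r <= M).
  move=> rrs [im0 /p0]; have : root P1 r.
    by rewrite Prs rootZ ?lead_coef_eq0// root_prod_XsubC.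
  have -> : r = (Re r)%:C by rewrite [LHS]complexE im0 mulr0 addr0.
  rewrite /P1 /cmap /root horner_map/= => /eqP/(@complexI _ _ 0).
  rewrite hornerD hornerN hornerC => /eqP; rewrite subr_eq0 => /eqP ->.
  by rewrite leNgt m0.
have [d d0 hd] := prod_bounded_below Tp TM root.
have lc0 : 0 < nm (lead_coef P1).
  rewrite lt_neqAle nm_ge0 andbT eq_sym; apply: contra_neq P10 => /nm_eq0/eqP.
  by rewrite lead_coef_eq0 => /eqP.
have T1d u : nm (lead_coef P1) * d * nm u <= nm (T1 u).
  by rewrite T1E [in cpoly P1]Prs cpolyZ nmZ -mulrA ler_pM2l.
pose c := nm (lead_coef P1) * d; have c0 : 0 < c by exact: mulr_gt0.
have [_ [u /= nu <-] hu] : exists2 z, E z & z < m + c ^+ 2 / (L + `|m|) / 2.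
  apply: inf_adherent => //; rewrite !divr_gt0// ?exprn_gt0//.
have := psd_bound T1l T1s L'0 (le_trans (ler_norm _) (qf_le _ T1L)) (T1p _) (x := u).
have : c ^+ 2 <= nm (T1 u) ^+ 2.
  rewrite ler_pXn2r ?nnegrE ?nm_ge0 ?(ltW c0)//.
  by have := T1d u; rewrite nu mulr1.
move=> /le_trans/[apply]; rewrite qT1 nu expr1n mulr1 leNgt => /negP; apply.
rewrite -ltr_pdivlMl// mulrC.
have : 0 < c ^+ 2 / (L + `|m|) by rewrite divr_gt0 ?exprn_gt0.
by move: hu; lra.
Qed.

End Operators.

(** * Powers of a positive operator on single vectors *)

Section FunctionalCalculus.
Context {R : realType} {H : hilbertSpace R}.
Implicit Types (A B T S : H -> H) (x y : H).

Lemma fcalc_approx f T S : is_fcalc f T S -> exists (M : R) (p : nat -> {poly R}),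
  [/\ forall x, nm (T x) <= M * nm x,
    forall e : R, 0 < e -> \forall n \near \oo,
       forall t, 0 <= t <= M -> `|(p n).[t] - f t| <= e &
    forall x, (fun n => polyop (p n) T x) @ \oo --> S x].
Proof.
move=> [M [p [TM pf pS]]]; exists M, p; split=> //.
  by move=> x; rewrite -lecR rmorphM/= -!normE.
move=> x; apply/cvg_nmP => e e0.
have [->|x0] := eqVneq x 0.
  have /pS : (0 : R) < 1 by [].
  apply: filterS => n /(_ 0); rewrite normr0 mulr0 normE lecR => /le_lt_trans.
  exact.
have nx : 0 < nm x.
  by rewrite lt_neqAle nm_ge0 andbT eq_sym; apply: contra_neq x0 => /nm_eq0.
have /pS : 0 < e / nm x / 2 by rewrite !divr_gt0.
apply: filterS => n /(_ x); rewrite !normE -rmorphM/= lecR => /le_lt_trans; apply.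
by rewrite mulrAC divfK ?gt_eqF// ltr_pdivrMr// ltr_pMr// ltr1n.
Qed.

Lemma cvg_innerl (u : nat -> H) (v y : H) : u @ \oo --> v ->
  (fun n => '[u n, y] : R[i]^o) @ \oo --> ('[v, y] : R[i]^o).
Proof.
move=> uv; apply/cvg_nmP => e e0.
have y1 : 0 < nm y + 1 by rewrite ltr_wpDl ?nm_ge0.
have /cvg_nmP/(_ (e / (nm y + 1))) := uv; rewrite divr_gt0// => /(_ isT).
apply: filterS => n; rewrite ltr_pdivlMr// -innerBl; apply: le_lt_trans.
rewrite (le_trans (CauchySchwarz _ _))// ler_wpM2l ?nm_ge0//.
by rewrite lerDl.
Qed.

Lemma cvg_innerr (u : nat -> H) (v y : H) : u @ \oo --> v ->
  (fun n => '[y, u n] : R[i]^o) @ \oo --> ('[y, v] : R[i]^o).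
Proof.
move=> /(@cvg_innerl _ _ y)/cvg_nmP uv; apply/cvg_nmP => e /uv.
by apply: filterS => n; rewrite -nmconj rmorphB/= -!innerC.
Qed.

Lemma cvg_nm (u : nat -> H) (v : H) : u @ \oo --> v ->
  (fun n => nm (u n)) @ \oo --> nm v.
Proof.
move=> /cvg_nmP uv; apply/cvgrPdist_lt => e e0; have := uv _ e0.
apply: filterS => n; apply: le_lt_trans.
rewrite ler_distl; apply/andP; split.
  by rewrite lerBlDr -[X in nm X](subrK v) (le_trans (nmD _ _))// addrC.
by rewrite -[X in nm X <= _](subrK (u n)) (le_trans (nmD _ _))// addrC nmBC.
Qed.

Lemma cvg_Re (u : nat -> R[i]) (v : R[i]) :
  (u : nat -> R[i]^o) @ \oo --> (v : R[i]^o) -> (fun n => Re (u n)) @ \oo --> Re v.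
Proof.
move=> /cvg_nmP uv; apply/cvgrPdist_lt => e /uv; apply: filterS => n.
apply: le_lt_trans; rewrite distrC -raddfB; exact: Re_le_nm.
Qed.

(** Scalar inequalities between t and f t become inequalities between T and
    S = f(T) on each vector: when the polynomials p n approximate f, the
    polynomial a (p n)^2 + b X^2 + c + d (p n) is nonnegative on [0, M] up to a
    small constant, so polyop_ge0 applies; then let n tend to infinity. *)
Lemma fcalc_ineq f T S a b c d : positive_op T -> is_fcalc f T S ->
  (forall M, exists F, forall t, 0 <= t <= M -> `|f t| <= F) ->
  (forall t, 0 <= t -> 0 <= a * f t ^+ 2 + b * t ^+ 2 + c + d * f t) ->
  forall x, 0 <= a * nm (S x) ^+ 2 + b * nm (T x) ^+ 2 + c * nm x ^+ 2 + d * qf S x.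
Proof.
move=> Tp /fcalc_approx[M [p [TM pf pS]]] fF fge0 x.
have Tl : linear T by case: Tp => -[].
have Ts := pos_selfadj Tp.
pose h n := a%:P * (p n * p n) + b%:P * ('X * 'X) + c%:P + d%:P * p n.
have hE n : qf (polyop (h n) T) x =
   a * nm (polyop (p n) T x) ^+ 2 + b * nm (T x) ^+ 2 + c * nm x ^+ 2 +
   d * qf (polyop (p n) T) x.
  have XE y : cpoly 'X T y = T y.
    by have := cpoly_XsubC 0 T y; rewrite polyC0 subr0 scale0r subr0.
  rewrite {1}/qf polyopE /h /cmap !rmorphD/= !rmorphM/= !map_polyC/= !map_polyX.
  rewrite !cpolyD !mul_polyC !cpolyZ cpolyC !cpolyM// !XE.
  rewrite -!polyopE !innerDl !innerZl.
  rewrite polyop_selfadj// Ts !innerxx [ '[polyop _ _ _, _]]qfE; last exact: polyop_selfadj.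
  by rewrite /= !mul0r !subr0.
have pScvg := cvg_nm (pS x).
have qcvg : (fun n => qf (polyop (p n) T) x) @ \oo --> qf S x.
  exact/cvg_Re/cvg_innerl.
have hcvg : (fun n => qf (polyop (h n) T) x) @ \oo -->
  a * nm (S x) ^+ 2 + b * nm (T x) ^+ 2 + c * nm x ^+ 2 + d * qf S x.
  under eq_fun do rewrite hE.
  apply: cvgD; last by apply: cvgMr.
  apply: cvgD; last exact: cvg_cst.
  apply: cvgD; last exact: cvg_cst.
  by apply: cvgMr; under eq_fun do rewrite expr2; rewrite expr2; apply: cvgM.
have [F fF'] := fF M.
have F0 : 0 <= `|F| by [].
(* k e bounds the change of a z^2 + d z when z moves by at most e <= 1 *)
pose k : R := `|a| * (2 * `|F| + 1) + `|d|.
have k0 : 0 <= k by rewrite addr_ge0// mulr_ge0// addr_ge0// mulr_ge0.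
suff hlow (e : R) : 0 < e -> e <= 1 -> \forall n \near \oo,
    - (k * e) * nm x ^+ 2 <= qf (polyop (h n) T) x.
  apply/ler_addgt0Pl => e e0.
  pose e1 := Num.min 1 (e / (k * nm x ^+ 2 + 1)).
  have kx : 0 < k * nm x ^+ 2 + 1 by rewrite ltr_wpDl// mulr_ge0// sqr_ge0.
  have e10 : 0 < e1 by rewrite lt_min ltr01 divr_gt0.
  have e11 : e1 <= 1 by rewrite ge_min lexx.
  have := hlow _ e10 e11 => low.
  rewrite -lerBlDl sub0r.
  have : - (k * e1) * nm x ^+ 2 <= a * nm (S x) ^+ 2 + b * nm (T x) ^+ 2 + c * nm x ^+ 2 + d * qf S x.
    exact: cvgr_to_ge hcvg low.
  apply: le_trans; rewrite mulNr lerN2.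
  apply: (@le_trans _ _ (e1 * (k * nm x ^+ 2 + 1))).
    by move: (ltW e10); lra.
  by rewrite -ler_pdivlMr// ge_min lexx orbT.
move=> e0 e1; have := pf _ e0; apply: filterS => n hn.
pose g := h n + (k * e)%:P.
have gpos t : 0 <= t <= M -> 0 <= g.[t].
  move=> tM; have t0 : 0 <= t by case/andP: tM.
  have := hn t tM; have := fge0 t t0; have := fF' t tM.
  rewrite /g /h !(hornerD, hornerM, hornerC, hornerX); set y := (p n).[t]; set z := f t.
  move=> zF fpos yz.
  have zF' : `|z| <= `|F| by rewrite (le_trans zF)// ler_norm.
  have h1 : `|y * y - z ^+ 2| <= (2 * `|F| + 1) * e.
    have -> : y * y - z ^+ 2 = (y - z) * ((y - z) + 2 * z) by ring.
    rewrite normrM mulrC ler_pM// (le_trans (ler_normD _ _))// addrC lerD//.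
      by rewrite normrM ger0_norm// ler_wpM2l.
    exact: le_trans yz e1.
  have h2 : `|a * (y * y - z ^+ 2)| <= `|a| * ((2 * `|F| + 1) * e).
    by rewrite normrM ler_wpM2l.
  have h3 : `|d * (y - z)| <= `|d| * e by rewrite normrM ler_wpM2l.
  move: h2 h3; rewrite !ler_norml => /andP[h2 _] /andP[h3 _].
  by rewrite /k; move: h2 h3 fpos; set A := `|a|; set D := `|d|; set F' := `|F|; lra.
have := polyop_ge0 Tp TM gpos x.
rewrite /qf polyopE /g /cmap rmorphD/= map_polyC/= cpolyD cpolyC -polyopE innerDl raddfD/=.
rewrite innerZl innerxx -rmorphM/= mulNr.
by move=> ?; rewrite -subr_ge0 opprK.
Qed.

Lemma pow_bound_nonneg (r M : R) : 0 < r -> exists F, forall t, 0 <= t <= M -> `|t `^ r| <= F.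
Proof.
move=> r0; exists (M `^ r) => t /andP[t0 tM].
rewrite ger0_norm ?powR_ge0//.
apply: ge0_ler_powR; rewrite ?nnegrE ?(ltW r0)//; exact: le_trans tM.
Qed.

Lemma powop_linear T r S : is_powop T r S -> linear S.
Proof.
move=> [[[Tl _] _] /fcalc_approx[M [p [_ _ pS]]]] a x y.
have := pS (a *: x + y).
under eq_fun do rewrite (polyop_linear _ Tl) ?Tl//.
move=> h; apply: (cvg_seq_unique h).
by apply: cvgD => //; apply: cvgZr.
Qed.

Lemma powop_qf_ge0 T r S : 0 < r -> is_powop T r S -> forall x, 0 <= qf S x.
Proof.
move=> r0 [Tp ST] x.
have := @fcalc_ineq _ _ _ 0 0 0 1 Tp ST (fun M => pow_bound_nonneg M r0) _ x.
rewrite !mul0r !add0r mul1r; apply => t t0.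
by rewrite !mul0r !add0r mul1r powR_ge0.
Qed.

Lemma powop_selfadj T r S : is_powop T r S -> selfadj S.
Proof.
move=> [Tp /fcalc_approx[M [p [_ _ pS]]]] x y.
have Tl : linear T by case: Tp => -[].
have Ts := pos_selfadj Tp.
have h1 := cvg_innerl (y := y) (pS x); have h2 := cvg_innerr (y := x) (pS y).
apply: (cvg_seq_unique h1).
by under eq_fun do rewrite polyop_selfadj//.
Qed.

Lemma powop_pos T r S : 0 < r -> is_powop T r S -> positive_op S.
Proof.
move=> r0 ST; have Sl := powop_linear ST; have Ss := powop_selfadj ST.
split; last by move=> x; rewrite qfE// ler0c; exact: powop_qf_ge0 r0 ST x.
move: (ST) => [Tp Sf]; apply/bounded_opP; split=> //.
have [/bounded_opP[_ [M M0 TM]] _] := Tp.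
have [L L0 h] : exists2 L : R, 0 < L & forall x, nm (S x) <= L * nm x.
  move: Sf => [M1 [p [_ _ pS]]]; have /pS[N _ hN] : (0 : R) < 1 by [].
  have [L L0 hL] := cpoly_bounded (cmap (p N)) M0 TM.
  exists (L + 1); first by rewrite ltr_pwDl.
  move=> x; rewrite mulrDl mul1r -[X in nm X](subrK (polyop (p N) T x)) addrC.
  rewrite (le_trans (nmD _ _))// lerD//; first by rewrite polyopE.
  by rewrite nmBC -[leRHS]mul1r -lecR rmorphM/= -!normE; exact: (hN N (leqnn N)).
by exists L.
Qed.

(** Young's inequality for the conjugate exponents 1/a and 1/(1 - a). *)
Lemma powR_amgm (u s a : R) : 0 <= u -> 0 < s -> 0 < a <= 1 ->
  u `^ a * s `^ (1 - a) <= a * u + (1 - a) * s.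
Proof.
move=> u0 s0 /andP[a0]; rewrite le_eqVlt => /predU1P[->|a1].
  by rewrite subrr powRr0 mulr1 powRr1// mul1r mul0r addr0.
have a1' : 0 < 1 - a by rewrite subr_gt0.
have := @conjugate_powR _ (u `^ a) (s `^ (1 - a)) a^-1 (1 - a)^-1.
rewrite !powR_ge0 !invr_gt0 a0 a1' !invrK subrKC -!powRrM.
rewrite !mulfV ?gt_eqF// !powRr1 ?u0 ?(ltW s0)// [u * _]mulrC [s * _]mulrC.
by apply.
Qed.

Lemma powR_sqr (y a : R) : 0 <= y -> (y ^+ 2) `^ a = (y `^ a) ^+ 2.
Proof.
by move=> y0; rewrite -(powR_mulrn 2 y0) -(powR_mulrn 2 (powR_ge0 y a)) powRAC.
Qed.

(** Last step of the two bounds below, where X and Y are the norms of two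
    vectors. *)
Lemma powR_amgm_concl (X Y s a : R) : 0 <= X -> 0 <= Y -> 0 < s ->
  (s ^+ 2) `^ (1 - a) * X ^+ 2 <= s ^+ 2 * Y ^+ 2 -> X <= s `^ a * Y.
Proof.
move=> X0 Y0 s0 h.
rewrite -(ler_pXn2r (_ : 0 < 2)%N) ?nnegrE ?mulr_ge0 ?powR_ge0//.
have s20 : 0 < s ^+ 2 by rewrite exprn_gt0.
have cgt : 0 < (s ^+ 2) `^ (1 - a) by exact: powR_gt0.
rewrite -(ler_pM2l cgt) (le_trans h)// exprMn [leRHS]mulrA ler_wpM2r ?sqr_ge0//.
rewrite -(powR_sqr _ (ltW s0)).
rewrite -powRD; last by apply/implyP => _; rewrite gt_eqF.
by rewrite subrK powRr1// ltW.
Qed.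

(** The tangent line at s^2 dominates the concave function u^a; at u = t^2 this
    bounds |T^a x|^2 in terms of |T x|^2 and |x|^2, for each single x. *)
Lemma powop_root_bound T S (a s : R) x : 0 < a <= 1 -> is_powop T a S -> 0 < s ->
  nm (T x) <= s * nm x -> nm (S x) <= s `^ a * nm x.
Proof.
move=> a01 [Tp ST] s0 Tx; have /andP[a0 a1] := a01.
apply: powR_amgm_concl; rewrite ?nm_ge0//.
have := @fcalc_ineq _ _ _ (- (s ^+ 2) `^ (1 - a)) a ((1 - a) * s ^+ 2) 0 Tp ST
  (fun M => pow_bound_nonneg M a0) _ x.
have : nm (T x) ^+ 2 <= s ^+ 2 * nm x ^+ 2.
  by rewrite -exprMn ler_pXn2r ?nnegrE ?mulr_ge0 ?nm_ge0// ltW.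
move=> /(ler_wpM2l (ltW a0)) Tx2 h.
rewrite -subr_ge0 (le_trans (h _))//; last by lra.
move=> t t0; rewrite mul0r addr0.
have := @powR_amgm (t ^+ 2) (s ^+ 2) a (sqr_ge0 t) (exprn_gt0 2 s0) a01.
rewrite (powR_sqr _ t0).
by lra.
Qed.

(** The same tangent line, read at u = (t^q)^2 and with exponent 1/q, goes back
    from T^q to T, so that a bound for |B|^q gives one for |B|. *)
Lemma powop_power_bound T S (q s : R) x : 1 <= q -> is_powop T q S -> 0 < s ->
  nm (S x) <= s * nm x -> nm (T x) <= s `^ q^-1 * nm x.
Proof.
move=> q1 [Tp ST] s0 Sx; have q0 : 0 < q by exact: lt_le_trans q1.
have a01 : 0 < q^-1 <= 1 by rewrite invr_gt0 q0 invf_le1.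
have /andP[a0 a1] := a01.
apply: powR_amgm_concl; rewrite ?nm_ge0//.
have := @fcalc_ineq _ _ _ q^-1 (- (s ^+ 2) `^ (1 - q^-1)) ((1 - q^-1) * s ^+ 2) 0 Tp ST
  (fun M => pow_bound_nonneg M q0) _ x.
have : nm (S x) ^+ 2 <= s ^+ 2 * nm x ^+ 2.
  by rewrite -exprMn ler_pXn2r ?nnegrE ?mulr_ge0 ?nm_ge0// ltW.
move=> /(ler_wpM2l (ltW a0)) Sx2 h.
rewrite -subr_ge0 (le_trans (h _))//; last by lra.
move=> t t0; rewrite mul0r addr0.
have := @powR_amgm ((t `^ q) ^+ 2) (s ^+ 2) q^-1 (sqr_ge0 _) (exprn_gt0 2 s0) a01.
have -> : ((t `^ q) ^+ 2) `^ q^-1 = t ^+ 2.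
  by rewrite powR_sqr ?powR_ge0// -powRrM mulfV ?gt_eqF// powRr1.
by lra.
Qed.

End FunctionalCalculus.

(** * Compactness of operators *)

Section Compact.
Context {R : realType} {H : hilbertSpace R}.
Implicit Types (A B K : H -> H) (x y : H).

Definition totally_bounded (X : set H) := forall e : R, 0 < e ->
  exists s : seq H, forall x, X x -> exists2 z, z \in s & nm (x - z) < e.

Lemma ultra_bigU (F : set_system H) (FU : UltraFilter F) (s : seq H) (P : H -> set H) :
  F [set y | exists2 z, z \in s & P z y] -> exists2 z, z \in s & F (P z).
Proof.
have FF : Filter F by exact: (@filter_filter _ F ultra_proper).
elim: s => [|a s IH].
  move=> h; have : F set0 by apply: filterS h => y [].
  by move/(@filter_not_empty _ _ ultra_proper).
move=> h; have [FP|FP] := in_ultra_setVsetC (P a) FU.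
  by exists a => //; rewrite inE eqxx.
have [|z zs Fz] := IH; last by exists z => //; rewrite inE zs orbT.
apply: (@filterS _ F FF _ _ _ (filterI FP h)) => y [nPy [z]].
by rewrite inE => /predU1P[->//|zs Pzy]; exists z.
Qed.

(** An ultrafilter contains a member of each finite cover by balls, so it is
    Cauchy, and the space is complete. *)
Lemma totally_bounded_precompact X : totally_bounded X -> precompact X.
Proof.
move=> Xtb; rewrite precompactE compact_ultra => F FU FX.
have FP : ProperFilter F by apply: ultra_proper.
have Fc : cvg F.
  apply: cauchy_cvg; apply: cauchy_exP => eC eC0.
  have eR : eC = (Re eC)%:C by rewrite RRe_real// gtr0_real.
  move: eC0; rewrite eR ltcR; set e := Re eC => e0.
  have e20 : 0 < e / 2 by rewrite divr_gt0.
  have [s hs] := Xtb _ e20.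
  have [|z zs Fz] := @ultra_bigU F FU s (fun z => [set y | nm (y - z) < e]).
    have e2C : 0 < (e / 2)%:C :> R[i] by rewrite ltcR.
    apply: filterS FX => y /(_ _ (nbhsx_ballx y _ e2C))[x [Xx]].
    rewrite -ball_normE /= normE ltcR => yx.
    have [z zs xz] := hs _ Xx; exists z => //=.
    rewrite (splitr e) -(subrK x y) -addrA (le_lt_trans (nmD _ _))//.
    by rewrite ltrD.
  exists z; apply: filterS Fz => y /=.
  by rewrite -ball_normE /= normE ltcR nmBC.
have Fl : F --> lim F by exact: Fc.
set l := lim F in Fl; exists l; split => //; apply: closed_closure => B Bl.
exact: (@filter_ex _ _ FP _ (filterI FX (Fl _ Bl))).
Qed.

Lemma real_net (d : R) : 0 < d ->
  exists s : seq R, forall t, `|t| <= 1 -> exists2 u, u \in s & `|t - u| < d.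
Proof.
move=> d0; pose d' := d / 2; have d'0 : 0 < d' by rewrite divr_gt0.
exists [seq k%:R * d' - 1 | k <- iota 0 (Num.truncn (2 / d')).+1] => t.
rewrite ler_norml => /andP[t1 t2].
have x0 : 0 <= (t + 1) / d' by rewrite divr_ge0 ?(ltW d'0)//; lra.
pose k := Num.truncn ((t + 1) / d').
have /andP[k1 k2] := truncn_itv x0; rewrite -/k in k1 k2.
exists (k%:R * d' - 1).
  apply/mapP; exists k => //; rewrite mem_iota/= add0n ltnS.
  by apply: le_truncn; rewrite ler_pM2r ?invr_gt0//; lra.
move: k1 k2; rewrite ler_pdivlMr// ltr_pdivrMr// -natr1 => k1 k2.
have -> : t - (k%:R * d' - 1) = t + 1 - k%:R * d' by ring.
rewrite ger0_norm; last by lra.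
by move: k2 d'0; rewrite /d'; lra.
Qed.

Lemma line_net (v : H) (d : R) : 0 < d -> exists s : seq H,
  forall c : R[i], nm c <= 1 -> exists2 z, z \in s & nm (c *: v - z) < d.
Proof.
move=> d0; have v1 : 0 < nm v + 1 by rewrite ltr_wpDl ?nm_ge0.
pose d' := d / (nm v + 1) / 2.
have d'0 : 0 < d' by rewrite !divr_gt0.
have [s hs] := real_net d'0.
exists [seq (a +i* b)%C *: v | a <- s, b <- s] => c c1.
have [a as_ ha] := hs (Re c) (le_trans (Re_le_nm _) c1).
have [b bs hb] := hs (Im c) (le_trans (Im_le_nm _) c1).
exists ((a +i* b)%C *: v); first by apply/allpairsP; exists (a, b).
rewrite -scalerBl nmZ.
have : nm (c - (a +i* b)%C) < d / (nm v + 1).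
  rewrite (le_lt_trans (nm_le_ReIm _))// (splitr (d / _)).
  by case: c {c1} ha hb => cr ci /= ha hb; rewrite ltrD.
rewrite ltr_pdivlMr//; apply: le_lt_trans.
by rewrite ler_wpM2l ?nm_ge0// lerDl.
Qed.

Lemma comb_net (I : eqType) (s : seq I) (v : I -> H) (d : R) : 0 < d -> exists t : seq H,
  forall c : I -> R[i], (forall a, nm (c a) <= 1) ->
  exists2 z, z \in t & nm (\sum_(a <- s) c a *: v a - z) < d.
Proof.
elim: s d => [|a s IH] d d0.
  exists [:: 0] => c _; exists 0; rewrite ?inE// big_nil subr0 nm0//.
have d20 : 0 < d / 2 by rewrite divr_gt0.
have [t ht] := IH _ d20; have [s' hs'] := line_net (v a) d20.
exists [seq x + y | x <- s', y <- t] => c c1.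
have [x xs hx] := hs' _ (c1 a); have [y yt hy] := ht _ c1.
exists (x + y); first by apply/allpairsP; exists (x, y).
rewrite big_cons (splitr d) opprD addrACA (le_lt_trans (nmD _ _))//.
by rewrite ltrD.
Qed.

(** Smallness of A on subspaces of finite codimension. For a bounded operator
    this is compactness, in the form in which it is proved and used below. *)
Definition almost_finite A : Prop := forall e : R, 0 < e ->
  exists s : seq H, forall x, perp s x -> nm (A x) <= e * nm x.

(** Up to a small error the image of the unit ball is the image of the unit ball
    of a finite-dimensional subspace, hence contained in a set of combinations
    with coefficients in the unit disc. *)
Lemma almost_finite_compact A : linear A -> almost_finite A -> compact_op A.
Proof.
move=> Al Af; split=> //; apply: totally_bounded_precompact => e e0.
have e20 : 0 < e / 2 by rewrite divr_gt0.
have e40 : 0 < e / 2 / 2 by rewrite divr_gt0.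
have [s0 hs0] := Af _ e40.
have [s [os _ _ hs]] := @orthon_hull _ _ [::] s0 isT.
have {hs0 hs} hA x : perp s x -> nm (A x) <= e / 2 / 2 * nm x.
  by move=> sx; apply: hs0 => a /hs; exact: perp_inspan sx.
have [t ht] := comb_net s A e20.
exists t => _ [x /= x1 <-].
have {}x1 : nm x <= 1 by rewrite -lecR -normE.
have [a|z zt hz] := ht (fun a => if a \in s then '[x, a] else 0).
  case: ifP => [sa|_]; last by rewrite nm0.
  rewrite (le_trans (CauchySchwarz _ _))//.
  suff -> : nm a = 1 by rewrite mulr1.
  apply/eqP; rewrite -(eqrXn2 (_ : 0 < 2)%N) ?nm_ge0// expr1n.
  apply/eqP/complexI; rewrite -innerxx.
  by case/andP: os => _ /allP/(_ a sa)/eqP.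
exists z => //.
have E : A x = A (x - proj s x) + \sum_(a <- s) (if a \in s then '[x, a] else 0) *: A a.
  rewrite -[X in A X = _](subrK (proj s x)) [LHS](linD Al); congr (_ + _).
  rewrite /proj (lin_sum Al); apply: eq_big_seq => a ->.
  by rewrite (linZ Al).
rewrite E -addrA (le_lt_trans (nmD _ _))// (splitr e) ler_ltD//.
rewrite (le_trans (hA _ (perp_sub_proj _ _)))//.
rewrite (@le_trans _ _ (e / 2 / 2 * 1))//; last by rewrite mulr1; lra.
by rewrite ler_wpM2l ?(ltW e40)// (le_trans (nm_sub_proj _ _)).
Qed.

(** Replaces the extraction of a convergent subsequence: Q e is meant to be the
    set of the points of the unit ball that are optimal up to e. *)
Lemma compact_cluster K (Q : R -> set H) : compact_op K ->
  (forall e, 0 < e -> exists x, Q e x) ->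
  (forall e e', 0 < e -> e <= e' -> Q e `<=` Q e') ->
  (forall e x, Q e x -> nm x <= 1) ->
  exists y, forall e, 0 < e -> exists2 x, Q e x & nm (K x - y) < e.
Proof.
move=> [_ [U UK [Uc _]]] Qex Qle Q1.
pose F : set_system H := filter_from [set e : R | 0 < e] (fun e => K @` Q e).
have FF : Filter F.
  apply: filter_from_filter; first by exists 1 => /=.
  move=> i j /= i0 j0; exists (Num.min i j); first by rewrite /= lt_min i0.
  have m0 : 0 < Num.min i j by rewrite lt_min i0.
  by move=> _ [x Qx <-]; split; exists x => //; apply: Qle Qx => //; rewrite ge_min lexx ?orbT.
have FP : ProperFilter F.
  by apply: filter_from_proper => e /= e0; have [x Qx] := Qex e e0; exists (K x); exists x.
have [|y [_ hy]] := Uc F FP.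
  exists 1 => //= _ [x Qx <-]; apply: UK; exists x => //=.
  by rewrite normE lecR; exact: Q1 Qx.
exists y => e e0.
have eC : 0 < e%:C :> R[i] by rewrite ltcR.
have [|_ [[x Qx <-]]] := hy (K @` Q e) _ _ (nbhsx_ballx y _ eC).
  by exists e.
by rewrite -ball_normE /= normE ltcR nmBC => h; exists x.
Qed.

End Compact.

(** * Orthonormal families and eigenvalues of compact self-adjoint operators *)

Section OrthoFamily.
Context {R : realType} {H : hilbertSpace R}.
Implicit Types (x y : H) (b : nat -> bool) (f : nat -> H).

(** An orthonormal family, where b n = false stands for a missing n-th vector:
    an operator may have only finitely many positive eigenvalues. *)
Definition orthofam b f : Prop := forall i j, '[f i, f j] = ((i == j) && b i)%:R.

Definition famlist f n : seq H := [seq x <- [seq f i | i <- iota 0 n] | x != 0].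

Variables (b : nat -> bool) (f : nat -> H).
Hypothesis fo : orthofam b f.

Lemma fam0 n : b n = false -> f n = 0.
Proof.
move=> bn; apply: nm_eq0; apply/eqP; rewrite -sqrf_eq0; apply/eqP/complexI.
by rewrite -innerxx fo bn andbF.
Qed.

Lemma fam_nm n : nm (f n) <= 1.
Proof.
rewrite -(ler_pXn2r (_ : 0 < 2)%N) ?nnegrE ?nm_ge0// expr1n.
rewrite -lecR -innerxx fo eqxx/=.
by rewrite rmorph1; case: (b n); rewrite ?lexx ?ler01.
Qed.

Lemma fam_neq0 n : b n -> f n != 0.
Proof.
move=> bn; apply/eqP => f0; have := fo n n.
by rewrite f0 inner0l eqxx bn => /esym/eqP; rewrite oner_eq0.
Qed.

Lemma famlist_orthon n : orthon (famlist f n).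
Proof.
rewrite /orthon; apply/andP; split.
  apply/pairwise_filter; rewrite pairwise_map.
  have : uniq (iota 0 n) by exact: iota_uniq.
  rewrite uniq_pairwise; apply: sub_pairwise => i j ij.
  by rewrite /= fo (negbTE ij).
apply/allP => x; rewrite mem_filter => /andP[x0 /mapP[i _ xi]].
rewrite xi fo eqxx/=; case bi : (b i) => //; exfalso.
by move/eqP: x0; apply; rewrite xi fam0.
Qed.

Lemma famlist_size n : (size (famlist f n) <= n)%N.
Proof. by rewrite size_filter (leq_trans (count_size _ _))// size_map size_iota. Qed.

Lemma perp_famlist n x : perp (famlist f n) x <->
  forall j, (j < n)%N -> '[x, f j] = 0.
Proof.
split=> [h j jn|h a].
  have [->|fj] := eqVneq (f j) 0; first by rewrite inner0r.
  by apply: h; rewrite mem_filter fj/=; apply/mapP; exists j; rewrite ?mem_iota.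
rewrite mem_filter => /andP[_ /mapP[j]]; rewrite mem_iota => /andP[_ jn] ->.
exact: h.
Qed.

Lemma famlist_sum (V : zmodType) (g : H -> V) n : g 0 = 0 ->
  \sum_(x <- famlist f n) g x = \sum_(i < n) g (f i).
Proof.
move=> g0; rewrite /famlist big_filter -(big_mkord xpredT (g \o f)) /index_iota subn0.
rewrite -(big_map f xpredT) [RHS](bigID (fun x => x != 0))/= [X in _ = _ + X]big1 ?addr0//.
by move=> x; rewrite negbK => /eqP ->.
Qed.

Lemma fam_Bessel n x : \sum_(i < n) nm '[x, f i] ^+ 2 <= nm x ^+ 2.
Proof.
rewrite -(famlist_sum (g := fun a => nm '[x, a] ^+ 2)) ?Bessel ?famlist_orthon//.
by rewrite inner0r nm0 expr0n.
Qed.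

Lemma fam_nm_sum (c : nat -> R[i]) m n :
  nm (\sum_(m <= k < n) c k *: f k) ^+ 2 <= \sum_(m <= k < n) nm (c k) ^+ 2.
Proof.
have [nm_|mn] := leqP n m; first by rewrite !big_geq// nm0 expr0n.
elim: n mn => // n IH; rewrite ltnS leq_eqVlt => /predU1P[<-|mn].
  rewrite !big_nat1 nmZ exprMn ler_piMr ?sqr_ge0//.
  by rewrite exprn_ile1 ?nm_ge0 ?fam_nm.
rewrite !big_nat_recr ?(ltnW mn)//= nmDo.
  rewrite lerD ?IH// nmZ exprMn ler_piMr ?sqr_ge0//.
  by rewrite exprn_ile1 ?nm_ge0 ?fam_nm.
rewrite inner_suml big_nat_cond big1// => k /andP[/andP[_ kn] _].
by rewrite innerZl innerZr fo (ltn_eqF kn) !mulr0.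
Qed.

(** Riesz-Fischer: the squared distance of two partial sums is at most a section
    of the series of the squares, and those have a finite supremum. *)
Lemma fam_series_cvg (c : nat -> R[i]) (B : R) :
  (forall n, \sum_(k < n) nm (c k) ^+ 2 <= B) ->
  cvg ((fun n => \sum_(k < n) c k *: f k) @ \oo).
Proof.
move=> cB; set s := fun n : nat => _.
pose t n := \sum_(0 <= k < n) nm (c k) ^+ 2.
have ht : has_sup (range t).
  split; first by exists (t 0%N); exists 0%N.
  by exists B => _ [n _ <-]; rewrite /t big_mkord.
apply: cauchy_cvg; apply: cauchy_exP => eC eC0.
have eR : eC = (Re eC)%:C by rewrite RRe_real// gtr0_real.
move: eC0; rewrite eR ltcR; set e := Re eC => e0.
have e20 : 0 < e ^+ 2 by rewrite exprn_gt0.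
have [_ [N _ <-] hN] := sup_adherent e20 ht.
exists (s N); exists N => // n /= Nn.
rewrite -ball_normE /= normE ltcR nmBC.
rewrite -(ltr_pXn2r (_ : 0 < 2)%N) ?nnegrE ?nm_ge0 ?(ltW e0)//.
have -> : s n - s N = \sum_(N <= k < n) c k *: f k.
  rewrite /s -!(big_mkord xpredT (fun k => c k *: f k)).
  by rewrite (big_cat_nat _ Nn)//= addrAC subrr add0r.
rewrite (le_lt_trans (fam_nm_sum _ _ _))//.
have : t n <= sup (range t) by apply: (ub_le_sup ht.2); exists n.
have -> : t n = t N + \sum_(N <= k < n) nm (c k) ^+ 2 by rewrite /t (big_cat_nat _ Nn).
by move: hN; lra.
Qed.

End OrthoFamily.

Section EigenSystem.
Context {R : realType} {H : hilbertSpace R}.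
Implicit Types (A B K : H -> H) (x y : H) (l : nat -> R) (f : nat -> H).

Lemma le0_small (a C : R) : 0 <= C -> (forall d, 0 < d -> a <= C * d) -> a <= 0.
Proof.
move=> C0 h; apply/ler_addgt0Pl => e e0; rewrite addr0.
have C1 : 0 < C + 1 by rewrite ltr_wpDl.
rewrite (le_trans (h (e / (C + 1)) _)) ?divr_gt0//.
by rewrite mulrCA ger_pMr// ler_pdivrMr// mul1r lerDl.
Qed.

Lemma nm_small (V : normedModType R[i]) (z : V) C : 0 <= C ->
  (forall d, 0 < d -> nm z <= C * d) -> z = 0.
Proof.
move=> C0 h; apply: nm_eq0; apply/eqP; rewrite eq_le nm_ge0 andbT.
exact: le0_small h.
Qed.

Definition top_value K (fs : seq H) : R :=
  sup [set qf K x | x in [set x | perp fs x /\ nm x <= 1]].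

(** Let s be the supremum of the form of K over the unit ball of the invariant
    subspace. There T = s - K is positive, so near-maximizers x, for which
    <T x, x> is small, satisfy K x = s x approximately (psd_bound). When s > 0,
    a cluster point of their images is therefore an eigenvector. *)
Lemma top_eigenvector K (fs : seq H) : bounded_op K -> selfadj K -> compact_op K ->
  (forall a, a \in fs -> exists c : R, K a = c%:C *: a) ->
  [/\ 0 <= top_value K fs,
      forall x, perp fs x -> qf K x <= top_value K fs * nm x ^+ 2 &
      exists x, [/\ perp fs x, K x = (top_value K fs)%:C *: x &
        '[x, x] = (0 < top_value K fs)%R%:R]].
Proof.
move=> /bounded_opP[Kl [M M0 KM]] Ks Kc Kfs; rewrite /top_value.
set E := [set _ | _ in _]; set s := sup E.
have E0 : E 0.
  exists 0; last by rewrite /qf inner0r.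
  by split; [move=> a _; rewrite inner0l | rewrite nm0 ler01].
have hE : has_sup E.
  split; first by exists 0.
  exists M => _ [x [_ x1] <-]; rewrite (le_trans (ler_norm _))//.
  rewrite (le_trans (qf_le _ KM))// ger_pMr// exprn_ile1 ?nm_ge0//.
have s0 : 0 <= s by exact: (ub_le_sup hE.2).
have hs x : perp fs x -> qf K x <= s * nm x ^+ 2.
  move=> px; have [->|x0] := eqVneq x 0.
    by rewrite /qf inner0r nm0 expr0n mulr0.
  have nx : 0 < nm x.
    by rewrite lt_neqAle nm_ge0 andbT eq_sym; apply: contra_neq x0 => /nm_eq0.
  rewrite -ler_pdivrMr ?exprn_gt0//; apply: (ub_le_sup hE.2).
  exists ((nm x)^-1%:C *: x).
    split; first exact: perpZ.
    by rewrite nmZ nmC gtr0_norm ?invr_gt0// mulVf// gt_eqF.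
  by rewrite qfZ// nmC gtr0_norm ?invr_gt0// exprVn mulrC.
split=> //; have [sgt|] := ltP 0 s; last first.
  move=> sle; have -> : s = 0 by apply/eqP; rewrite eq_le sle.
  exists 0; rewrite (lin0 Kl) scaler0 inner0l; split=> // a _.
  by rewrite inner0l.
have Kperp x : perp fs x -> perp fs (K x).
  move=> px a afs; have [c Kc'] := Kfs a afs.
  by rewrite Ks Kc' innerZr px// mulr0.
pose T x := s%:C *: x - K x.
have Tl : linear T.
  move=> a u v; rewrite /T Kl scalerDr opprD addrACA; congr (_ + _).
  by rewrite scalerBr !scalerA mulrC.
have Ts : selfadj T.
  move=> u v; rewrite /T innerBl innerBr innerZl innerZr Ks.
  by rewrite conj_Creal ?complex_real.
pose L := s + M; have L0 : 0 < L by rewrite addr_gt0.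
have TL u : nm (T u) <= L * nm u.
  by rewrite (le_trans (nmB _ _))// mulrDl lerD// nmZ nmC ger0_norm.
have qT u : qf T u = s * nm u ^+ 2 - qf K u.
  apply: complexI; rewrite -qfE// rmorphB rmorphM/= -qfE//.
  by rewrite -innerxx /T innerBl innerZl.
have Tp u : perp fs u -> 0 <= qf T u by move=> /hs; rewrite qT subr_ge0.
pose Q (e : R) x := [/\ perp fs x, nm x <= 1 & s - e < qf K x].
(* y is a limit of K x, hence of s x, for near-maximizers x *)
have [||e x []//|y hy] := @compact_cluster _ _ K Q Kc.
- move=> e e0; have [_ [x [px x1] <-] hx] := sup_adherent e0 hE.
  by exists x.
- move=> e e' e0 ee' x [px x1 hx]; split=> //; apply: le_lt_trans hx.
  by rewrite lerB.
have {}hy d : 0 < d -> exists x, [/\ perp fs x, nm x <= 1, s - d < qf K x,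
    nm (s%:C *: x - y) <= 2 * d & nm (K x - y) <= d].
  move=> d0; pose e := Num.min d (d ^+ 2 / L).
  have e0 : 0 < e by rewrite lt_min d0 divr_gt0// exprn_gt0.
  have [x [px x1 hx] Kxy] := hy _ e0.
  have ed : e <= d by rewrite ge_min lexx.
  have Kxy' : nm (K x - y) <= d by rewrite (le_trans (ltW Kxy)).
  exists x; split=> //; first by apply: le_lt_trans hx; rewrite lerB.
  have Tx : nm (T x) <= d.
    rewrite -(ler_pXn2r (_ : 0 < 2)%N) ?nnegrE ?nm_ge0 ?(ltW d0)//.
    have := psd_bound Tl Ts L0 (le_trans (ler_norm _) (qf_le _ TL)) (x := x).
    have -> : 0 <= qf T (x - L^-1%:C *: T x).
      by apply/Tp/perpB => //; apply/perpZ/perpB; [exact: perpZ|exact: Kperp].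
    move=> /(_ isT)/le_trans; apply.
    rewrite -ler_pdivlMl// mulrC; apply: (@le_trans _ _ e); last by rewrite ge_min lexx orbT.
    rewrite qT lerBlDr; apply: (@le_trans _ _ s); last by rewrite -lerBlDl ltW.
    by rewrite ger_pMr// exprn_ile1 ?nm_ge0.
  have -> : s%:C *: x - y = T x + (K x - y) by rewrite /T addrA subrK.
  by rewrite (le_trans (nmD _ _))// mulr_natl mulr2n lerD.
have py : perp fs y.
  move=> a afs; apply: (@nm_small R[i]^o _ (2 * nm a)); first by rewrite mulr_ge0 ?nm_ge0.
  move=> d d0; have [x [px x1 _ h _]] := hy d d0.
  have -> : '[y, a] = - '[s%:C *: x - y, a].
    by rewrite innerBl innerZl px// mulr0 sub0r opprK.
  rewrite nmN (le_trans (CauchySchwarz _ _))// mulrAC.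
  by rewrite ler_wpM2r ?nm_ge0.
have Ky : K y = s%:C *: y.
  apply/eqP; rewrite -subr_eq0; apply/eqP.
  apply: (@nm_small _ _ (2 * M + s)); first by rewrite addr_ge0// mulr_ge0 ?ltW.
  move=> d d0; have [x [px x1 _ h1 h2]] := hy d d0.
  have -> : K y - s%:C *: y = K (y - s%:C *: x) + s%:C *: (K x - y).
    by rewrite (linB Kl) (linZ Kl) scalerBr addrA subrK.
  rewrite (le_trans (nmD _ _))// mulrDl lerD//.
    rewrite (le_trans (KM _))// nmBC (le_trans (ler_wpM2l (ltW M0) h1))//; lra.
  by rewrite nmZ nmC ger0_norm// ler_wpM2l.
have y0 : y != 0.
  apply/eqP => y0; have s40 : 0 < s / 4 by rewrite divr_gt0.
  have [x [px x1 h1 _]] := hy _ s40; rewrite y0 subr0 => h2.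
  have : qf K x <= s / 4.
    rewrite (le_trans (Re_inner_le _ _))// -[leRHS]mulr1.
    by rewrite ler_pM ?nm_ge0.
  by move: h1; lra.
have ny0 : nm y != 0 by apply: contra_neq y0 => /nm_eq0.
exists ((nm y)^-1%:C *: y); split; first exact: perpZ.
  by rewrite (linZ Kl) Ky !scalerA mulrC.
by rewrite innerxx nmZ nmC ger0_norm ?invr_ge0 ?nm_ge0// mulVf// expr1n.
Qed.

(** Eigenvalues of K from the top, with an orthonormal family of eigenvectors;
    once the form of K is nonpositive on the remaining subspace, the values are
    0 and the zero vector takes the place of a missing eigenvector. *)
Definition eigsys K l f : Prop :=
  [/\ forall n, 0 <= l n,
      forall m n, (m <= n)%N -> l n <= l m,
      orthofam (fun i => 0 < l i) f,
      forall n, K (f n) = (l n)%:C *: f n &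
      forall n x, (forall j, (j < n)%N -> '[x, f j] = 0) ->
        qf K x <= l n * nm x ^+ 2].

(** Each eigenvector is chosen orthogonally to the list of the previous ones. *)
Fixpoint greedy (g : seq H -> H) n : seq H :=
  if n is m.+1 then rcons (greedy g m) (g (greedy g m)) else [::].

Lemma eigsys_exists K : bounded_op K -> selfadj K -> compact_op K ->
  exists l f, eigsys K l f.
Proof.
move=> Kb Ks Kc.
pose good (fs : seq H) := forall a, a \in fs -> exists c : R, K a = c%:C *: a.
have [g hg] : exists g : seq H -> H, forall fs, good fs ->
    [/\ perp fs (g fs), K (g fs) = (top_value K fs)%:C *: g fs &
        '[g fs, g fs] = (0 < top_value K fs)%R%:R].
  have /choice[g hg] : forall fs, exists x, good fs ->
    [/\ perp fs x, K x = (top_value K fs)%:C *: x &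
        '[x, x] = (0 < top_value K fs)%R%:R].
    move=> fs; have [gfs|] := pselect (good fs); last by exists 0.
    by have [_ _ [x hx]] := top_eigenvector Kb Ks Kc gfs; exists x.
  by exists g.
pose F := greedy g.
pose f n := g (F n); pose l n := top_value K (F n).
have memF n a : a \in F n <-> exists2 j, (j < n)%N & a = f j.
  elim: n => [|n IH] /=; first by split=> [|[]].
  rewrite mem_rcons inE; split.
    case/predU1P => [->|/IH[j jn ->]]; first by exists n.
    by exists j => //; apply: leqW.
  move=> [j]; rewrite ltnS leq_eqVlt => /predU1P[-> ->|jn aj].
    by rewrite eqxx.
  by apply/orP; right; apply/IH; exists j.
have gF n : good (F n).
  elim: n => [|n IH] a /=; first by rewrite in_nil.
  rewrite mem_rcons inE => /predU1P[->|]; last exact: IH.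
  by exists (l n); have [_ ->] := hg _ IH.
have perpF n x : perp (F n) x <-> (forall j, (j < n)%N -> '[x, f j] = 0).
  split=> [h j jn|h a /memF[j jn ->]]; last exact: h.
  by apply/h/memF; exists j.
have top n := top_eigenvector Kb Ks Kc (gF n).
have ff i j : (i < j)%N -> '[f j, f i] = 0.
  by move=> ij; have [/perpF h _ _] := hg _ (gF j); apply: h.
exists l, f; split.
- by move=> n; have [] := top n.
- suff step n : l n.+1 <= l n.
    by apply: (homo_leq (r := fun a b => b <= a)) => // a b c /[swap]; exact: le_trans.
  have [_ hn _] := top n; have [ln1 _ [x [px Kx xx]]] := top n.+1.
  move: ln1; rewrite le_eqVlt => /predU1P[l0|l0].
    by rewrite -[l n.+1]/(top_value _ _) -l0; have [] := top n.
  have px' : perp (F n) x by move=> a an; apply: px; rewrite /= mem_rcons inE an orbT.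
  have := hn x px'; rewrite /qf Kx innerZl.
  have nx : nm x ^+ 2 = 1 by apply: complexI; rewrite -innerxx xx l0.
  by rewrite innerxx nx mulr1 -rmorphM/= mulr1.
- move=> i j; case: ltngtP => ij/=; first by apply/orthoC/ff.
    by rewrite ff.
  by rewrite -ij; have [_ _] := hg _ (gF i).
- by move=> n; have [_] := hg _ (gF n).
- by move=> n x /perpF px; have [_ h _] := top n; apply: h.
Qed.

Section EigTheory.
Variables (K : H -> H) (l : nat -> R) (f : nat -> H).
Hypothesis Kf : eigsys K l f.

Lemma eig_ge0 n : 0 <= l n. Proof. by case: Kf. Qed.
Lemma eig_mono m n : (m <= n)%N -> l n <= l m. Proof. by case: Kf => _ h _ _ _; apply: h. Qed.
Lemma eig_orth : orthofam (fun i => 0 < l i) f.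
Proof. by case: Kf. Qed.
Lemma eig_vec n : K (f n) = (l n)%:C *: f n. Proof. by case: Kf. Qed.
Lemma eig_bound n x : (forall j, (j < n)%N -> '[x, f j] = 0) ->
  qf K x <= l n * nm x ^+ 2.
Proof. by case: Kf => _ _ _ _ h; apply: h. Qed.

(** Half of the min-max principle: the span of the first size s + 1 eigenvectors
    contains a unit vector orthogonal to s, and on this span the form is at
    least l (size s). *)
Lemma eig_minmax (s : seq H) (t : R) : linear K -> 
  (forall x, perp s x -> qf K x <= t * nm x ^+ 2) -> 0 <= t -> l (size s) <= t.
Proof.
move=> Kl hs t0; have := eig_ge0 (size s); rewrite le_eqVlt.
case/predU1P => [<-//|ls].
have li i : (i <= size s)%N -> 0 < l i.
  by move=> is_; exact: lt_le_trans ls (eig_mono is_).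
set n := (size s).+1.
have ffE : famlist f n = [seq f i | i <- iota 0 n].
  apply/all_filterP; rewrite all_map; apply/allP => i; rewrite mem_iota/= add0n ltnS => is_.
  exact/(fam_neq0 eig_orth)/li.
have [|x [xn x1 xs]] := @unit_vector_perp _ _ (famlist f n) s (famlist_orthon eig_orth n).
  by rewrite ffE size_map size_iota.
have := hs x xs; rewrite x1 expr1n mulr1; apply: le_trans.
have -> : qf K x = \sum_(a <- famlist f n) Re ('[x, a] * '[K a, x]).
  rewrite /qf -[X in '[K X, _]]xn /proj (lin_sum Kl) inner_suml raddf_sum/=.
  by apply: eq_bigr => a _; rewrite (linZ Kl) innerZl.
have e1 : 1 = \sum_(a <- famlist f n) nm '[x, a] ^+ 2.
  by rewrite -nm_proj ?(famlist_orthon eig_orth)// xn x1 expr1n.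
rewrite -[leLHS]mulr1 [in leLHS]e1 mulr_sumr.
rewrite ffE !big_map big_seq [leRHS]big_seq; apply: ler_sum => i.
rewrite mem_iota/= add0n ltnS => is_; rewrite eig_vec innerZl (innerC (f i)).
by rewrite ['[_, _] * _]mulrCA nm_sqr -rmorphM/= ler_wpM2r ?sqr_ge0// eig_mono.
Qed.

End EigTheory.

End EigenSystem.

(** * Adjoints and diagonal operators *)

Section Adjoint.
Context {R : realType} {H : hilbertSpace R}.
Implicit Types (A B K : H -> H) (x y : H).

Lemma cvg_eq (V : normedModType R[i]) (u v : nat -> V) (a : V) :
  (forall n, u n = v n) -> u @ \oo --> a -> v @ \oo --> a.
Proof. by move=> /funext ->. Qed.

Lemma cvg_lin A (u : nat -> H) x : bounded_op A -> u @ \oo --> x ->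
  (A \o u) @ \oo --> A x.
Proof. by move=> [_ Ac] ux; apply: continuous_cvg => //; exact: Ac. Qed.

Lemma nm_sqr_le (a b : R) : 0 <= a -> 0 <= b -> a ^+ 2 <= b * a -> a <= b.
Proof.
move=> a0 b0; have [->//|an0] := eqVneq a 0.
by rewrite expr2 ler_pM2r// lt_neqAle eq_sym an0.
Qed.

Lemma adjoint_bounded A B M : 0 <= M -> is_adjoint A B ->
  (forall x, nm (A x) <= M * nm x) -> linear B /\ forall x, nm (B x) <= M * nm x.
Proof.
move=> M0 AB AM; split.
  move=> a x y; apply: inner_ext => z.
  by rewrite [LHS]innerC -AB innerDr innerZr !AB -innerZr -innerDr -innerC.
move=> y; apply: nm_sqr_le; rewrite ?mulr_ge0 ?nm_ge0//.
rewrite -lecR -innerxx -AB.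
have -> : '[A (B y), y] = (nm (B y) ^+ 2)%:C by rewrite AB innerxx.
rewrite lecR; have : nm (B y) ^+ 2 = nm '[A (B y), y].
  by rewrite AB innerxx nmC ger0_norm ?sqr_ge0.
move=> ->; rewrite (le_trans (CauchySchwarz _ _))// mulrAC.
by rewrite ler_wpM2r ?nm_ge0.
Qed.

(** B y is the sum of the <y, A e_k> e_k. The squares of these coefficients are
    summable: with z their n-th partial sum, |z|^2 = <y, A z> <= M |y| |z|. *)
Lemma adjoint_exists (e : nat -> H) A : orthonormal_basis e -> bounded_op A ->
  exists B, bounded_op B /\ is_adjoint A B.
Proof.
move=> [eo eb] Ab; have /bounded_opP[Al [M M0 AM]] := Ab.
have fo : orthofam (fun=> true) e by move=> i j; rewrite eo andbT.
have nmsum (c : nat -> R[i]) n :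
    nm (\sum_(k < n) c k *: e k) ^+ 2 = \sum_(k < n) nm (c k) ^+ 2.
  apply: complexI; rewrite -innerxx inner_suml rmorph_sum/=; apply: eq_bigr => i _.
  rewrite inner_sumr (bigD1 i)//= big1 ?addr0.
    by rewrite innerZl innerZr eo eqxx mulr1 nm_sqr.
  move=> j ji; rewrite innerZl innerZr eo [_ == _]eq_sym.
  by rewrite -[(_ == _ :> nat)]/(j == i) (negbTE ji) !mulr0.
have bnd y n : \sum_(k < n) nm '[y, A (e k)] ^+ 2 <= (M * nm y) ^+ 2.
  rewrite -(nmsum (fun k => '[y, A (e k)])); set z := \sum_(k < n) _.
  rewrite ler_pXn2r ?nnegrE ?mulr_ge0 ?nm_ge0 ?(ltW M0)//.
  apply: nm_sqr_le; rewrite ?mulr_ge0 ?nm_ge0 ?(ltW M0)//.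
  have yAz : '[y, A z] = (nm z ^+ 2)%:C.
    rewrite /z (nmsum (fun k => '[y, A (e k)])) (lin_sum Al) inner_sumr rmorph_sum/=; apply: eq_bigr => k _.
    by rewrite (linZ Al) innerZr mulrC nm_sqr.
  have := CauchySchwarz y (A z); rewrite yAz nmC ger0_norm ?sqr_ge0//.
  by have := ler_wpM2l (nm_ge0 y) (AM z); lra.
pose s y n := \sum_(k < n) '[y, A (e k)] *: e k.
pose B y := lim (s y @ \oo).
have sB y : s y @ \oo --> B y by exact: (fam_series_cvg fo (c := fun k => '[y, A (e k)]) (bnd y)).
have AB : is_adjoint A B.
  move=> x y; have h1 := cvg_innerl (y := y) (cvg_lin Ab (eb x)).
  apply: (cvg_seq_unique h1); apply: cvg_eq (cvg_innerr (y := x) (sB y)) => n /=.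
  rewrite /s (lin_sum Al) inner_suml inner_sumr; apply: eq_bigr => k _.
  by rewrite (linZ Al) innerZl innerZr -innerC mulrC.
exists B; split=> //; apply/bounded_opP.
have [Bl BM] := adjoint_bounded (ltW M0) AB AM.
by split=> //; exists M.
Qed.

End Adjoint.

Section Diagonal.
Context {R : realType} {H : hilbertSpace R}.
Variables (l : nat -> R) (f : nat -> H).
Hypothesis l0 : forall n, 0 <= l n.
Hypothesis lmono : forall m n, (m <= n)%N -> l n <= l m.
Hypothesis fo : orthofam (fun i => 0 < l i) f.
Implicit Types x y : H.

(** The operator x |-> sum of the l k <x, f k> f k, for a decreasing sequence l. *)
Definition diagop_part n x : H := \sum_(k < n) ((l k)%:C * '[x, f k]) *: f k.

Definition diagop x : H := lim ((fun n => diagop_part n x) @ \oo).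

Lemma diag_sum_le n N x : (forall j, (j < n)%N -> '[x, f j] = 0) ->
  \sum_(k < N) nm ((l k)%:C * '[x, f k]) ^+ 2 <= (l n * nm x) ^+ 2.
Proof.
move=> hx; rewrite exprMn.
apply: (@le_trans _ _ (l n ^+ 2 * \sum_(k < N) nm '[x, f k] ^+ 2)); last first.
  by rewrite ler_wpM2l ?sqr_ge0// (fam_Bessel fo).
rewrite mulr_sumr; apply: ler_sum => k _.
rewrite nmM exprMn nmC ger0_norm//; have [nk|kn] := leqP n k.
  by rewrite ler_wpM2r ?sqr_ge0// ler_pXn2r ?nnegrE// lmono.
by rewrite hx// nm0 expr0n !mulr0.
Qed.

Lemma diagop_cvg x : (fun n => diagop_part n x) @ \oo --> diagop x.
Proof.
apply: (fam_series_cvg fo (c := fun k => (l k)%:C * '[x, f k]) (B := (l 0%N * nm x) ^+ 2)) => n.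
exact: diag_sum_le.
Qed.

Lemma diagop_small n x : (forall j, (j < n)%N -> '[x, f j] = 0) ->
  nm (diagop x) <= l n * nm x.
Proof.
move=> hx; have h := cvg_nm (@diagop_cvg x); apply: (cvgr_to_le h).
near=> N.
rewrite -(ler_pXn2r (_ : 0 < 2)%N) ?nnegrE ?mulr_ge0 ?nm_ge0//.
rewrite (le_trans _ (diag_sum_le N hx))// /diagop_part.
rewrite -(big_mkord xpredT (fun k => ((l k)%:C * '[x, f k]) *: f k)).
by rewrite (le_trans (fam_nm_sum fo _ _ _))// big_mkord.
Unshelve. all: by end_near. Qed.

Lemma diagop_linear : linear diagop.
Proof.
move=> a x y; apply: (cvg_seq_unique (@diagop_cvg _)).
have -> : (fun n => diagop_part n (a *: x + y)) =
    (fun n => a *: diagop_part n x + diagop_part n y).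
  apply/funext => n; rewrite /diagop_part scaler_sumr -big_split/=.
  apply: eq_bigr => k _; rewrite innerDl innerZl mulrDr scalerDl scalerA.
  by rewrite mulrCA.
by apply: cvgD; [apply: cvgZr|]; exact: diagop_cvg.
Qed.

Lemma diagop_bounded : bounded_op diagop.
Proof.
apply/bounded_opP; split; first exact: diagop_linear.
exists (l 0%N + 1); first by rewrite ltr_wpDl.
move=> x; rewrite (le_trans (@diagop_small 0 x _))//.
by rewrite ler_wpM2r ?nm_ge0// lerDl.
Qed.

Lemma diagop_inner x y :
  (fun n => \sum_(k < n) (l k)%:C * '[x, f k] * '[f k, y] : R[i]^o) @ \oo -->
  ('[diagop x, y] : R[i]^o).
Proof.
apply: cvg_eq (cvg_innerl (y := y) (@diagop_cvg x)) => n.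
by rewrite /diagop_part inner_suml; apply: eq_bigr => k _; rewrite innerZl.
Qed.

Lemma diagop_selfadj : selfadj diagop.
Proof.
move=> x y; apply: (cvg_seq_unique (@diagop_inner x y)).
apply: cvg_eq (cvg_innerr (y := x) (@diagop_cvg y)) => n.
rewrite /diagop_part inner_sumr; apply: eq_bigr => k _.
rewrite innerZr rmorphM/= -innerC conj_Creal ?complex_real//.
by rewrite mulrAC.
Qed.

Lemma diagop_qf_ge0 x : 0 <= qf diagop x.
Proof.
have := cvg_Re (@diagop_inner x x); rewrite -/(qf diagop x) => h.
apply: cvgr_to_ge h _; near=> n.
rewrite raddf_sum/= sumr_ge0// => k _.
by rewrite -mulrA (innerC (f k)) nm_sqr -rmorphM/= mulr_ge0// sqr_ge0.
Unshelve. all: by end_near. Qed.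

Lemma diagop_pos : positive_op diagop.
Proof.
split; first exact: diagop_bounded.
by move=> x; rewrite qfE ?ler0c ?diagop_qf_ge0//; exact: diagop_selfadj.
Qed.

Lemma diagop_vec j : diagop (f j) = (l j)%:C *: f j.
Proof.
apply: (cvg_seq_unique (@diagop_cvg _)).
apply: cvg_near_cst; exists j.+1 => // n /= jn.
rewrite /diagop_part (bigD1 (Ordinal jn))//= big1 ?addr0; last first.
  move=> k kj; rewrite fo eq_sym.
  by rewrite -[(_ == _ :> nat)]/(k == Ordinal jn) (negbTE kj) mulr0 scale0r.
rewrite fo eqxx/=; case: ltP => lj; first by rewrite mulr1.
by rewrite (fam0 fo) ?scaler0//; apply/negbTE; rewrite -leNgt.
Qed.

Lemma diagop_eigsys : eigsys diagop l f.
Proof.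
split=> //; first exact: diagop_vec.
move=> n x hx; rewrite (le_trans (Re_inner_le _ _))// expr2 mulrA.
by rewrite ler_wpM2r ?nm_ge0// diagop_small.
Qed.

Lemma diagop_perp x : (forall j, '[x, f j] = 0) -> diagop x = 0.
Proof.
move=> hx; apply: (cvg_seq_unique (@diagop_cvg _)).
apply: cvg_near_cst; near=> n; rewrite /diagop_part big1// => k _.
by rewrite hx mulr0 scale0r.
Unshelve. all: by end_near. Qed.

Lemma diagop_almost_finite : (forall e, 0 < e -> exists n, l n <= e) ->
  almost_finite diagop.
Proof.
move=> lv e /lv[n ln]; exists (famlist f n) => x /perp_famlist hx.
by rewrite (le_trans (diagop_small hx))// ler_wpM2r ?nm_ge0.
Qed.

End Diagonal.

(** * Positive part, negative part and absolute value *)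

Section Split.
Context {R : realType} {H : hilbertSpace R}.
Implicit Types (x y : H).

Definition vanishing (l : nat -> R) : Prop := forall e, 0 < e -> exists n, l n <= e.

Lemma bounded_opD (A B : H -> H) : bounded_op A -> bounded_op B ->
  bounded_op (fun x => A x + B x).
Proof.
move=> /bounded_opP[Al [M M0 AM]] /bounded_opP[Bl [N N0 BN]]; apply/bounded_opP.
split; first by move=> a x y; rewrite Al Bl scalerDr addrACA.
exists (M + N); first exact: addr_gt0.
by move=> x; rewrite (le_trans (nmD _ _))// mulrDl lerD.
Qed.

Lemma almost_finiteD (A B : H -> H) : almost_finite A -> almost_finite B ->
  almost_finite (fun x => A x + B x).
Proof.
move=> Af Bf e e0; have e20 : 0 < e / 2 by rewrite divr_gt0.
have [s hs] := Af _ e20; have [t ht] := Bf _ e20; exists (s ++ t).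
move=> x /perp_cat[/hs h1 /ht h2]; rewrite (le_trans (nmD _ _))//.
by rewrite (splitr e) mulrDl lerD.
Qed.

Variables (K : H -> H) (l l' : nat -> R) (f f' : nat -> H).
Hypotheses (Kl : linear K) (Ks : selfadj K).
Hypotheses (Kf : eigsys K l f) (Kf' : eigsys (fun x => - K x) l' f').
Hypotheses (lv : vanishing l) (lv' : vanishing l').

Lemma eig_cross i j : '[f i, f' j] = 0.
Proof.
have h : ((l i)%:C + (l' j)%:C) * '[f i, f' j] = 0.
  rewrite mulrDl -innerZl -(eig_vec Kf).
  have -> : (l' j)%:C * '[f i, f' j] = '[f i, (l' j)%:C *: f' j].
    by rewrite innerZr conj_Creal// complex_real.
  by rewrite -(eig_vec Kf') innerNr Ks subrr.
move/eqP: h; rewrite mulf_eq0 => /orP[|/eqP//].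
rewrite -rmorphD/= => /eqP/(@complexI _ _ 0)/eqP.
rewrite paddr_eq0 ?(eig_ge0 Kf) ?(eig_ge0 Kf')// => /andP[/eqP li _].
by rewrite (fam0 (eig_orth Kf)) ?inner0l// li ltxx.
Qed.

Let S := diagop l f.
Let S' := diagop l' f'.

Let l0 : forall n, 0 <= l n := eig_ge0 Kf.
Let l0' : forall n, 0 <= l' n := eig_ge0 Kf'.
Let lm : forall m n, (m <= n)%N -> l n <= l m := eig_mono Kf.
Let lm' : forall m n, (m <= n)%N -> l' n <= l' m := eig_mono Kf'.
Let fo := eig_orth Kf.
Let fo' := eig_orth Kf'.
Let Sl : linear S := diagop_linear l0 lm fo.
Let Sl' : linear S' := diagop_linear l0' lm' fo'.
Let Ss : selfadj S := diagop_selfadj l0 lm fo.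
Let Ss' : selfadj S' := diagop_selfadj l0' lm' fo'.

Lemma diagop_cross j : S (f' j) = 0.
Proof. by apply: diagop_perp => // i; apply/orthoC/eig_cross. Qed.

Lemma diagop_cross' j : S' (f j) = 0.
Proof. by apply: diagop_perp => // i; exact: eig_cross. Qed.

(** D = K - S + S' is self-adjoint, kills all the eigenvectors, and on the
    complement of the first n of either sign its form is at most
    2 (l n + l' n) |x|^2 in absolute value, which tends to 0. *)
Lemma eig_split x : K x = S x - S' x.
Proof.
pose D x := K x - S x + S' x.
have Dl : linear D.
  move=> a u v; rewrite /D Kl Sl Sl' !scalerDr !scalerN.
  by rewrite opprD [X in X + _ = _]addrACA [LHS]addrACA.
have Ds : selfadj D.
  by move=> u v; rewrite /D innerDl innerDr innerBl innerBr Ks Ss Ss'.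
have Df j : D (f j) = 0.
  by rewrite /D (eig_vec Kf) diagop_cross' /S diagop_vec// subrr addr0.
have Df' j : D (f' j) = 0.
  rewrite /D -[K _]opprK (eig_vec Kf') diagop_cross /S' diagop_vec// subr0.
  by rewrite addNr.
suff D0 : D x = 0.
  by apply/eqP; rewrite -subr_eq0 opprB addrA addrAC -[X in _ == X]D0 eqxx.
apply: qf0_eq0 => // {}x.
have small n : `|qf D x| <= 2 * (l n + l' n) * nm x ^+ 2.
  pose s := famlist f n ++ famlist f' n.
  have os : orthon s.
    have h1 := famlist_orthon fo n; have h2 := famlist_orthon fo' n.
    move: h1 h2; rewrite /orthon pairwise_cat !all_cat => /andP[-> ->] /andP[-> ->].
    rewrite !andbT; apply/allrelP => a b; rewrite !mem_filter.
    move=> /andP[_ /mapP[i _ ->]] /andP[_ /mapP[j _ ->]].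
    by rewrite eig_cross.
  pose z := x - proj s x.
  have Dz : D x = D z.
    rewrite /z (linB Dl) /proj (lin_sum Dl) big_seq big1 ?subr0// => a.
    rewrite mem_cat !mem_filter (linZ Dl).
    by move=> /orP[] /andP[_ /mapP[j _ ->]]; rewrite ?Df ?Df' scaler0.
  have qD : qf D x = qf D z.
    rewrite /qf Dz -[x in '[_, x]](subrK (proj s x)) -/z innerDr.
    rewrite inner_proj_perp ?addr0// => a; rewrite Ds mem_cat !mem_filter.
    by move=> /orP[] /andP[_ /mapP[j _ ->]]; rewrite ?Df ?Df' inner0r.
  have /perp_cat[/perp_famlist zf /perp_famlist zf'] : perp s z by exact: perp_sub_proj.
  have nz : nm z ^+ 2 <= nm x ^+ 2.
    by rewrite ler_pXn2r ?nnegrE ?nm_ge0// nm_sub_proj.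
  have h1 := eig_bound Kf zf; have h2 := eig_bound Kf' zf'.
  have h3 := eig_bound (diagop_eigsys l0 lm fo) zf.
  have h4 := eig_bound (diagop_eigsys l0' lm' fo') zf'.
  have h5 := diagop_qf_ge0 l0 lm fo z; have h6 := diagop_qf_ge0 l0' lm' fo' z.
  have E : qf D z = qf K z - qf S z + qf S' z.
    by rewrite /qf /D innerDl innerBl raddfD raddfB.
  have h2' : qf (fun x => - K x) z = - qf K z by rewrite /qf innerNl raddfN.
  have := ler_wpM2l (addr_ge0 (l0 n) (l0' n)) nz.
  have := mulr_ge0 (l0 n) (sqr_ge0 (nm z)); have := mulr_ge0 (l0' n) (sqr_ge0 (nm z)).
  move: h1 h2 h3 h4 h5 h6; rewrite qD E h2' -/S -/S' ler_norml => h1 h2 h3 h4 h5 h6 h7 h8 h9.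
  by apply/andP; split; lra.
apply/eqP; rewrite -normr_eq0; apply/eqP/le_anti; rewrite normr_ge0 andbT.
apply: (@le0_small _ _ (4 * nm x ^+ 2)); first by rewrite mulr_ge0 ?sqr_ge0.
move=> d d0; have [n1 hn1] := lv d0; have [n2 hn2] := lv' d0.
have h1 : l (maxn n1 n2) <= d by rewrite (le_trans _ hn1)// lm// leq_maxl.
have h2 : l' (maxn n1 n2) <= d by rewrite (le_trans _ hn2)// lm'// leq_maxr.
rewrite (le_trans (small (maxn n1 n2)))//.
by have := ler_wpM2r (sqr_ge0 (nm x)) (lerD h1 h2); lra.
Qed.

Lemma diagop_mul0 x : S (S' x) = 0.
Proof.
apply: diagop_perp => // i; rewrite -/S' Ss' diagop_cross' inner0r//.
Qed.

Lemma diagop_mul0' x : S' (S x) = 0.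
Proof.
apply: diagop_perp => // i; rewrite -/S Ss diagop_cross inner0r//.
Qed.

(** The absolute value of K, as the sum of its positive and negative parts. *)
Definition absK x : H := diagop l f x + diagop l' f' x.

Lemma absK_absop : is_absop K absK.
Proof.
split.
  split; first by apply: bounded_opD; exact: diagop_bounded.
  move=> x; rewrite innerDl addr_ge0//.
    by have [_] := diagop_pos l0 lm fo; apply.
  by have [_] := diagop_pos l0' lm' fo'; apply.
exists K; split=> //; apply/funext => x /=.
rewrite !eig_split /absK -/S -/S' (linD Sl) (linD Sl') (linB Sl) (linB Sl').
by rewrite diagop_mul0 diagop_mul0' subr0 sub0r opprK addr0 add0r.
Qed.

Lemma absK_linear : linear absK.
Proof. by move=> a x y; rewrite /absK -/S -/S' Sl Sl' scalerDr addrACA. Qed.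

Lemma absK_selfadj : selfadj absK.
Proof. by move=> x y; rewrite /absK -/S -/S' innerDl innerDr Ss Ss'. Qed.

Lemma absK_almost_finite : almost_finite absK.
Proof. by apply: almost_finiteD; exact: diagop_almost_finite. Qed.

(** On the vectors orthogonal to the first n eigenvectors of either sign, the two
    parts are at most l n and l' n; conclude by min-max. *)
Lemma absK_eig_le m g n : eigsys absK m g -> m (n + n)%N <= l n + l' n.
Proof.
move=> mg; pose s := famlist f n ++ famlist f' n.
have ss : (size s <= n + n)%N by rewrite size_cat leq_add ?famlist_size.
apply: le_trans (eig_mono mg ss) _.
apply: (eig_minmax mg absK_linear); last by rewrite addr_ge0.
move=> x /perp_cat[/perp_famlist h1 /perp_famlist h2].
rewrite /qf /absK innerDl raddfD mulrDl lerD//.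
  exact: (eig_bound (diagop_eigsys l0 lm fo) h1).
exact: (eig_bound (diagop_eigsys l0' lm' fo') h2).
Qed.

End Split.

(** * Singular values *)

Section SingularValues.
Context {R : realType} {H : hilbertSpace R}.
Implicit Types (A B K P : H -> H) (x y : H) (s m : nat -> R).

(** If k < j, the coordinates of the j independent vectors b with respect to the
    k vectors c form a matrix with a nonzero left null vector. *)
Lemma has_dim_uniq_le (E : set H) j k : has_dim E j -> has_dim E k -> (j <= k)%N.
Proof.
move=> [b [bfree bE]] [c [_ cE]]; rewrite leqNgt; apply/negP => kj.
have /choice[M hM] : forall i : 'I_j, exists d : 'I_k -> R[i], b i = \sum_u d u *: c u.
  move=> i; have : E (b i); last by rewrite cE.
  rewrite bE; exists (fun u => (u == i)%:R).
  rewrite (bigD1 i)//= eqxx scale1r big1 ?addr0// => u ui.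
  by rewrite (negbTE ui) scale0r.
have [v v0 vM] := @null_row R[i] j k (\matrix_(i, u) M i u) kj.
have /eqP := v0; apply; apply/rowP => i; rewrite mxE.
apply: (bfree (fun i => v 0 i)).
under eq_bigr do rewrite hM scaler_sumr.
rewrite exchange_big/= big1// => u _.
under eq_bigr do rewrite scalerA.
rewrite -scaler_suml.
have /rowP/(_ u) := vM; rewrite !mxE.
by under eq_bigr do rewrite mxE; move=> ->; rewrite scale0r.
Qed.

Lemma has_dim_uniq (E : set H) j k : has_dim E j -> has_dim E k -> j = k.
Proof.
by move=> hj hk; apply/eqP; rewrite eqn_leq !(has_dim_uniq_le (E := E)).
Qed.

(** Both eigenspaces are the kernel of A^* A - t^2, because P + t is injective
    for positive P and t > 0. *)
Lemma is_absop_eigenspace A P P' (t : R) x : is_absop A P -> is_absop A P' ->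
  0 < t -> P x = t%:C *: x -> P' x = t%:C *: x.
Proof.
move=> [Pp [B [AB PP]]] [P'p [B' [AB' PP']]] t0 Px.
have BB' : B =1 B' by move=> y; apply: inner_ext => z; rewrite innerC -AB AB' -innerC.
have Pl : linear P by case: Pp => -[].
have P'l : linear P' by case: P'p => -[].
have P'2 : P' (P' x) = (t * t)%:C *: x.
  have -> : P' (P' x) = P (P x).
    have := congr1 (@^~ x) PP; have := congr1 (@^~ x) PP'.
    by rewrite /= -BB' => -> ->.
  by rewrite Px (linZ Pl) Px scalerA rmorphM.
pose y := P' x - t%:C *: x.
have h : P' y = - (t%:C *: y).
  by rewrite /y (linB P'l) P'2 (linZ P'l) scalerBr scalerA -rmorphM/= opprB.
have [_ P'0] := P'p; have := P'0 y; rewrite h innerNl innerZl innerxx -rmorphM/= oppr_ge0.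
rewrite lecR pmulr_rle0// => yle.
have y0 : y = 0.
  by apply: nm_eq0; apply/eqP; rewrite -sqrf_eq0 eq_le yle sqr_ge0.
by apply/eqP; rewrite -subr_eq0; apply/eqP.
Qed.

(** If s n exceeded s' n, the value s n would be taken by s' only before n, where
    the two sequences agree, hence less often than by s. *)
Lemma card_level_le s s' n : (forall i j, (i <= j)%N -> s' j <= s' i) ->
  0 <= s' n -> (forall j, (j < n)%N -> s j = s' j) ->
  (forall t, 0 < t -> exists k, ([set i | s i = t] #= `I_k)%card /\
                                ([set i | s' i = t] #= `I_k)%card) ->
  s n <= s' n.
Proof.
move=> s'm s'0 ss' hc; rewrite leNgt; apply/negP => sn.
have [k [Ak A'k]] := hc (s n) (le_lt_trans s'0 sn).
move: Ak A'k; set A := [set i | s i = _]; set A' := [set i | s' i = _] => Ak A'k.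
have fA : finite_set A by apply/finite_setP; exists k.
have fA' : finite_set A' by apply/finite_setP; exists k.
have A'A i : A' i -> A i /\ i != n.
  rewrite /A' /A /= => s'i; have ilt : (i < n)%N.
    rewrite ltnNge; apply/negP => /s'm; rewrite s'i.
    by rewrite leNgt sn.
  by rewrite ss'// s'i ltn_eqF.
have : (fset_set A' `<=` (fset_set A `\ n))%fset.
  apply/fsubsetP => i; rewrite in_fsetD1 !in_fset_set// !inE => /A'A[Ai ->].
  by rewrite /=; apply/asboolP.
move/fsubset_leq_card; rewrite (card_fset_set A'k).
have := cardfsD1 n (fset_set A); rewrite (card_fset_set Ak).
have -> : n \in fset_set A by rewrite in_fset_set// inE.
by rewrite add1n => ->; rewrite ltnn.
Qed.

Lemma singular_values_uniq A s s' :
  is_singular_values A s -> is_singular_values A s' -> s = s'.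
Proof.
move=> [P AP [sm s0 hs]] [P' AP' [s'm s'0 hs']].
have nm' u : nonincreasing_seq u -> forall i j, (i <= j)%N -> u j <= u i :> R.
  by move=> um i j ij; exact: um.
have hc t : 0 < t -> exists k, ([set i | s i = t] #= `I_k)%card /\
                                ([set i | s' i = t] #= `I_k)%card.
  move=> t0; have [k [hk sk]] := hs t t0; have [k' [hk' sk']] := hs' t t0.
  exists k; split=> //; suff -> : k = k' by [].
  apply: has_dim_uniq hk _; suff -> : [set x | P x = t%:C *: x] = [set x | P' x = t%:C *: x] by [].
  by apply/seteqP; split=> x /=; [exact: (is_absop_eigenspace AP AP' t0)|exact: (is_absop_eigenspace AP' AP t0)].
have hc' t : 0 < t -> exists k, ([set i | s' i = t] #= `I_k)%card /\
                                ([set i | s i = t] #= `I_k)%card.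
  by move=> /hc[k [h1 h2]]; exists k.
apply/funext => n; elim/ltn_ind: n => n IH; apply/le_anti/andP; split.
  by apply: card_level_le => //; exact: nm'.
by apply: card_level_le => // j /IH ->.
Qed.

(** A vector y of the t-eigenspace orthogonal to the eigenvectors g with value t
    is orthogonal to all of them, so that t |y|^2 <= m n |y|^2 for every n. *)
Lemma eigsys_singular_values A P m (g : nat -> H) : is_absop A P -> eigsys P m g ->
  vanishing m -> is_singular_values A m.
Proof.
move=> AP Pg mv; exists P => //; split.
- by move=> i j ij; apply: (eig_mono Pg).
- exact: eig_ge0 Pg.
move=> t t0; have [N mN] := mv _ (divr_gt0 t0 (ltr0n _ 2)).
have Pp : positive_op P by case: AP.
have Ps := pos_selfadj Pp; have Pl : linear P by case: Pp => -[].
pose L := [seq n <- iota 0 N | m n == t].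
have memL n : n \in L <-> m n = t.
  rewrite mem_filter mem_iota/= add0n; split=> [/andP[/eqP]//|mn].
  rewrite mn eqxx/= ltnNge; apply/negP => Nn.
  have := eig_mono Pg Nn; rewrite mn => /le_trans/(_ mN).
  by rewrite leNgt ltr_pdivrMr// ltr_pMr// ltr1n.
have uL : uniq L by rewrite filter_uniq// iota_uniq.
exists (size L); split; last first.
  have -> : [set n | m n = t] = [set` [fset n in L]%fset].
    by apply/seteqP; split=> n /=; rewrite inE /= => /memL.
  by apply/card_eq_fsetP; rewrite card_fseq undup_id.
pose b (i : 'I_(size L)) := g (nth 0%N L i).
have mb (i : 'I_(size L)) : m (nth 0%N L i) = t by apply/memL/mem_nth.
have bb i j : '[b i, b j] = (i == j)%:R.
  by rewrite /b (eig_orth Pg) nth_uniq// mb t0 andbT.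
exists b; split.
  move=> c c0 i; have := congr1 (fun z => '[z, b i]) c0.
  rewrite inner0l inner_suml (bigD1 i)//= big1 ?addr0.
    by rewrite innerZl bb eqxx mulr1.
  by move=> j ji; rewrite innerZl bb (negbTE ji) mulr0.
apply/seteqP; split=> x /=; last first.
  move=> [c ->]; rewrite (lin_sum Pl) scaler_sumr; apply: eq_bigr => i _.
  by rewrite (linZ Pl) /b (eig_vec Pg) mb !scalerA mulrC.
move=> Px; exists (fun i => '[x, b i]).
pose y := x - \sum_i '[x, b i] *: b i.
have yb i : '[y, b i] = 0.
  rewrite innerBl inner_suml (bigD1 i)//= big1 ?addr0.
    by rewrite innerZl bb eqxx mulr1 subrr.
  by move=> j ji; rewrite innerZl bb (negbTE ji) mulr0.
have yt : P y = t%:C *: y.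
  rewrite (linB Pl) Px (lin_sum Pl) scalerBr; congr (_ - _).
  rewrite scaler_sumr; apply: eq_bigr => i _.
  by rewrite (linZ Pl) /b (eig_vec Pg) mb !scalerA mulrC.
have yg j : '[y, g j] = 0.
  have [mj|mj] := eqVneq (m j) t.
    have jL : (index j L < size L)%N by rewrite index_mem; apply/memL.
    by have := yb (Ordinal jL); rewrite /b/= nth_index//; apply/memL.
  have : (t%:C - (m j)%:C) * '[y, g j] = 0.
    rewrite mulrBl -innerZl -yt Ps (eig_vec Pg) innerZr conj_Creal ?complex_real//.
    by rewrite subrr.
  move/eqP; rewrite mulf_eq0 -rmorphB/= => /orP[|/eqP//].
  by move=> /eqP/(@complexI _ _ 0)/eqP; rewrite subr_eq0 eq_sym (negbTE mj).
have := eig_bound Pg (n := N) (x := y) (fun j _ => yg j).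
rewrite /qf yt innerZl innerxx -rmorphM/= => h.
have : t / 2 * nm y ^+ 2 <= 0.
  by have := ler_wpM2r (sqr_ge0 (nm y)) mN; move: h; lra.
rewrite pmulr_rle0 ?divr_gt0// => yle.
have : y = 0.
  by apply: nm_eq0; apply/eqP; rewrite -sqrf_eq0 eq_le yle sqr_ge0.
by move/eqP; rewrite subr_eq0 => /eqP.
Qed.

Lemma singular_valueE A P m (g : nat -> H) : is_absop A P -> eigsys P m g ->
  vanishing m -> singular_value A = m.
Proof.
move=> AP Pg mv; have h := eigsys_singular_values AP Pg mv.
apply: (singular_values_uniq (A := A)) => //.
by rewrite /singular_value; case: xgetP => [s -> //|/(_ m)].
Qed.

Lemma pos_absop A : positive_op A -> is_absop A A.
Proof. by move=> Ap; split=> //; exists A; split=> //; exact: pos_selfadj. Qed.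

Lemma singular_value_mono A i j : (i <= j)%N -> singular_value A j <= singular_value A i.
Proof.
rewrite /singular_value; case: xgetP => [s -> [P _ [sm _ _]] ij|_ _//].
exact: sm.
Qed.

Lemma singular_value_ge0 A i : 0 <= singular_value A i.
Proof. by rewrite /singular_value; case: xgetP => [s -> [P _ []]|]. Qed.

(** If all m n exceeded d, the images m n g n of the unit vectors g n would be
    orthogonal of norm more than d, and could not cluster. *)
Lemma eigsys_vanishing K m (g : nat -> H) : compact_op K -> eigsys K m g -> vanishing m.
Proof.
move=> Kc Kg d d0; apply: contrapT => hd.
have {}hd n : d < m n by rewrite ltNge; apply/negP => h; apply: hd; exists n.
pose Q (e : R) x := exists2 n, (1 <= n.+1%:R * e) & x = g n.
have Qex e : 0 < e -> exists x, Q e x.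
  move=> e0; pose n := Num.truncn e^-1; exists (g n); exists n => //.
  rewrite -ler_pdivrMr// mul1r ltW//.
  have ei : 0 <= e^-1 by rewrite invr_ge0 ltW.
  by have /andP[_] := truncn_itv ei.
have Qle e e' : 0 < e -> e <= e' -> Q e `<=` Q e'.
  by move=> e0 ee' x [n hn ->]; exists n => //; rewrite (le_trans hn)// ler_wpM2l.
have Q1 e x : Q e x -> nm x <= 1 by move=> [n _ ->]; exact: fam_nm (eig_orth Kg) n.
have [y hy] := compact_cluster Kc Qex Qle Q1.
have d20 : 0 < d / 2 by rewrite divr_gt0.
have [_ [n _ ->] hn] := hy _ d20.
pose e := Num.min (d / 2) (n.+2%:R)^-1.
have e0 : 0 < e by rewrite lt_min d20 invr_gt0 ltr0n.
have [_ [k hk ->] hk'] := hy _ e0.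
have nk : (n < k)%N.
  rewrite ltnNge; apply/negP => kn; move: hk; rewrite leNgt => /negP; apply.
  apply: (@le_lt_trans _ _ (k.+1%:R / n.+2%:R)).
    by rewrite ler_wpM2l// ge_min lexx orbT.
  by rewrite ltr_pdivrMr ?ltr0n// mul1r ltr_nat ltnS ltnS.
have small : nm (K (g n) - K (g k)) < d.
  have -> : K (g n) - K (g k) = (K (g n) - y) + (y - K (g k)) by rewrite addrA subrK.
  rewrite (le_lt_trans (nmD _ _))// (splitr d) ltrD// nmBC (lt_le_trans hk')//.
  by rewrite ge_min lexx.
have : d <= nm '[K (g n) - K (g k), g n].
  rewrite innerBl !(eig_vec Kg) !innerZl !(eig_orth Kg) eqxx (gtn_eqF nk)/= mulr0 subr0.
  by rewrite (lt_trans d0 (hd n)) mulr1 nmC ger0_norm ?(eig_ge0 Kg)// ltW.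
rewrite leNgt => /negP; apply.
rewrite (le_lt_trans (CauchySchwarz _ _))//; apply: le_lt_trans small.
by rewrite -[leRHS]mulr1 ler_wpM2l ?nm_ge0// (fam_nm (eig_orth Kg)).
Qed.

End SingularValues.

(** * Regularly varying functions of index -1 *)

Lemma lt1_powR (R : realType) (a r s : R) : 1 < a -> (a `^ r < a `^ s) = (r < s).
Proof.
move=> a1; have a0 : a != 0 by rewrite gt_eqF// (lt_trans ltr01).
by rewrite /powR (negbTE a0) ltr_expR ltr_pM2r// ln_gt0.
Qed.

Lemma uphalf_bounds n : (2 <= n)%N -> [/\ (uphalf n < n)%N, (0 < uphalf n)%N,
  (n <= (uphalf n).*2)%N & ((uphalf n).*2 <= n.+1)%N].
Proof. by move=> n2; split; lia. Qed.

Section RegularVariation.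
Context {R : realType}.
Variable phi : R -> R.
Hypothesis phi_gt0 : forall t, 0 <= t -> 0 < phi t.
Hypothesis phi_decr : forall s t, 0 <= s -> s <= t -> phi t <= phi s.
Hypothesis phi_rv : regularly_varying_m1 phi.

Lemma rv_ratio (lambda eps : R) : 0 < lambda -> 0 < eps ->
  exists2 T : R, 0 < T & forall t, T <= t ->
    (lambda^-1 - eps) * phi t <= phi (lambda * t) <= (lambda^-1 + eps) * phi t.
Proof.
move=> l0 e0; have [_ /(_ _ l0)/cvgrPdist_lt/(_ _ e0)[M [_ hM]]] := phi_rv.
exists (`|M| + 1); first by rewrite ltr_wpDl.
move=> t tM; have t0 : 0 <= t by rewrite (le_trans _ tM)// addr_ge0.
have /hM /= : M < t by rewrite (lt_le_trans _ tM)// (le_lt_trans (ler_norm _))// ltrDl.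
rewrite ltr_norml => /andP[h1 h2].
rewrite -(ler_pdivlMr _ _ (phi_gt0 t0)) -(ler_pdivrMr _ _ (phi_gt0 t0)).
by apply/andP; split; lra.
Qed.

Lemma phi_contract (lambda : R) : 0 < lambda ->
  exists2 C : R, 0 < C & forall t, 0 <= t -> phi (lambda * t) <= C * phi t.
Proof.
move=> l0; have [T T0 hT] := rv_ratio l0 ltr01.
pose C := lambda^-1 + 1 + phi 0 / phi T.
have C0 : 0 < phi 0 / phi T by rewrite divr_gt0 ?phi_gt0 ?(ltW T0).
have l1 : 0 < lambda^-1 by rewrite invr_gt0.
exists C; first by rewrite /C; lra.
move=> t t0; have pt := phi_gt0 t0; have [tT|Tt] := ltP t T.
  rewrite (@le_trans _ _ (phi 0))//; first by rewrite phi_decr// mulr_ge0// ltW.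
  rewrite (@le_trans _ _ (phi 0 / phi T * phi t))//.
    rewrite -mulrA ler_peMr ?(ltW (phi_gt0 _))//.
    by rewrite mulrC ler_pdivlMr ?phi_gt0 ?(ltW T0)// mul1r phi_decr// ltW.
  by rewrite ler_wpM2r ?(ltW pt)// /C; lra.
have /andP[_ h] := hT _ Tt; rewrite (le_trans h)// ler_wpM2r ?(ltW pt)// /C.
by lra.
Qed.

(** Carries bounds at the multiples of d over to all indices. *)
Lemma phi_divn (d : nat) : (0 < d)%N ->
  exists2 C : R, 0 < C & forall k : nat, phi (k %/ d)%:R <= C * phi k%:R.
Proof.
move=> d0; have l0 : 0 < (d.*2%:R)^-1 :> R by rewrite invr_gt0 ltr0n double_gt0.
have [C C0 hC] := phi_contract l0.
have D0 : 0 < phi 0 / phi d%:R by rewrite divr_gt0// phi_gt0.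
exists (C + phi 0 / phi d%:R); first by rewrite addr_gt0.
move=> k; have pk : 0 < phi k%:R by exact: phi_gt0.
have D1 : 0 <= phi 0 / phi d%:R * phi k%:R by exact/ltW/mulr_gt0.
have C1 : 0 <= C * phi k%:R by exact/ltW/mulr_gt0.
have [kd|dk] := ltnP k d.
  rewrite divn_small// mulrDl ler_wpDl//.
  rewrite -mulrA ler_peMr ?(ltW (phi_gt0 _))//.
  by rewrite mulrC ler_pdivlMr ?phi_gt0// mul1r phi_decr// ler_nat (ltnW kd).
rewrite mulrDl ler_wpDr// (le_trans _ (hC _ _))//.
apply: phi_decr; first by rewrite mulr_ge0// ltW.
rewrite mulrC ler_pdivrMr ?ltr0n ?double_gt0// -natrM ler_nat.
have := ltn_ceil k d0; have := divn_gt0 k d0; rewrite dk => /esym.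
by rewrite -muln2; nia.
Qed.

(** Karamata's estimate for sums. From a large t to t/2 the function phi^theta
    grows by a factor at most rho < 2, since phi grows by a factor close to 2
    and theta < 1. If S(N) denotes the sum, then S(N) <= S(N/2) + (N/2) rho phi(N)^theta,
    and a large constant C is reproduced by the induction. *)
Lemma sum_phi_powR (theta : R) : 0 <= theta < 1 -> exists2 C : R, 0 < C &
  forall N : nat, (0 < N)%N ->
    \sum_(k < N) phi k%:R `^ theta <= C * (N%:R * phi N%:R `^ theta).
Proof.
move=> /andP[th0 th1].
(* a > 2 bounds phi(t/2) / phi(t) for large t, and rho = 2^(theta/th') < 2 *)
pose th' := (theta + 1) / 2; have th'0 : 0 < th' by rewrite /th'; lra.
have th'1 : th' < 1 by rewrite /th'; lra.
have thth : theta < th' by rewrite /th'; lra.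
pose a : R := 2 `^ th'^-1; pose rho : R := a `^ theta.
have a2 : 2 < a.
  rewrite -[X in X < _](@powRr1 _ 2)// /a lt1_powR ?ltr1n//.
  by rewrite invf_gt1.
have rho2 : rho < 2.
  rewrite /rho /a -powRrM -[X in _ < X](@powRr1 _ 2)// lt1_powR ?ltr1n//.
  by rewrite mulrC ltr_pdivrMr// mul1r.
have rho0 : 0 < rho by rewrite powR_gt0// (lt_trans _ a2).
have a0 : 0 < a - 2 by rewrite subr_gt0.
have h2 : 0 < 2^-1 :> R by rewrite invr_gt0.
have [T T0 hT] := rv_ratio h2 a0.
pose psi t := phi t `^ theta.
have psi0 t : 0 <= psi t by exact: powR_ge0.
have psi_decr s t : 0 <= s -> s <= t -> psi t <= psi s.
  move=> s0 st; apply: ge0_ler_powR; rewrite ?nnegrE ?(ltW (phi_gt0 _))//.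
  - exact: le_trans st.
  - exact: phi_decr.
have psi_half t : T <= t -> psi (2^-1 * t) <= rho * psi t.
  move=> Tt; have t0 : 0 <= t by rewrite (le_trans _ Tt)// ltW.
  have /andP[_] := hT t Tt; rewrite invrK subrKC => h.
  have a0' : 0 <= a by lra.
  rewrite /rho /psi -powRM ?(ltW (phi_gt0 _))//.
  apply: ge0_ler_powR; rewrite ?nnegrE ?mulr_ge0 ?(ltW (phi_gt0 _))//.
  by rewrite mulr_ge0// ltW.
pose delta := 1 - rho / 2; have d0 : 0 < delta by rewrite /delta; lra.
(* from N0 on, the rounding error in N/2 is absorbed by delta *)
pose N0 := (Num.truncn (T + 2 / delta + 2)).+1.
have hN0 : T + 2 / delta + 2 < N0%:R.
  have h : 0 <= T + 2 / delta + 2 by rewrite !addr_ge0 ?divr_ge0 ?ltW.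
  by have /andP[_] := truncn_itv h.
have dd : 0 < 2 / delta by rewrite divr_gt0.
have psiN0 : 0 < psi N0%:R by rewrite powR_gt0// phi_gt0.
pose C := 2 / delta + psi 0 / psi N0%:R.
have Cp : 0 <= psi 0 / psi N0%:R by rewrite divr_ge0 ?(ltW psiN0).
have C0 : 0 < C by rewrite /C; lra.
exists C => // N; elim/ltn_ind: N => N IH N_gt0.
rewrite -/(psi _); have [NN0|N0N] := leqP N N0.
  apply: (@le_trans _ _ (\sum_(k < N) psi 0)).
    by apply: ler_sum => k _; apply: psi_decr.
  rewrite sumr_const card_ord -[leLHS]mulr_natl [leRHS]mulrCA ler_wpM2l//.
  apply: (@le_trans _ _ (psi 0 / psi N0%:R * psi N%:R)).
    rewrite -mulrA ler_peMr// mulrC ler_pdivlMr// mul1r psi_decr//.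
    by rewrite ler_nat.
  by rewrite ler_wpM2r// /C; lra.
have N2 : (2 <= N)%N by rewrite (leq_trans _ N0N).
have NR : T + 2 / delta + 2 < N%:R by rewrite (lt_trans hN0)// ltr_nat.
pose M := uphalf N.
have [MN M0 NM2 MN2] := uphalf_bounds N2; rewrite -/M in MN M0 NM2 MN2.
have NMR : N%:R <= 2 * M%:R :> R by rewrite -natrM mul2n ler_nat.
have MNR : 2 * M%:R <= N%:R + 1 :> R by rewrite -natrM mul2n natr1 ler_nat.
have half0 : 0 <= 2^-1 * N%:R :> R by rewrite mulr_ge0.
have hN : psi (2^-1 * N%:R) <= rho * psi N%:R by apply: psi_half; lra.
have psiM k : (M <= k)%N -> psi k%:R <= rho * psi N%:R.
  move=> Mk; apply: le_trans hN; apply: psi_decr => //.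
  have : M%:R <= k%:R :> R by rewrite ler_nat.
  by lra.
rewrite -(big_mkord xpredT (fun k => psi k%:R)) (big_cat_nat _ (ltnW MN))//= big_mkord.
have h1 := IH M MN M0; rewrite -/(psi _) in h1.
have hh : \sum_(M <= k < N) psi k%:R <= (N%:R - M%:R) * (rho * psi N%:R).
  apply: (@le_trans _ _ (\sum_(M <= k < N) (rho * psi N%:R))).
    by rewrite !big_nat; apply: ler_sum => k /andP[Mk _]; exact: psiM.
  by rewrite sumr_const_nat -[leLHS]mulr_natl natrB// ltnW.
have h3 : M%:R * psi M%:R <= M%:R * (rho * psi N%:R) by rewrite ler_wpM2l// psiM.
have {h3}h3 := ler_wpM2l (ltW C0) h3.
apply: (le_trans (lerD (le_trans h1 h3) hh)).
set r := rho * psi N%:R; have r0 : 0 <= r by rewrite mulr_ge0// ltW.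
apply: (@le_trans _ _ ((C * (N%:R + 1) + N%:R) / 2 * r)).
  have : 0 <= (C * (N%:R + 1 - 2 * M%:R) + (2 * M%:R - N%:R)) * r.
    by rewrite mulr_ge0// addr_ge0 ?mulr_ge0 ?(ltW C0)//; lra.
  by lra.
have -> : (C * (N%:R + 1) + N%:R) / 2 * r =
   ((1 - delta) * (C * (N%:R + 1) + N%:R)) * psi N%:R by rewrite /r /delta; field.
rewrite [leRHS]mulrA ler_wpM2r//.
have Cd : 2 <= C * delta by rewrite -ler_pdivrMr// /C; lra.
have Nd : 2 <= N%:R * delta by rewrite -ler_pdivrMr//; move: NR; lra.
have e1 : 2 * N%:R <= C * delta * N%:R by rewrite ler_wpM2r.
have e2 : 2 * C <= N%:R * delta * C by rewrite ler_wpM2r// ltW.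
have e3 : 0 <= delta * (C + N%:R) by apply: mulr_ge0; [exact: ltW|apply: addr_ge0 => //; exact: ltW].
by lra.
Qed.

(** If phi had a positive limit, phi(2t) / phi(t) would tend to 1, not to 1/2. *)
Lemma phi_vanishing : vanishing (fun n => phi n%:R).
Proof.
move=> e e0; apply: contrapT => hne.
have he n : e <= phi n%:R by rewrite leNgt; apply/negP => h; apply: hne; exists n; exact: ltW.
pose E := range (fun n : nat => phi n%:R).
have hE : has_inf E.
  by split; [exists (phi 0%:R); exists 0%N | exists e => _ [n _ <-]].
have Lge : e <= inf E by apply: lb_le_inf hE.1 _ => _ [n _ <-].
have L0 : 0 < inf E by exact: lt_le_trans Lge.
have L8 : 0 < inf E / 8 by rewrite divr_gt0.
have [_ [m _ <-] hm] := inf_adherent L8 hE.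
have [T T0 hT] := rv_ratio (ltr0n R 2) (divr_gt0 ltr01 (ltr0n R 4)).
pose n := maxn m (Num.truncn T).+1.
have Tn : T <= n%:R.
  have /andP[_ /ltW/le_trans] := truncn_itv (ltW T0); apply.
  by rewrite ler_nat leq_maxr.
have /andP[_] := hT _ Tn; rewrite -natrM => h.
have : inf E <= phi (2 * n)%:R by apply: (ge_inf hE.2); exists (2 * n)%N.
have : phi n%:R <= phi m%:R by rewrite phi_decr// ler_nat leq_maxl.
by move: h hm L0; lra.
Qed.

Variable c : R.
Hypothesis c_ge0 : 0 <= c.

Let D (t : R) : R := \int[lebesgue_measure]_(s in `[0, t]) phi s.

Lemma phi_integrable (t : R) :
  lebesgue_measure.-integrable (`[0, t] : set R) (EFin \o phi).
Proof.
apply: measurable_bounded_integrable => //.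
- rewrite /= lebesgue_measure_itv/=; by case: ifP => _; rewrite ?ltry.
- have [mphi _] := phi_rv; apply: measurable_funS mphi => //.
  by move=> x /=; rewrite !in_itv/= => /andP[->].
- exists (phi 0); split; first exact: num_real.
  move=> M M0 x /=; rewrite in_itv/= => /andP[x0 _].
  by rewrite ger0_norm ?(ltW (phi_gt0 x0))// (le_trans (phi_decr (lexx 0) x0))// ltW.
Qed.

(** phi >= phi t on [s, t]. *)
Lemma Phi_step (s t : R) : 0 <= s -> s <= t -> D s + (t - s) * phi t <= D t.
Proof.
move=> s0 st; rewrite -lerBrDl /D.
rewrite Rintegral_itvB ?bnd_simp//; last exact: phi_integrable.
have sub : [set` Interval (BRight s) (BRight t)] `<=` (`[0, t] : set R).
  by move=> x /=; rewrite !in_itv/= => /andP[sx ->]; rewrite (le_trans s0 (ltW sx)).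
have mI : measurable ([set` Interval (BRight s) (BRight t)] : set R).
  exact: measurable_itv.
apply: (@le_trans _ _ (\int[lebesgue_measure]_(x in [set` Interval (BRight s) (BRight t)]) phi t)).
  rewrite Rintegral_cst// /= lebesgue_measure_itv/= mulrC.
  case: ifPn; rewrite lte_fin => // h; rewrite ler_wpM2l//.
    by rewrite ltW// phi_gt0// (le_trans s0).
  by move: h; rewrite -leNgt/=; lra.
apply: le_Rintegral => //.
- apply: measurable_bounded_integrable => //.
    rewrite /= lebesgue_measure_itv/=; by case: ifP => _; rewrite ?ltry.
  exists (phi t); split; first exact: num_real.
  move=> M M0 x _; rewrite ger0_norm ?ltW// phi_gt0//.
  exact: le_trans st.
- by apply: integrableS (phi_integrable t).
- move=> x /=; rewrite in_itv/= => /andP[sx xt]; apply: phi_decr => //.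
  exact: le_trans s0 (ltW sx).
Qed.

Lemma D_ge0 t : 0 <= D t.
Proof.
rewrite /D Rintegral_ge0// => x /=; rewrite in_itv/= => /andP[x0 _].
by rewrite ltW// phi_gt0.
Qed.

Lemma Phi_ge1 (n : nat) : phi 1 <= Phi phi c n.+1%:R.
Proof.
have := @Phi_step 0 1 (lexx 0) ler01; rewrite subr0 mul1r => h1.
have n1 : 1 <= n.+1%:R :> R by rewrite ler1n.
have := @Phi_step 1 n.+1%:R ler01 n1 => h2.
have : 0 <= (n.+1%:R - 1) * phi n.+1%:R.
  by rewrite mulr_ge0 ?subr_ge0// ltW// phi_gt0.
rewrite /Phi -/(D _); have := D_ge0 0; move: h1 h2 c_ge0; lra.
Qed.

Lemma Phi_gt0 (n : nat) : 0 < Phi phi c n.+1%:R.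
Proof. by rewrite (lt_le_trans _ (Phi_ge1 n))// phi_gt0. Qed.

Lemma sum_phi_le : exists2 C : R, 0 < C &
  forall n : nat, \sum_(k < n.+1) phi k%:R <= C * Phi phi c n.+1%:R.
Proof.
have p1 : 0 < phi 1 by exact: phi_gt0.
have p0 : 0 < phi 0 / phi 1 by rewrite divr_gt0 ?phi_gt0.
exists (phi 0 / phi 1 + 1); first by rewrite addr_gt0.
move=> n; rewrite mulrDl mul1r.
have : phi 0 <= phi 0 / phi 1 * Phi phi c n.+1%:R.
  rewrite -mulrA ler_peMr ?(ltW (phi_gt0 _))//.
  by rewrite mulrC ler_pdivlMr// mul1r Phi_ge1.
suff : \sum_(k < n.+1) phi k%:R <= phi 0 + D n%:R.
  have n0 : (n%:R : R) <= n.+1%:R by rewrite ler_nat.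
  have := @Phi_step n%:R n.+1%:R (ler0n _ _) n0.
  have : 0 <= (n.+1%:R - n%:R) * phi n.+1%:R.
    by rewrite mulr_ge0 ?subr_ge0// ltW// phi_gt0.
  by rewrite /Phi -/(D _); move: c_ge0; lra.
elim: n => [|n IH]; first by rewrite big_ord1 lerDl D_ge0.
rewrite big_ord_recr/=.
have n0 : (n%:R : R) <= n.+1%:R by rewrite ler_nat.
have := @Phi_step n%:R n.+1%:R (ler0n _ _) n0.
have -> : n.+1%:R - n%:R = 1 :> R by rewrite -natr1 addrAC subrr add0r.
by move: IH; lra.
Qed.

(** Karamata's theorem at the critical index: each dyadic block of the integral
    contributes about t phi(t) / 2, so the integral dominates t phi(t). *)
Lemma Phi_dominates (J : nat) : exists2 T : R, 0 < T & forall t, T <= t ->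
  J%:R / 4 * (t * phi t) <= D t.
Proof.
elim: J => [|J [T T0 IH]].
  by exists 1 => // t _; rewrite mul0r mul0r D_ge0.
have eta0 : 0 < (J.+1%:R)^-1 :> R by rewrite invr_gt0 ltr0n.
have h2 : 0 < 2^-1 :> R by rewrite invr_gt0.
have [T1 T10 hT1] := rv_ratio h2 eta0.
exists (2 * T + T1); first by rewrite addr_gt0// mulr_gt0.
move=> t Tt; have t0 : 0 < t by move: T0 T10 Tt; lra.
have pt := phi_gt0 (ltW t0).
have /hT1/andP[h _] : T1 <= t by move: T0 T10 Tt; lra.
have /IH IHt : T <= 2^-1 * t by move: T0 T10 Tt; lra.
have st := @Phi_step (2^-1 * t) t (ltW (mulr_gt0 h2 t0)) _.
have /st{}st : 2^-1 * t <= t by lra.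
apply: le_trans st; rewrite invrK in h.
have k0 : 0 <= J%:R / 4 * (2^-1 * t) by rewrite !mulr_ge0// ltW.
have h3 := ler_wpM2l k0 h.
have tp : 0 < t * phi t by rewrite mulr_gt0.
have Je : J%:R * (J.+1%:R)^-1 <= 1 :> R.
  by rewrite ler_pdivrMr ?ltr0n// mul1r ler_nat.
have {}Je := ler_wpM2r (ltW tp) Je.
move: h3 IHt Je tp; set e := (J.+1%:R)^-1; rewrite -[J.+1%:R]natr1.
set q := D _; set P := phi (2^-1 * t); set p := phi t; set j := J%:R => h3 IHt Je tp.
by lra.
Qed.

Lemma nphi_Phi_small (e : R) : 0 < e -> \forall n \near \oo,
  n.+1%:R * phi n.+1%:R <= e * Phi phi c n.+1%:R.
Proof.
move=> e0; pose J := (Num.truncn (4 / e)).+1.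
have J0 : 4 / e < J%:R.
  by have /andP[_] := truncn_itv (ltW (divr_gt0 (ltr0n R 4) e0)).
have [T T0 hT] := Phi_dominates J.
exists (Num.truncn T).+1 => // n /= nT.
have Tn : T <= n.+1%:R.
  have /andP[_ /ltW/le_trans] := truncn_itv (ltW T0); apply.
  by rewrite ler_nat ltnW.
have /hT := Tn; rewrite -/(D _) => h.
have : D n.+1%:R <= Phi phi c n.+1%:R by rewrite /Phi lerDl.
move=> /(le_trans h)/(ler_wpM2l (ltW e0)); apply: le_trans.
rewrite mulrA -[leLHS]mul1r ler_wpM2r//.
  by rewrite mulr_ge0// ltW// phi_gt0.
by move: J0; rewrite ltr_pdivrMr//; lra.
Qed.

End RegularVariation.

(** * Eigenvalues and diagonal sums of a product B W *)

Section Estimates.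
Context {R : realType} {H : hilbertSpace R}.
Implicit Types (A B W K : H -> H) (x y : H).

(** A bound for the size of A off n vectors, as for approximation numbers; the
    explicit family g makes such bounds easy to combine. *)
Definition codim_bound A (g : nat -> H) (b : nat -> R) : Prop :=
  forall n x, (forall j, (j < n)%N -> '[x, g j] = 0) -> nm (A x) <= b n * nm x.

(** By Parseval's identity |V x|^2 is the sum of the (mu k |<x, e k>|)^2, and the
    terms with k < n vanish. *)
Lemma basis_codim_bound (e : nat -> H) V (mu : nat -> R) : orthonormal_basis e ->
  selfadj V -> (forall n, V (e n) = (mu n)%:C *: e n) ->
  (forall n, 0 <= mu n) -> (forall i j, (i <= j)%N -> mu j <= mu i) ->
  codim_bound V e mu.
Proof.
move=> [eo eb] Vs Ve mu0 mum n x hx.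
have fo : orthofam (fun=> true) e by move=> i j; rewrite eo andbT.
apply: cvgr_to_le (cvg_nm (eb (V x))) _; near=> N.
rewrite -(ler_pXn2r (_ : 0 < 2)%N) ?nnegrE ?mulr_ge0 ?nm_ge0//.
rewrite -(big_mkord xpredT (fun k => '[V x, e k] *: e k)).
rewrite (le_trans (fam_nm_sum fo (fun k => '[V x, e k]) _ _))// big_mkord.
rewrite exprMn; apply: (@le_trans _ _ (mu n ^+ 2 * \sum_(k < N) nm '[x, e k] ^+ 2)).
  rewrite mulr_sumr; apply: ler_sum => k _.
  rewrite Vs Ve innerZr conj_Creal ?complex_real// nmM exprMn nmC ger0_norm//.
  have [nk|kn] := leqP n k; last by rewrite hx// nm0 expr0n !mulr0.
  by rewrite ler_wpM2r ?sqr_ge0// ler_pXn2r ?nnegrE// mum.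
by rewrite ler_wpM2l ?sqr_ge0// (fam_Bessel fo).
Unshelve. all: by end_near. Qed.

Section Product.
Variables (K B W : H -> H) (e g : nat -> H) (b w : nat -> R).
Hypotheses (Kl : linear K) (Ks : selfadj K) (Ws : selfadj W).
Hypothesis KBW : forall x, `|qf K x| <= nm (B (W x)) * nm x.
Hypotheses (Bb : codim_bound B g b) (Ww : codim_bound W e w).
Hypotheses (b0 : forall n, 0 <= b n) (w0 : forall n, 0 <= w n).

Lemma qfN x : qf (fun x => - K x) x = - qf K x.
Proof. by rewrite /qf innerNl raddfN. Qed.

(** Min-max with 2n conditions: x orthogonal to e j and W x orthogonal to g j,
    for j < n, give |B W x| <= b n |W x| <= b n w n |x|. *)
Lemma prod_minmax A l f n : linear A -> (forall x, qf A x <= `|qf K x|) ->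
  eigsys A l f -> l (n + n)%N <= b n * w n.
Proof.
move=> Al AK Af.
pose s := [seq e j | j <- iota 0 n] ++ [seq W (g j) | j <- iota 0 n].
have ss : size s = (n + n)%N by rewrite size_cat !size_map !size_iota.
rewrite -ss; apply: (eig_minmax Af Al); last by rewrite mulr_ge0.
move=> x /perp_cat[xe xg].
have {}xe j : (j < n)%N -> '[x, e j] = 0.
  by move=> jn; apply/xe/mapP; exists j; rewrite ?mem_iota.
have {}xg j : (j < n)%N -> '[W x, g j] = 0.
  by move=> jn; rewrite Ws; apply/xg/mapP; exists j; rewrite ?mem_iota.
rewrite (le_trans (AK x))// (le_trans (KBW x))// expr2 mulrA ler_wpM2r ?nm_ge0//.
by rewrite (le_trans (Bb xg))// -mulrA ler_wpM2l// Ww.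
Qed.

Lemma eig_prod_le l f n : eigsys K l f -> l (n + n)%N <= b n * w n.
Proof. by apply: prod_minmax => // x; rewrite ler_norm. Qed.

Lemma eig_prod_le' l f n : eigsys (fun x => - K x) l f -> l (n + n)%N <= b n * w n.
Proof.
apply: prod_minmax => [a x y|x]; first by rewrite Kl scalerN opprD.
by rewrite qfN -normrN ler_norm.
Qed.

Variables (l l' : nat -> R) (f f' : nat -> H).
Hypotheses (Kf : eigsys K l f) (Kf' : eigsys (fun x => - K x) l' f').
Hypothesis eo : forall i j, '[e i, e j] = (i == j)%:R.

(** The diagonal sum and the eigenvalue sum of K are two partial traces on a
    common finite-dimensional space S, spanned by the first N basis vectors and
    the first N eigenvectors of either sign. Complete both families to bases of
    S. On the complement of the eigenvectors the form of K is at most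
    l N + l' N; on the complement of the basis vectors, of dimension at most 2N,
    W is at most w N, and the k-th new vector u can be chosen with |B W u| <= b k |W u|. *)
Lemma trace_estimate N : `|\sum_(k < N) qf K (e k) - (\sum_(k < N) l k - \sum_(k < N) l' k)|
   <= (N + N + N)%:R * (l N + l' N) + w N * \sum_(k < N + N) b k.
Proof.
have fo := eig_orth Kf; have fo' := eig_orth Kf'.
have eo' : orthofam (fun=> true) e by move=> i j; rewrite eo andbT.
pose E := famlist e N; pose F := famlist f N ++ famlist f' N.
have oE : orthon E by exact: famlist_orthon eo' N.
have Edef : E = [seq e i | i <- iota 0 N].
  apply/all_filterP; rewrite all_map; apply/allP => i _.
  exact: (fam_neq0 eo').
have sE : size E = N by rewrite Edef size_map size_iota.
have sF : (size F <= N + N)%N by rewrite size_cat leq_add ?famlist_size.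
have oF : orthon F.
  have h1 := famlist_orthon fo N; have h2 := famlist_orthon fo' N.
  move: h1 h2; rewrite /orthon pairwise_cat !all_cat => /andP[-> ->] /andP[-> ->].
  rewrite !andbT; apply/allrelP => a c; rewrite !mem_filter.
  move=> /andP[_ /mapP[i _ ->]] /andP[_ /mapP[j _ ->]].
  by rewrite (eig_cross Ks Kf Kf').
have [s [os ss Es Fs]] := orthon_hull F oE.
have sEs : (size E <= size s)%N by exact: orthon_size_le.
have sFs : (size F <= size s)%N by exact: orthon_size_le.
have [u [ur ou us hu]] := orthon_extend (fun j => W (g j)) os oE Es (subnKC sEs).
have [v [vr ov vs _]] := orthon_extend (fun=> 0) os oF Fs (subnKC sFs).
have Tu : \sum_(a <- u ++ E) '[K a, a] = \sum_(a <- s) '[K a, a].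
  apply: trace_indep => //; first by rewrite size_cat ur subnK.
  by move=> x; rewrite mem_cat => /orP[/us|/Es].
have Tv : \sum_(a <- v ++ F) '[K a, a] = \sum_(a <- s) '[K a, a].
  apply: trace_indep => //; first by rewrite size_cat vr subnK.
  by move=> x; rewrite mem_cat => /orP[/vs|/Fs].
pose su := \sum_(a <- u) qf K a; pose sv := \sum_(a <- v) qf K a.
have sumE : \sum_(a <- E) qf K a = \sum_(k < N) qf K (e k).
  by rewrite (famlist_sum e (g := qf K))// /qf inner0r.
have sumf : \sum_(a <- famlist f N) qf K a = \sum_(k < N) l k.
  rewrite (famlist_sum f (g := qf K)) /qf ?inner0r//; apply: eq_bigr => k _.
  rewrite (eig_vec Kf) innerZl fo eqxx/=; case: ltP => lk /=.
    by rewrite mulr1 mulr0 subr0.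
  by rewrite !mulr0 subr0; apply/le_anti; rewrite lk (eig_ge0 Kf).
have sumf' : \sum_(a <- famlist f' N) qf K a = - \sum_(k < N) l' k.
  rewrite (famlist_sum f' (g := qf K)) /qf ?inner0r// -sumrN; apply: eq_bigr => k _.
  rewrite -[K _]opprK (eig_vec Kf') innerNl innerZl fo' eqxx/=; case: ltP => lk /=.
    by rewrite mulr1 mulr0 subr0.
  rewrite !mulr0 subr0 oppr0; apply/eqP; rewrite eq_sym oppr_eq0; apply/eqP/le_anti.
  by rewrite lk (eig_ge0 Kf').
have tr : su + \sum_(k < N) qf K (e k) = sv + (\sum_(k < N) l k - \sum_(k < N) l' k).
  rewrite -sumE -sumf -sumf' /su /sv.
  by have := congr1 (@complex.Re R) (etrans Tu (esym Tv)); rewrite !big_cat/= !raddfD/= !raddf_sum.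
have perpv (t t' : seq H) a : orthon (t ++ t') -> a \in t -> perp t' a.
  rewrite /orthon pairwise_cat => /andP[/andP[/allrelP h _] _] at_ c ct.
  by apply/eqP/h.
have unit1 (t t' : seq H) a : orthon (t ++ t') -> a \in t -> nm a = 1.
  rewrite /orthon all_cat => /andP[_ /andP[/allP h _]] /h/eqP.
  rewrite innerxx => /(@complexI _ _ 1)/eqP; rewrite -[X in _ == X](expr1n _ 2).
  by rewrite eqrXn2 ?nm_ge0// => /eqP.
have hsv : `|sv| <= (N + N + N)%:R * (l N + l' N).
  rewrite (le_trans (ler_norm_sum _ _ _))//.
  apply: (@le_trans _ _ (\sum_(a <- v) (l N + l' N))).
    rewrite !big_seq; apply: ler_sum => a av.
    have /perp_cat[/perp_famlist h1 /perp_famlist h2] := perpv _ _ _ ov av.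
    have a1 := unit1 _ _ _ ov av.
    have := eig_bound Kf h1; have := eig_bound Kf' h2.
    rewrite qfN a1 expr1n !mulr1 -/(qf K a) ler_norml.
    move: (eig_ge0 Kf N) (eig_ge0 Kf' N) => h3 h4 h5 h6.
    by apply/andP; split; lra.
  rewrite big_const_seq count_predT iter_addr_0 -[leLHS]mulr_natl ler_wpM2r//.
    by rewrite addr_ge0 ?(eig_ge0 Kf) ?(eig_ge0 Kf').
  rewrite ler_nat vr (leq_trans (leq_subr _ _))// (leq_trans ss)// sE -addnA.
  by rewrite leq_add2l.
have hsu : `|su| <= w N * \sum_(k < N + N) b k.
  rewrite /su (big_nth 0) big_mkord (le_trans (ler_norm_sum _ _ _))//.
  apply: (@le_trans _ _ (\sum_(k < size u) w N * b k)).
    apply: ler_sum => k _; have ku := mem_nth 0 (ltn_ord k).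
    have a1 := unit1 _ _ _ ou ku; have /perp_famlist h1 := perpv _ _ _ ou ku.
    have := KBW u`_k; rewrite a1 mulr1 => /le_trans; apply.
    have h2 j : (j < k)%N -> '[W u`_k, g j] = 0.
      by move=> jk; rewrite Ws; apply: hu => //; rewrite -ur.
    rewrite (le_trans (Bb h2))// mulrC ler_wpM2r//.
    by rewrite (le_trans (Ww h1))// a1 mulr1.
  rewrite -mulr_sumr ler_wpM2l//.
  have ru : (size u <= N + N)%N by rewrite ur leq_subLR (leq_trans ss)// sE leq_add.
  rewrite -!(big_mkord xpredT b) (big_cat_nat _ ru)//= lerDl.
  by rewrite big_nat sumr_ge0.
rewrite [leLHS](_ : _ = `|sv - su|); last by congr (`|_|); move: tr; lra.
by rewrite (le_trans (ler_normB _ _))// lerD.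
Qed.

End Product.

End Estimates.

(** * The trace of a self-adjoint operator *)

Section Bounds.
Context {R : realType} {H : hilbertSpace R}.
Variable phi : R -> R.
Hypothesis phi_gt0 : forall t, 0 <= t -> 0 < phi t.
Implicit Types (A B W V P Q : H -> H).

Let phin_gt0 (n : nat) : 0 < phi n%:R. Proof. exact: phi_gt0. Qed.

Lemma Lphi_bound A : Lphi phi A -> exists2 C : R, 0 < C &
  forall n, singular_value A n <= C * phi n%:R.
Proof.
move=> [_ [M hM]]; exists (`|M| + 1); first by rewrite ltr_wpDl.
move=> n; rewrite -ler_pdivrMr// (@le_trans _ _ M)//; first by apply: hM; exists n.
by rewrite (le_trans (ler_norm _))// lerDl.
Qed.

Lemma Lphi_intro A P m g C : compact_op A -> is_absop A P -> eigsys P m g ->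
  vanishing m -> (forall n, m n <= C * phi n%:R) -> Lphi phi A.
Proof.
move=> Ac AP Pm mv mC; split=> //; exists C => _ [n _ <-].
by rewrite (singular_valueE AP Pm mv) ler_pdivrMr.
Qed.

Lemma root_codim_bound V W r (e : nat -> H) C : 0 < r <= 1 -> is_powop V r W ->
  orthonormal_basis e -> (forall n, V (e n) = (singular_value V n)%:C *: e n) ->
  0 < C -> (forall n, singular_value V n <= C * phi n%:R) ->
  codim_bound W e (fun n => C `^ r * phi n%:R `^ r).
Proof.
move=> r01 VW eb Ve C0 hC n x hx.
have Vp : positive_op V by case: VW.
have Vx := basis_codim_bound eb (pos_selfadj Vp) Ve (singular_value_ge0 V)
  (fun i j ij => singular_value_mono V ij) hx.
rewrite -powRM ?(ltW C0) ?(ltW (phin_gt0 n))//.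
apply: (powop_root_bound r01 VW); first exact: mulr_gt0.
by rewrite (le_trans Vx)// ler_wpM2r ?nm_ge0.
Qed.

Lemma absop_nm A P x : is_absop A P -> nm (A x) = nm (P x).
Proof.
move=> [Pp [A' [AA' PP]]].
have Ps := pos_selfadj Pp.
apply/eqP; rewrite -(eqrXn2 (_ : 0 < 2)%N) ?nm_ge0//; apply/eqP/complexI.
rewrite -!innerxx AA' Ps; congr '[x, _].
by have := congr1 (@^~ x) PP.
Qed.

(** With q the conjugate exponent of p > 1, take for g the eigenvectors of |B|^q.
    Its eigenvalues are O(phi), and powop_power_bound turns this into a bound
    for |B| by phi^(1/q), where 1/q = 1 - 1/p. For p = 1 boundedness of B is
    what is claimed. *)
Lemma conj_codim_bound B p : 1 <= p -> Lphi_pow phi (conj_exponent p) B ->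
  exists g C, 0 < C /\ codim_bound B g (fun n => C * phi n%:R `^ (1 - p^-1)).
Proof.
move=> p1; rewrite /conj_exponent; case: eqVneq => [->|pn1].
  move=> [/bounded_opP[_ [M M0 BM]] _]; exists (fun=> 0), M; split=> // n x _.
  by rewrite invr1 subrr powRr0 mulr1.
have {}p1 : 1 < p by rewrite lt_neqAle eq_sym pn1.
move=> [_ [P [Q [BP PQ QL]]]].
set q := p / (p - 1) in PQ.
have p10 : 0 < p - 1 by rewrite subr_gt0.
have p0 : 0 < p by exact: lt_trans p1.
have q1 : 1 <= q by rewrite /q ler_pdivlMr// mul1r lerBlDr lerDl.
have qE : q^-1 = 1 - p^-1 by rewrite /q invf_div mulrBl mulfV ?gt_eqF// mul1r.
have Qp : positive_op Q by apply: powop_pos PQ; exact: lt_le_trans q1.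
have Qs := pos_selfadj Qp; have [Qb _] := Qp; have Ql : linear Q by case: Qb.
have [Qc _] := QL.
have [m [g Qm]] := eigsys_exists Qb Qs Qc.
have mE := singular_valueE (pos_absop Qp) Qm (eigsys_vanishing Qc Qm).
have [C C0 hC] := Lphi_bound QL.
exists g, (C `^ q^-1); split; first exact: powR_gt0.
move=> n x hx; rewrite -qE -powRM ?(ltW C0) ?(ltW (phin_gt0 n))//.
rewrite (absop_nm x BP); set s := C * phi n%:R.
have s0 : 0 < s by exact: mulr_gt0.
apply: (powop_power_bound q1 PQ s0).
have ms : m n <= s by rewrite -mE.
have Qperp y : (forall j, (j < n)%N -> '[y, g j] = 0) ->
    forall j, (j < n)%N -> '[Q y, g j] = 0.
  by move=> hy j jn; rewrite Qs (eig_vec Qm) innerZr hy// mulr0.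
have qs y : (forall j, (j < n)%N -> '[y, g j] = 0) -> qf Q y <= s * nm y ^+ 2.
  by move=> /(eig_bound Qm)/le_trans; apply; rewrite ler_wpM2r// sqr_ge0.
have sx : 0 <= s * nm x by exact: mulr_ge0 (ltW s0) (nm_ge0 _).
rewrite -(ler_pXn2r (_ : 0 < 2)%N) ?nnegrE ?nm_ge0//.
have Q0 y : 0 <= qf Q y by rewrite -ler0c -qfE//; case: Qp.
rewrite (le_trans (psd_bound Ql Qs s0 (qs _ (Qperp _ hx)) (Q0 _)))//.
by have := ler_wpM2l (ltW s0) (qs x hx); lra.
Qed.

End Bounds.

Section BoundedSeq.
Context {R : realType}.
Implicit Types a b : nat -> R[i].

Lemma bounded_seqP a : bounded_seq a <-> exists C : R, forall n, nm (a n) <= C.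
Proof.
split=> [[M [Mr hM]]|[C hC]].
  exists (Re M + 1) => n; rewrite -lecR -normE.
  have MR : M = (Re M)%:C by rewrite RRe_real.
  by apply: hM => //; rewrite {1}MR ltcR ltrDl.
exists C%:C; split; first by rewrite complex_real.
by move=> M CM n _ /=; rewrite normE (le_trans _ (ltW CM))// lecR.
Qed.

Lemma bounded_seqZD (z : R[i]) a b : bounded_seq a -> bounded_seq b ->
  bounded_seq (fun n => z * a n + b n).
Proof.
move=> /bounded_seqP[C hC] /bounded_seqP[D hD]; apply/bounded_seqP.
exists (nm z * C + D) => n; rewrite (le_trans (nmD _ _))// nmM lerD//.
by rewrite ler_wpM2l ?nm_ge0.
Qed.

Lemma bounded_seq_real (u : nat -> R) C : (forall n, `|u n| <= C) ->
  bounded_seq (fun n => (u n)%:C).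
Proof. by move=> uC; apply/bounded_seqP; exists C => n; rewrite nmC. Qed.

End BoundedSeq.

Section Trace.
Context {R : realType} {H : hilbertSpace R}.
Variables (phi : R -> R) (c : R).
Hypothesis phi_gt0 : forall t, 0 <= t -> 0 < phi t.
Hypothesis phi_decr : forall s t, 0 <= s -> s <= t -> phi t <= phi s.
Hypothesis phi_rv : regularly_varying_m1 phi.
Hypothesis c_ge0 : 0 <= c.
Variables (omega : (nat -> R[i]) -> R[i]) (Tr : (H -> H) -> R[i]).
Hypothesis omega_lim : extended_limit omega.
Hypothesis Tr_omega : is_Tr phi c omega Tr.
Variables (K B W : H -> H) (e g : nat -> H) (r C1 C2 : R).
Hypothesis e_basis : orthonormal_basis e.
Hypotheses (Kb : bounded_op K) (Ks : selfadj K) (Ka : almost_finite K).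
Hypothesis Ws : selfadj W.
Hypothesis KBW : forall x, `|qf K x| <= nm (B (W x)) * nm x.
Hypotheses (r01 : 0 < r <= 1) (C10 : 0 < C1) (C20 : 0 < C2).
Hypothesis Ww : codim_bound W e (fun n => C1 * phi n%:R `^ r).
Hypothesis Bb : codim_bound B g (fun n => C2 * phi n%:R `^ (1 - r)).

Let phin_gt0 (n : nat) : 0 < phi n%:R. Proof. exact: phi_gt0. Qed.

Let Kl : linear K. Proof. by case: Kb. Qed.

(** The sequence to which the extended limit is applied. *)
Definition diag_mean (A : H -> H) (n : nat) : R :=
  (Phi phi c n.+1%:R)^-1 * \sum_(k < n.+1) qf A (e k).

Let bw (n : nat) : C2 * phi n%:R `^ (1 - r) * (C1 * phi n%:R `^ r) = C2 * C1 * phi n%:R.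
Proof.
have E : phi n%:R `^ (1 - r) * phi n%:R `^ r = phi n%:R.
  rewrite -powRD; last by apply/implyP => _; rewrite gt_eqF.
  by rewrite subrK powRr1// ltW.
by rewrite -[X in _ = _ * X]E; ring.
Qed.

Let b0 (n : nat) : 0 <= C2 * phi n%:R `^ (1 - r).
Proof. by rewrite mulr_ge0 ?powR_ge0 ?(ltW C20). Qed.
Let w0 (n : nat) : 0 <= C1 * phi n%:R `^ r.
Proof. by rewrite mulr_ge0 ?powR_ge0 ?(ltW C10). Qed.

(** Min-max controls the values with even index only. *)
Lemma decay_of_even (m : nat -> R) (C : R) : 0 < C ->
  (forall i j, (i <= j)%N -> m j <= m i) -> (forall n, m (n + n)%N <= C * phi n%:R) ->
  exists2 D : R, 0 < D & forall n, m n <= D * phi n%:R.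
Proof.
move=> C0 mm hm; have [D D0 hD] := phi_divn phi_gt0 phi_decr phi_rv (isT : (0 < 2)%N).
exists (C * D); first exact: mulr_gt0.
move=> n; rewrite (le_trans (mm (n %/ 2 + n %/ 2)%N _ _))//; first by lia.
by rewrite (le_trans (hm _))// -mulrA ler_wpM2l// ltW.
Qed.

Lemma decay_vanishing (m : nat -> R) (D : R) : 0 < D ->
  (forall n, m n <= D * phi n%:R) -> vanishing m.
Proof.
move=> D0 hD eps eps0; have [n hn] := phi_vanishing phi_gt0 phi_decr phi_rv (divr_gt0 eps0 D0).
by exists n; rewrite (le_trans (hD n))// mulrC -ler_pdivlMr.
Qed.

Lemma oppK_eigsys : exists l f, eigsys (fun x => - K x) l f.
Proof.
have Nl : linear (fun x => - K x) by move=> a x y; rewrite Kl scalerN opprD.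
apply: eigsys_exists.
- have /bounded_opP[_ [M M0 KM]] := Kb; apply/bounded_opP; split=> //.
  by exists M => // x; rewrite nmN.
- by move=> x y; rewrite innerNl innerNr Ks.
- apply: almost_finite_compact => // eps /Ka[s hs]; exists s => x /hs.
  by rewrite nmN.
Qed.

(** Eigenvalues of either sign are O(phi) by min-max, so the positive and negative
    parts S and S' of K are in the ideal, and the trace of K is the extended
    limit of the means of l - l'. By trace_estimate these differ from the
    diagonal means by O(N phi(N) / Phi(N)), with N = n + 1: for
    w N sum_(k < 2N) b k, use the sum of the phi(k)^(1-r) and
    phi^r phi^(1-r) = phi. The difference tends to 0. *)
Lemma selfadj_trace : [/\ Lphi phi K, bounded_seq (fun n => (diag_mean K n)%:C) &
  Tr K = omega (fun n => (diag_mean K n)%:C)].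
Proof.
have Kc := almost_finite_compact Kl Ka.
have [l [f Kf]] := eigsys_exists Kb Ks Kc; have [l' [f' Kf']] := oppK_eigsys.
have C210 : 0 < C2 * C1 by exact: mulr_gt0.
have [D D0 hD] : exists2 D : R, 0 < D & forall n, l n <= D * phi n%:R.
  apply: (decay_of_even C210 (eig_mono Kf)) => n; rewrite -bw.
  exact: (eig_prod_le Kl Ws KBW Bb Ww b0 w0 n Kf).
have [D' D'0 hD'] : exists2 D : R, 0 < D & forall n, l' n <= D * phi n%:R.
  apply: (decay_of_even C210 (eig_mono Kf')) => n; rewrite -bw.
  exact: (eig_prod_le' Kl Ws KBW Bb Ww b0 w0 n Kf').
have lv := decay_vanishing D0 hD; have lv' := decay_vanishing D'0 hD'.
have l0 := eig_ge0 Kf; have l0' := eig_ge0 Kf'.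
have lm := eig_mono Kf; have lm' := eig_mono Kf'.
have fo := eig_orth Kf; have fo' := eig_orth Kf'.
pose S := diagop l f; pose S' := diagop l' f'.
have Sp : positive_op S by exact: diagop_pos.
have Sp' : positive_op S' by exact: diagop_pos.
have SL : Lphi phi S.
  apply: (Lphi_intro phi_gt0 _ (pos_absop Sp) (diagop_eigsys l0 lm fo) lv hD).
  apply: almost_finite_compact; first exact: diagop_linear.
  exact: diagop_almost_finite.
have SL' : Lphi phi S'.
  apply: (Lphi_intro phi_gt0 _ (pos_absop Sp') (diagop_eigsys l0' lm' fo') lv' hD').
  apply: almost_finite_compact; first exact: diagop_linear.
  exact: diagop_almost_finite.
have svS : singular_value S = l.
  exact: (singular_valueE (pos_absop Sp) (diagop_eigsys l0 lm fo) lv).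
have svS' : singular_value S' = l'.
  exact: (singular_valueE (pos_absop Sp') (diagop_eigsys l0' lm' fo') lv').
have absKP := absK_absop Kl Ks Kf Kf' lv lv'.
have Ac : almost_finite (absK l l' f f') by exact: absK_almost_finite Kf Kf' lv lv'.
have [m [h Am]] : exists m h, eigsys (absK l l' f f') m h.
  apply: eigsys_exists; first by case: absKP => -[].
    exact: (absK_selfadj Kf Kf').
  apply: almost_finite_compact => //; exact: (absK_linear Kf Kf').
have [D2 D20 hD2] : exists2 D : R, 0 < D & forall n, m n <= D * phi n%:R.
  apply: (@decay_of_even _ (D + D') (addr_gt0 D0 D'0) (eig_mono Am)) => n.
  rewrite (le_trans (absK_eig_le Kf Kf' n Am))// mulrDl.
  by rewrite lerD.
have KL : Lphi phi K.
  exact: (Lphi_intro phi_gt0 Kc absKP Am (decay_vanishing D20 hD2) hD2).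
pose a n := (Phi phi c n.+1%:R)^-1 * \sum_(k < n.+1) l k.
pose a' n := (Phi phi c n.+1%:R)^-1 * \sum_(k < n.+1) l' k.
have Phi0 n : 0 < Phi phi c n.+1%:R by exact: Phi_gt0.
have [E E0 hE] := sum_phi_le phi_gt0 phi_decr phi_rv c_ge0.
have mean_bnd (u : nat -> R) (F : R) : 0 < F -> (forall n, 0 <= u n) ->
    (forall n, u n <= F * phi n%:R) ->
    bounded_seq (fun n => ((Phi phi c n.+1%:R)^-1 * \sum_(k < n.+1) u k)%:C).
  move=> F0 u0 uF; apply: (@bounded_seq_real _ _ (F * E)) => n.
  rewrite ger0_norm; last first.
    by rewrite mulr_ge0 ?invr_ge0 ?(ltW (Phi0 n))// sumr_ge0.
  rewrite mulrC ler_pdivrMr// -mulrA.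
  apply: (@le_trans _ _ (F * \sum_(k < n.+1) phi k%:R)); last first.
    by rewrite ler_wpM2l ?(ltW F0).
  by rewrite mulr_sumr; apply: ler_sum.
have ab := mean_bnd l D D0 l0 hD; have ab' := mean_bnd l' D' D'0 l0' hD'.
have [oL _ _ oc0] := omega_lim; have [TrL TrP] := Tr_omega.
have TrK : Tr K = -1 * omega (fun n => (a' n)%:C) + omega (fun n => (a n)%:C).
  have -> : K = (fun x => -1 *: S' x + S x).
    by apply/funext => x; rewrite (eig_split Kl Ks Kf Kf' lv lv') scaleN1r addrC.
  by rewrite TrL// (TrP S)// (TrP S')// svS svS'.
rewrite -oL// in TrK.
pose d n := diag_mean K n - (a n - a' n).
have th01 : 0 <= 1 - r < 1 by case/andP: r01 => r0 r1; apply/andP; split; lra.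
have [F F0 hF] := sum_phi_powR phi_gt0 phi_decr phi_rv th01.
(* the two terms come from the two terms of trace_estimate *)
pose M := 3 * (D + D') + C1 * (C2 * (F * 2)).
have M0 : 0 < M by rewrite addr_gt0// !mulr_gt0// addr_gt0.
have dM n : `|d n| <= M * (n.+1%:R * phi n.+1%:R / Phi phi c n.+1%:R).
  have -> : d n = (Phi phi c n.+1%:R)^-1 *
     (\sum_(k < n.+1) qf K (e k) - (\sum_(k < n.+1) l k - \sum_(k < n.+1) l' k)).
    by rewrite /d /diag_mean /a /a' !mulrBr.
  rewrite normrM ger0_norm ?invr_ge0 ?(ltW (Phi0 n))//.
  rewrite [leRHS]mulrA [leRHS]mulrC ler_wpM2l ?invr_ge0 ?(ltW (Phi0 n))//.
  rewrite (le_trans (trace_estimate Kl Ks Ws KBW Bb Ww b0 w0 Kf Kf' e_basis.1 n.+1))//.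
  rewrite /M [leRHS]mulrDl lerD//.
    rewrite !natrD -[leRHS]mulrA.
    have -> : 3 * ((D + D') * (n.+1%:R * phi n.+1%:R)) =
      (n.+1%:R + n.+1%:R + n.+1%:R) * (D * phi n.+1%:R + D' * phi n.+1%:R) by ring.
    by rewrite ler_wpM2l// lerD.
  rewrite -mulr_sumr.
  have NN : (0 < n.+1 + n.+1)%N by [].
  have h1 := hF _ NN.
  have h2 : phi (n.+1 + n.+1)%:R `^ (1 - r) <= phi n.+1%:R `^ (1 - r).
    apply: ge0_ler_powR; rewrite ?nnegrE ?(ltW (phin_gt0 _))//.
      by case/andP: th01.
    by rewrite phi_decr// ler_nat leq_addr.
  have h3 : (n.+1 + n.+1)%:R * phi (n.+1 + n.+1)%:R `^ (1 - r) <=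
     2 * n.+1%:R * phi n.+1%:R `^ (1 - r).
    have -> : 2 * n.+1%:R = (n.+1 + n.+1)%:R :> R by rewrite natrD; ring.
    by rewrite ler_wpM2l.
  have h4 := le_trans h1 (ler_wpM2l (ltW F0) h3).
  rewrite (le_trans (ler_wpM2l (w0 _) (ler_wpM2l (ltW C20) h4)))//.
  have P : phi n.+1%:R `^ (1 - r) * phi n.+1%:R `^ r = phi n.+1%:R.
    rewrite -powRD; last by apply/implyP => _; rewrite gt_eqF.
    by rewrite subrK powRr1// ltW.
  rewrite -[X in _ <= _ * (_ * X)]P le_eqVlt; apply/orP; left; apply/eqP.
  by ring.
have d0 : ((fun n => (d n)%:C) : nat -> R[i]^o) @ \oo --> (0 : R[i]^o).
  apply/cvg_nmP => eps eps0; have eM : 0 < eps / M / 2 by rewrite !divr_gt0.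
  have := nphi_Phi_small phi_gt0 phi_decr phi_rv c_ge0 eM; apply: filterS => n hn.
  rewrite subr0 nmC (le_lt_trans (dM n))//.
  apply: (@le_lt_trans _ _ (M * (eps / M / 2))).
    by rewrite ler_wpM2l ?(ltW M0)// ler_pdivrMr.
  have -> : M * (eps / M / 2) = eps / 2 by field; rewrite gt_eqF.
  by rewrite ltr_pdivrMr// ltr_pMr// ltr1n.
have db : bounded_seq (fun n => (d n)%:C).
  apply: (@bounded_seq_real _ _ (M * E)) => n; rewrite (le_trans (dM n))//.
  rewrite ler_wpM2l ?(ltW M0)// ler_pdivrMr// (le_trans _ (hE n))//.
  rewrite mulr_natl -[X in _ *+ X]card_ord -sumr_const.
  by apply: ler_sum => k _; rewrite phi_decr// ler_nat ltnW.
have aab := bounded_seqZD (-1) ab' ab.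
have meanE : (fun n => (diag_mean K n)%:C) =
    (fun n => 1 * (d n)%:C + (-1 * (a' n)%:C + (a n)%:C)).
  apply/funext => n; rewrite mul1r mulN1r -rmorphN/= -!rmorphD/=.
  by congr (_%:C); rewrite /d; ring.
split=> //; first by rewrite meanE; exact: bounded_seqZD.
by rewrite TrK meanE [RHS]oL// (oc0 _ d0) mulr0 add0r.
Qed.

End Trace.

(** * Real and imaginary parts; the trace formula *)

Section RealParts.
Context {R : realType} {H : hilbertSpace R}.
Implicit Types (A B W G : H -> H).

Lemma almost_finiteZ (z : R[i]) A : almost_finite A -> almost_finite (fun x => z *: A x).
Proof.
move=> Af eps eps0; have z1 : 0 < nm z + 1 by rewrite ltr_wpDl ?nm_ge0.
have [s hs] := Af _ (divr_gt0 eps0 z1); exists s => x /hs h.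
rewrite nmZ (le_trans (ler_wpM2l (nm_ge0 z) h))// mulrA ler_wpM2r ?nm_ge0//.
by rewrite mulrCA ger_pMr// ler_pdivrMr// mul1r lerDl.
Qed.

Lemma bounded_opZ (z : R[i]) A : bounded_op A -> bounded_op (fun x => z *: A x).
Proof.
move=> /bounded_opP[Al [M M0 AM]]; apply/bounded_opP; split.
  by move=> a x y; rewrite Al scalerDr !scalerA mulrC.
exists (nm z * M + 1); first by rewrite ltr_wpDl// mulr_ge0 ?nm_ge0 ?ltW.
move=> x; rewrite nmZ mulrDl mul1r ler_wpDr ?nm_ge0// -mulrA.
by rewrite ler_wpM2l ?nm_ge0.
Qed.

Section Product.
Variables (B B' W : H -> H) (e : nat -> H) (w : nat -> R).
Hypotheses (BB' : is_adjoint B B') (Ws : selfadj W).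
Hypotheses (Ww : codim_bound W e w) (wv : vanishing w).

Lemma almost_finite_lmul : bounded_op B -> almost_finite (B \o W).
Proof.
move=> /bounded_opP[_ [M M0 BM]] eps eps0; have [n wn] := wv (divr_gt0 eps0 M0).
exists [seq e j | j <- iota 0 n] => x hx /=.
rewrite (le_trans (BM _))//.
have hW : nm (W x) <= w n * nm x.
  by apply: Ww => j jn; apply/hx/mapP; exists j; rewrite ?mem_iota.
rewrite (le_trans (ler_wpM2l (ltW M0) hW))// mulrA ler_wpM2r ?nm_ge0//.
by rewrite mulrC -ler_pdivlMr.
Qed.

(** B' x is orthogonal to e j when x is orthogonal to B (e j). *)
Lemma almost_finite_rmul : bounded_op B' -> almost_finite (W \o B').
Proof.
move=> /bounded_opP[_ [M M0 BM]] eps eps0; have [n wn] := wv (divr_gt0 eps0 M0).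
exists [seq B (e j) | j <- iota 0 n] => x hx /=.
have hW : nm (W (B' x)) <= w n * nm (B' x).
  apply: Ww => j jn; apply: orthoC; rewrite -BB'; apply: orthoC.
  by apply/hx/mapP; exists j; rewrite ?mem_iota.
rewrite (le_trans hW)// (@le_trans _ _ (eps / M * (M * nm x)))//.
  by rewrite (le_trans (ler_wpM2r (nm_ge0 _) wn))// ler_wpM2l// divr_ge0 ?ltW.
by rewrite mulrA divfK// gt_eqF.
Qed.

End Product.

(** The real part of z G, when G' is the adjoint of G. *)
Definition real_part (z : R[i]) G G' : H -> H :=
  fun x => z / 2 *: G x + (z / 2)^* *: G' x.

Section RealPart.
Variables (z : R[i]) (G G' : H -> H).
Hypothesis GG' : is_adjoint G G'.

Lemma real_part_selfadj : selfadj (real_part z G G').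
Proof.
move=> x y; rewrite /real_part innerDl innerDr !innerZl !innerZr conjCK GG'.
have -> : '[G' x, y] = '[x, G y] by rewrite innerC -GG' -innerC.
by rewrite addrC.
Qed.

Lemma real_part_bounded : bounded_op G -> bounded_op G' ->
  bounded_op (real_part z G G').
Proof. by move=> Gb G'b; apply: bounded_opD; exact: bounded_opZ. Qed.

Lemma real_part_almost_finite : almost_finite G -> almost_finite G' ->
  almost_finite (real_part z G G').
Proof. by move=> Gf G'f; apply: almost_finiteD; exact: almost_finiteZ. Qed.

Lemma real_part_qf x : qf (real_part z G G') x = Re (z * '[G x, x]).
Proof.
rewrite /qf /real_part innerDl !innerZl.
have -> : '[G' x, x] = '[G x, x]^* by rewrite GG' -innerC.
rewrite -rmorphM/= raddfD/=.
have -> (a : R[i]) : Re a^* = Re a by case: a.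
have -> : z * '[G x, x] = z / 2 * '[G x, x] + z / 2 * '[G x, x].
  by rewrite -mulrDl -splitr.
by rewrite raddfD.
Qed.

End RealPart.

End RealParts.

Theorem theorem3p5 (R : realType) (H : hilbertSpace R)
  (H_sep : separable H) (H_inf : infinite_dim H)
  (phi : R -> R) (c : R)
  (phi_gt0 : forall t, 0 <= t -> 0 < phi t)
  (phi_decr : forall s t, 0 <= s -> s <= t -> phi t <= phi s)
  (phi_rv : regularly_varying_m1 phi)
  (c_ge0 : 0 <= c)
  (Phi_infty : Phi phi c t @[t --> +oo] --> +oo)
  (V : H -> H) (V_L : Lphi phi V) (V_pos : strictly_positive_op V)
  (e : nat -> H) (e_basis : orthonormal_basis e)
  (e_eigen : forall n, V (e n) = (singular_value V n)%:C *: e n)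
  (G : H -> H) (G_bounded : bounded_op G) (G_mod : weakly_modulated phi V G)
  (omega : (nat -> R[i]) -> R[i]) (omega_lim : extended_limit omega)
  (Tr : (H -> H) -> R[i]) (Tr_omega : is_Tr phi c omega Tr) :
  Tr G = omega (fun n => ((Phi phi c n.+1%:R)^-1)%:C *
                         \sum_(k < n.+1) inner (G (e k)) (e k)).
Proof.
have [p [p1 [W [B [VW BW BL]]]]] := G_mod.
have p0 : 0 < p by exact: lt_le_trans p1.
have r01 : 0 < p^-1 <= 1 by rewrite invr_gt0 p0 invf_le1.
have r0 : 0 < p^-1 by case/andP: r01.
have Wp := powop_pos r0 VW; have Ws := pos_selfadj Wp.
have [Wb _] := Wp; have [Bb _] := BL.
have [C C0 hC] := Lphi_bound phi_gt0 V_L.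
have C10 : 0 < C `^ p^-1 by exact: powR_gt0.
have Ww := root_codim_bound phi_gt0 r01 VW e_basis e_eigen C0 hC.
have [g [C2 [C20 Bg]]] := conj_codim_bound phi_gt0 p1 BL.
have wv : vanishing (fun n => C `^ p^-1 * phi n%:R `^ p^-1).
  move=> eps eps0; have q0 : 0 < eps / C `^ p^-1 by rewrite divr_gt0.
  have [n hn] := phi_vanishing phi_gt0 phi_decr phi_rv (powR_gt0 p q0).
  exists n; rewrite mulrC -ler_pdivlMr//.
  have -> : eps / C `^ p^-1 = ((eps / C `^ p^-1) `^ p) `^ p^-1.
    by rewrite -powRrM mulfV ?gt_eqF// powRr1// ltW.
  by apply: ge0_ler_powR; rewrite ?nnegrE ?powR_ge0 ?(ltW r0) ?(ltW (phi_gt0 _ _)).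
have [B' [B'b BB']] := adjoint_exists e_basis Bb.
have GE : G = B \o W by apply/funext => x; rewrite /= BW.
pose G' := W \o B'.
have GG' : is_adjoint G G' by move=> x y; rewrite GE /= BB' Ws.
have Gf : almost_finite G by rewrite GE; exact: almost_finite_lmul Ww wv Bb.
have G'f : almost_finite G' by exact: almost_finite_rmul BB' Ww wv B'b.
have G'b : bounded_op G'.
  have /bounded_opP[_ [M M0 GM]] := G_bounded.
  have [G'l G'M] := adjoint_bounded (ltW M0) GG' GM.
  by apply/bounded_opP; split=> //; exists M.
(* z = 1 and z = -i give the real and imaginary parts of G *)
have main (z : R[i]) : nm z = 1 -> let K := real_part z G G' in
  [/\ Lphi phi K, bounded_seq (fun n => (diag_mean phi c e K n)%:C) &
      Tr K = omega (fun n => (diag_mean phi c e K n)%:C)].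
  move=> z1 K; apply: (@selfadj_trace _ _ _ _ phi_gt0 phi_decr phi_rv c_ge0 _ _
    omega_lim Tr_omega K B W e g p^-1 _ _ e_basis _ _ _ Ws _ r01 C10 C20 Ww Bg).
  - exact: real_part_bounded.
  - exact: real_part_selfadj.
  - exact: real_part_almost_finite.
  - move=> x; rewrite real_part_qf// (le_trans (Re_le_nm _))// nmM z1 mul1r BW.
    exact: CauchySchwarz.
have ni : nm (- 'i%C : R[i]) = 1.
  by rewrite nmN /nm normc_def/= expr0n expr1n add0r sqrtr1.
have n1 : nm (1 : R[i]) = 1 by rewrite /nm normr1.
have [L1 b1 T1] := main 1 n1; have [L2 b2 T2] := main _ ni.
set K1 := real_part 1 G G' in L1 b1 T1; set K2 := real_part (- 'i%C) G G' in L2 b2 T2.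
have [TrL _] := Tr_omega; have [oL _ _ _] := omega_lim.
have i2 : 'i%C * 'i%C = -1 :> R[i] by rewrite -expr2 sqr_i.
have iJ : ('i%C)^* = - 'i%C :> R[i].
  by rewrite /Num.conj/=; apply/eqP; rewrite eq_complex/= oppr0 !eqxx.
have hJ : (2^-1)^* = 2^-1 :> R[i] by rewrite conj_Creal// realE invr_ge0 ler0n.
have -> : Tr G = 'i%C * Tr K2 + Tr K1.
  rewrite -TrL//; congr Tr; apply/funext => x.
  rewrite /K1 /K2 /real_part scalerDr !scalerA.
  have -> : 'i%C * (- 'i%C / 2) = 2^-1 :> R[i].
    by rewrite mulrA mulrN i2 opprK mul1r.
  have -> : 'i%C * (- 'i%C / 2)^* = - 2^-1 :> R[i].
    by rewrite rmorphM rmorphN/= iJ opprK hJ mulrA i2 mulN1r.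
  rewrite rmorphM/= rmorph1 hJ mul1r scaleNr.
  by rewrite addrACA addNr addr0 -scalerDl -[in RHS]mulr2n -[_ *+ 2]mulr_natr mulVf ?scale1r.
rewrite T1 T2 -oL//; congr omega; apply/funext => n.
rewrite /diag_mean !rmorphM/= !rmorph_sum/= mulrCA -mulrDr; congr (_ * _).
rewrite mulr_sumr -big_split/=; apply: eq_bigr => k _.
rewrite !real_part_qf// mul1r mulNr raddfN/= mulrC.
rewrite [RHS]complexE addrC; congr (_ + _).
by rewrite mulrC; congr (_ * _%:C); rewrite mulrC ReiNIm opprK.
Qed.
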